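(* Let $(a_{nk})_{n,k\ge0}$ be complex scalars with $\sum_{k\ge0}|a_{nk}|<\infty$ for each $n\ge0$. Then the following are equivalent: (i) $\sum_{k\ge0}a_{nk}\hat f(k)z^k\to f$ weakly in $A(\mathbb D)$, for all $f\in A(\mathbb D)$; (ii) $\sum_{k\ge0}a_{nk}\hat f(k)z^k\to f$ in sup-norm, for all $f\in A(\mathbb D)$; (iii) $\sum_{k\ge0}a_{nk}\hat\mu(k)z^k\to K\mu$ weak* in $\mathcal K$, for all $\mu\in M(\mathbb T)$; (iv) $\sum_{k\ge0}a_{nk}\hat g(k)z^k\to Kg$ weak* in $\mathcal K$, for all $g\in L^1(\mathbb T)$; (v) for all $g\in L^1(\mathbb T)$, $\operatorname{dist}_{L^1}\bigl(\sum_{k\ge0}a_{nk}\hat g(k)e^{ikt}-g,\ \overline{H^1_0}\bigr)\to0$, i.e. the classes converge in the quotient norm of $L^1(\mathbb T)/\overline{H^1_0}$.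
   Context: $A(\mathbb D)$ is the disk algebra (holomorphic functions on the unit disk $\mathbb D$ continuous on $\overline{\mathbb D}$) with sup-norm, and $\hat f(k)$ are Taylor coefficients. $M(\mathbb T)$ is the space of finite complex Borel measures on the unit circle, $\hat\mu(k)=\int\overline\zeta^k d\mu(\zeta)$, and $L^1(\mathbb T)$ is identified with measures $g\,dt/2\pi$. $\overline{H^1_0}:=\{h\in L^1(\mathbb T):\hat h(k)=0\ \forall k\ge0\}$. The Cauchy transform is $K\mu(z):=\int_{\mathbb T}\frac{d\mu(\zeta)}{1-\overline\zeta z}=\sum_{k\ge0}\hat\mu(k)z^k$, and $\mathcal K:=\{K\mu:\mu\in M(\mathbb T)\}$ with norm $\|K\mu\|_{\mathcal K}:=\operatorname{dist}(\mu,\overline{H^1_0})$ (total variation). $\mathcal K$ is identified with $A(\mathbb D)^*$ via $\langle f,K\mu\rangle=\int_{\mathbb T}f(\zeta)\,d\mu(\overline\zeta)=\lim_{r\to1^-}\sum_{k\ge0}\hat f(k)\hat\mu(k)r^k$; weak* refers to this duality. A polynomial $\sum_k c_kz^k$ is regarded as the element $K(\sum_kc_ke^{ikt}dt/2\pi)$ of $\mathcal K$. *)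

(* Defs.v *)
From HB Require Import structures.
From mathcomp Require Import all_boot all_order all_algebra.
From mathcomp Require Import complex.
From mathcomp Require Import all_classical all_reals all_analysis.

Set Implicit Arguments.
Unset Strict Implicit.
Unset Printing Implicit Defensive.

Import Order.TTheory GRing.Theory Num.Theory.
Import numFieldNormedType.Exports.
Import ComplexField.

Local Open Scope ring_scope.
Local Open Scope classical_set_scope.

HB.instance Definition _ (R : realType) := NormedModule.copy R[i] R[i]^o.

Section Defs.
Variable R : realType.
Local Notation C := R[i].

Definition cabs (z : C) : R := Normc.normc z.

Definition expi (t : R) : C := (cos t +i* sin t)%C.

Definition csum (u : nat -> C) : C := limn (series u).

Definition cdisk : set C := [set z | cabs z <= 1].

(** A(D): holomorphic (complex differentiable) on the open disk and
    continuous on the closed disk (values outside the closed disk are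
    irrelevant). *)
Definition disk_algebra : set (C -> C) :=
  [set f | (forall z : C, cabs z < 1 -> derivable f z 1) /\
           {within cdisk, continuous f}].

Definition taylor (f : C -> C) (k : nat) : C :=
  derive1n k f 0 / (k`!)%:R.

Definition supnorm (f : C -> C) : R := sup [set cabs (f z) | z in cdisk].

Definition AD_dual (L : (C -> C) -> C) : Prop :=
  [/\ (forall f g, disk_algebra f -> disk_algebra g -> L (f \+ g) = L f + L g),
      (forall (c : C) f, disk_algebra f -> L (fun z => c * f z) = c * L f) &
      exists M : R, forall f, disk_algebra f -> cabs (L f) <= M * supnorm f].

(** ---------- the circle T, parametrised by t in [0, 2pi) via e^{it} ---------- *)

Definition Tdom : set R := [set t | 0 <= t < 2 * pi].

Definition cint (mu : {measure set (measurableTypeR R) -> \bar R})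
  (h : R -> C) : C :=
  ((\int[mu]_(t in Tdom) complex.Re (h t))%:C +
   'i * (\int[mu]_(t in Tdom) complex.Im (h t))%:C)%C.

(** M(T): a finite complex Borel measure on T written as
    (mu1 - mu2) + i (mu3 - mu4) with mu_j finite positive Borel measures
    (on R, restricted to [0,2pi)); every complex measure has this form. *)
Record cmeasure := CMeasure {
  cm1 : {finite_measure set (measurableTypeR R) -> \bar R};
  cm2 : {finite_measure set (measurableTypeR R) -> \bar R};
  cm3 : {finite_measure set (measurableTypeR R) -> \bar R};
  cm4 : {finite_measure set (measurableTypeR R) -> \bar R} }.

Definition cmhat (mu : cmeasure) (k : nat) : C :=
  let e := fun t => expi (- (k%:R * t)) in
  (cint (cm1 mu) e - cint (cm2 mu) e + 'i * (cint (cm3 mu) e - cint (cm4 mu) e))%C.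

Definition L1T (g : R -> C) : Prop :=
  lebesgue_measure.-integrable Tdom (fun t => (complex.Re (g t))%:E) /\
  lebesgue_measure.-integrable Tdom (fun t => (complex.Im (g t))%:E).

(** \hat g(k) = \int e^{-ikt} g(t) dt/2pi  (g identified with g dt/2pi) *)
Definition ghat (g : R -> C) (k : nat) : C :=
  ((2 * pi)^-1)%:C%C * cint lebesgue_measure (fun t => g t * expi (- (k%:R * t))).

(** L^1 norm = total variation of g dt/2pi *)
Definition l1norm (g : R -> C) : R :=
  (2 * pi)^-1 * \int[lebesgue_measure]_(t in Tdom) cabs (g t).

Definition H10bar : set (R -> C) :=
  [set h | L1T h /\ forall k, ghat h k = 0].

Definition dist_H10bar (h : R -> C) : R :=
  inf [set l1norm (h \- u) | u in H10bar].

(** duality <f, b> for f in A(D) and b = \sum_k b_k z^k in K: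
    lim_{r -> 1^-} \sum_k \hat f(k) b_k r^k *)
Definition pairK (f : C -> C) (b : nat -> C) : C :=
  lim ((fun r : R => csum (fun k => taylor f k * b k * (r%:C%C) ^+ k)) @ 1^'-).

End Defs.

(* Main.v *)
(** Let T_n f be the multiplier transform of f in the disk algebra with coefficients
    a_nk.  Transposition gives <f, a_n . mu^> = <T_n f, mu^>, so (i) yields (iii), (iii)
    contains (iv) because g dt/2pi is a measure, and (ii) yields (i) since functionals
    are bounded.  Conversely (iv) bounds the norms of the T_n by the
    uniform boundedness principle, and testing it on characters gives a_nk -> 1 for
    each k.  Hence T_n p -> p for polynomials p, which are dense, and (ii) follows.
    In the same way, (iv) gives (v) by density of trigonometric polynomials in L^1, once
    the quotient norm of L^1 modulo conj(H^1_0) is controlled by the pairing with the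
    disk algebra: this is the Hahn-Banach theorem, with functionals approximated
    by their Cesaro means.  Finally the pairing with f is continuous for the quotient
    norm, so (v) gives (iv).  The Taylor expansion of functions in the disk algebra
    comes from Goursat's theorem applied to f(exp w): integrals over circles of
    different radii agree up to the expected factor. *)
Require Import Defs.
From HB Require Import structures.
From mathcomp Require Import all_boot all_order all_algebra.
From mathcomp Require Import complex.
From mathcomp Require Import all_classical all_reals all_analysis.
From mathcomp Require Import measurable_realfun.
From mathcomp Require Import ring lra.
Import Order.TTheory GRing.Theory Num.Theory.
Import numFieldNormedType.Exports.
Import ComplexField.
Local Open Scope ring_scope.
Local Open Scope classical_set_scope.
Set Implicit Arguments.
Unset Strict Implicit.
Unset Printing Implicit Defensive.

(** Complex integrals are pairs of real integrals, so bounding one by the integral of the modulus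
    costs a factor 2; the coefficient bound and the complexified Hahn-Banach functional inherit it.
    All five statements concern limits, so such constants are simply carried along. [taylor] is
    defined by iterated derivatives at 0 whereas every estimate comes from Fourier integrals; the
    power series expansion joins the two and precedes any work on the disk algebra. One tool serves
    four times. Fejer means of a trace are Cesaro means of partial sums, which proves the expansion;
    Fejer kernels recover a sup-norm from pairings with L^1; Fejer means make trigonometric
    polynomials dense in L^1; and a functional evaluated at Fejer kernels becomes a bounded family
    of polynomials. The detour through duality for (v) has a reason: projecting onto nonnegative
    frequencies is unbounded on L^1, so the quotient norm cannot be computed from a canonical
    representative. On the circle the pairing is read through t -> f(e^(-it)), the reflection that
    matches the coefficient of z^k in f with e^(-ikt). *)

Section ComplexBasics.
Variable R : realType.
Local Notation C := R[i].
Implicit Types (z w : C) (x y : R).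

Lemma cabs_ge0 z : 0 <= cabs z.
Proof. by case: z => a b; rewrite /cabs /= sqrtr_ge0. Qed.

Lemma normCE z : `|z| = (cabs z)%:C%C.
Proof. by []. Qed.

Lemma cabs0 : cabs (0 : C) = 0.
Proof. exact: Normc.normc0. Qed.

Lemma cabs1 : cabs (1 : C) = 1.
Proof. exact: Normc.normc1. Qed.

Lemma cabs0_eq z : cabs z = 0 -> z = 0.
Proof. exact: Normc.eq0_normc. Qed.

Lemma cabsM z w : cabs (z * w) = cabs z * cabs w.
Proof. exact: Normc.normcM. Qed.

Lemma cabsD z w : cabs (z + w) <= cabs z + cabs w.
Proof. exact: le_normcD. Qed.

Lemma cabsN z : cabs (- z) = cabs z.
Proof. exact: normcN. Qed.

Lemma cabsB z w : cabs (z - w) <= cabs z + cabs w.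
Proof. by rewrite -(cabsN w) cabsD. Qed.

Lemma cabsBC z w : cabs (z - w) = cabs (w - z).
Proof. by rewrite -cabsN opprB. Qed.

Lemma cabs_dist z w : `|cabs z - cabs w| <= cabs (z - w).
Proof.
rewrite ler_norml lerBlDr lerNl opprB lerBlDr; apply/andP; split.
  by rewrite cabsBC (le_trans _ (cabsD _ _))// subrK.
by rewrite (le_trans _ (cabsD _ _))// subrK.
Qed.

Lemma cabsX z n : cabs (z ^+ n) = cabs z ^+ n.
Proof. by elim: n => [|n IH]; rewrite ?expr0 ?cabs1// !exprS cabsM IH. Qed.

Lemma cabsV z : cabs z^-1 = (cabs z)^-1.
Proof. exact: Normc.normcV. Qed.

Lemma cabs_real x : cabs x%:C%C = `|x|.
Proof. by rewrite /cabs /= expr0n/= addr0 sqrtr_sqr. Qed.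

Lemma cabs_nat n : cabs (n%:R : C) = n%:R.
Proof. by rewrite -(rmorph_nat (real_complex R)) cabs_real normr_nat. Qed.

Lemma cabs_sum (I : Type) (r : seq I) (P : pred I) (F : I -> C) :
  cabs (\sum_(i <- r | P i) F i) <= \sum_(i <- r | P i) cabs (F i).
Proof.
elim/big_ind2: _ => [|z a w b ha hb|//]; first by rewrite cabs0.
by apply: le_trans (cabsD _ _) _; apply: lerD.
Qed.

Lemma Re_subc z w : complex.Re (z - w) = complex.Re z - complex.Re w.
Proof. by case: z w => a b []. Qed.

Lemma Im_subc z w : complex.Im (z - w) = complex.Im z - complex.Im w.
Proof. by case: z w => a b []. Qed.

Lemma Re_addc z w : complex.Re (z + w) = complex.Re z + complex.Re w.
Proof. by case: z w => a b []. Qed.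

Lemma Im_addc z w : complex.Im (z + w) = complex.Im z + complex.Im w.
Proof. by case: z w => a b []. Qed.

Lemma Re_mulc z w :
  complex.Re (z * w) = complex.Re z * complex.Re w - complex.Im z * complex.Im w.
Proof. by case: z w => a b []. Qed.

Lemma Im_mulc z w :
  complex.Im (z * w) = complex.Re z * complex.Im w + complex.Im z * complex.Re w.
Proof. by case: z w => a b []. Qed.

Lemma Re_le_cabs z : `|complex.Re z| <= cabs z.
Proof.
case: z => a b; rewrite /cabs /= -sqrtr_sqr ler_sqrt ?lerDl ?sqr_ge0//.
by rewrite addr_ge0 ?sqr_ge0.
Qed.

Lemma Im_le_cabs z : `|complex.Im z| <= cabs z.
Proof.
case: z => a b; rewrite /cabs /= -sqrtr_sqr ler_sqrt ?lerDr ?sqr_ge0//.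
by rewrite addr_ge0 ?sqr_ge0.
Qed.

Lemma cabs_le_ReIm z : cabs z <= `|complex.Re z| + `|complex.Im z|.
Proof.
case: z => a b; rewrite /cabs /= -[leRHS]ger0_norm ?addr_ge0//.
rewrite -sqrtr_sqr ler_sqrt ?sqr_ge0// sqrrD !real_normK ?num_real//.
by rewrite -subr_ge0; set u := `|a| * `|b|; have : 0 <= u; [rewrite mulr_ge0|lra].
Qed.

Lemma cabs_expi x : cabs (expi x) = 1.
Proof. by rewrite /expi /cabs /= cos2Dsin2 sqrtr1. Qed.

Lemma expiD x y : expi (x + y) = expi x * expi y.
Proof.
rewrite /expi cosD sinD; apply/eqP; rewrite eq_complex /=.
by apply/andP; split; apply/eqP; ring.
Qed.

Lemma expi0 : expi (0 : R) = 1.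
Proof. by rewrite /expi cos0 sin0. Qed.

Lemma expiX x n : expi x ^+ n = expi (n%:R * x).
Proof.
elim: n => [|n IH]; first by rewrite mul0r expi0.
by rewrite exprS IH -expiD; congr expi; rewrite -natr1; ring.
Qed.

Lemma expiN x : expi (- x) = (expi x)^*%C.
Proof. by rewrite /expi cosN sinN. Qed.

(** The norm on [C] takes values in [C], whose order makes positive elements positive reals. Radii
    thus become real, and the convergence criteria below mention [cabs] only. *)
Lemma gt0_complexE (e : C) : 0 < e -> e = (complex.Re e)%:C%C /\ 0 < complex.Re e.
Proof. by case: e => a b; rewrite ltcE /= => /andP[/eqP -> ->]. Qed.

Lemma cvg_cabsP (T : Type) (F : set_system T) {FF : Filter F} (u : T -> C) (l : C) :
  u @ F --> l <-> forall e : R, 0 < e -> \forall x \near F, cabs (u x - l) < e.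
Proof.
split=> [/cvgrPdist_lt h e e0|h].
  have e0' : 0 < e%:C%C :> C by rewrite ltcR.
  by apply: filterS (h _ e0') => x; rewrite normCE ltcR cabsBC.
apply/cvgrPdist_lt => e /gt0_complexE[-> e0].
by apply: filterS (h _ e0) => x; rewrite normCE ltcR cabsBC.
Qed.

Lemma cvg_cabs0P (T : Type) (F : set_system T) {FF : Filter F} (u : T -> C) (l : C) :
  u @ F --> l <-> cabs (u x - l) @[x --> F] --> 0.
Proof.
rewrite cvg_cabsP; split=> [h|/cvgrPdist_lt h e e0].
  apply/cvgrPdist_lt => e e0; apply: filterS (h _ e0) => x.
  by rewrite sub0r normrN ger0_norm ?cabs_ge0.
by apply: filterS (h _ e0) => x; rewrite sub0r normrN ger0_norm ?cabs_ge0.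
Qed.

Lemma cvg_ReIm (T : Type) (F : set_system T) {FF : Filter F} (u : T -> C) (l : C) :
  u @ F --> l <-> (complex.Re (u x) @[x --> F] --> complex.Re l /\
                   complex.Im (u x) @[x --> F] --> complex.Im l).
Proof.
rewrite cvg_cabsP; split.
  move=> h; split; apply/cvgrPdist_lt => e e0; apply: filterS (h _ e0) => x;
    apply: le_lt_trans; rewrite distrC.
    by rewrite -Re_subc Re_le_cabs.
  by rewrite -Im_subc Im_le_cabs.
move=> [/cvgrPdist_lt h1 /cvgrPdist_lt h2] e e0.
have e2 : 0 < e / 2 by rewrite divr_gt0.
near=> x; apply: le_lt_trans (cabs_le_ReIm _) _; rewrite [ltRHS]splitr.
rewrite Re_subc Im_subc distrC [X in _ + X]distrC.
by apply: ltrD; near: x; [exact: h1|exact: h2].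
Unshelve. all: by end_near. Qed.

End ComplexBasics.

(** * Absolutely convergent complex series *)

Section ComplexSeries.
Variable R : realType.
Local Notation C := R[i].
Implicit Types (u v : nat -> C) (c : nat -> C) (z w : C).

Definition abs_summable u : Prop := cvgn (series (fun k => cabs (u k))).

Lemma csumE u s : series u @ \oo --> s -> csum u = s.
Proof. by move=> us; apply: cvg_lim. Qed.

Lemma Re_series u n : complex.Re (series u n) = series (fun k => complex.Re (u k)) n.
Proof.
rewrite /series /= !big_mkord.
by elim/big_ind2: _ => [//|z a w b <- <-|//]; rewrite Re_addc.
Qed.

Lemma Im_series u n : complex.Im (series u n) = series (fun k => complex.Im (u k)) n.
Proof.
rewrite /series /= !big_mkord.
by elim/big_ind2: _ => [//|z a w b <- <-|//]; rewrite Im_addc.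
Qed.

(** Real and imaginary parts are dominated by [cabs], so completeness of the reals applies to each.
    Without convergence [csum] would only be the default value of [limn]. *)
Lemma abs_summable_cvg u : abs_summable u -> series u @ \oo --> csum u.
Proof.
move=> su.
have cR (g : nat -> R) : (forall k, `|g k| <= cabs (u k)) -> cvgn (series g).
  move=> gu; apply: normed_cvg.
  apply: (series_le_cvg _ _ gu su) => k //; exact: cabs_ge0.
have hR := cR _ (fun k => Re_le_cabs (u k)).
have hI := cR _ (fun k => Im_le_cabs (u k)).
set l := Complex (limn (series (fun k => complex.Re (u k))))
                 (limn (series (fun k => complex.Im (u k)))).
suff hl : series u @ \oo --> l by rewrite (csumE hl).
apply/cvg_ReIm; split.
  by under eq_fun do rewrite Re_series.
by under eq_fun do rewrite Im_series.
Qed.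

Lemma abs_summable_le u (v : nat -> R) :
  (forall k, cabs (u k) <= v k) -> cvgn (series v) -> abs_summable u.
Proof.
move=> uv cv; apply: (series_le_cvg _ _ uv cv) => k; first exact: cabs_ge0.
exact: le_trans (cabs_ge0 _) (uv k).
Qed.

(** Source of the truncation errors below: when [v] does not depend on a point at which [u] is
    evaluated, the bound is uniform in that point. *)
Lemma csum_tail_le u (v : nat -> R) n :
  (forall k, cabs (u k) <= v k) -> cvgn (series v) ->
  cabs (csum u - series u n) <= limn (series v) - series v n.
Proof.
move=> uv cv; have su := abs_summable_le uv cv.
have h1 : cabs (series u m - series u n) @[m --> \oo] --> cabs (csum u - series u n).
  apply/cvgrPdist_lt => e e0.
  have /cvg_cabsP/(_ _ e0) := abs_summable_cvg su; apply: filterS => m.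
  apply: le_lt_trans; rewrite cabsBC.
  apply: le_trans (cabs_dist _ _) _.
  by rewrite opprB addrA subrK.
have h2 : (series v m - series v n) @[m --> \oo] --> limn (series v) - series v n.
  by apply: cvgB => //; exact: cvg_cst.
apply: ler_cvg_to h1 h2 _; exists n => // m /= nm.
rewrite !sub_series_geq//; apply: le_trans (cabs_sum _ _ _) _.
by apply: ler_sum.
Qed.

Lemma csum_le u (v : nat -> R) : (forall k, cabs (u k) <= v k) -> cvgn (series v) ->
  cabs (csum u) <= limn (series v).
Proof.
move=> uv cv; have := csum_tail_le 0 uv cv.
by rewrite /series /= !big_geq// !subr0.
Qed.

Lemma csumD u v : abs_summable u -> abs_summable v ->
  csum (fun k => u k + v k) = csum u + csum v.
Proof.
move=> su sv; apply: csumE.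
rewrite (_ : series _ = series u + series v).
  by apply: cvgD; exact: abs_summable_cvg.
by apply/funext => n; rewrite /series /= big_split.
Qed.

Lemma csumZ (a : C) u : abs_summable u -> csum (fun k => a * u k) = a * csum u.
Proof.
move=> su; apply: csumE; apply/cvg_cabs0P.
rewrite (_ : (fun _ => _) = (fun n => cabs a * cabs (series u n - csum u))).
  rewrite -(mulr0 (cabs a)); apply: cvgM; first exact: cvg_cst.
  by apply/cvg_cabs0P; exact: abs_summable_cvg.
by apply/funext => n; rewrite -cabsM mulrBr /series /= mulr_sumr.
Qed.

Lemma abs_summableD u v : abs_summable u -> abs_summable v ->
  abs_summable (fun k => u k + v k).
Proof.
move=> su sv; apply: (abs_summable_le (v := fun k => cabs (u k) + cabs (v k))).
  by move=> k; exact: cabsD.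
rewrite (_ : series _ = series (fun k => cabs (u k)) + series (fun k => cabs (v k))).
  exact: is_cvgD.
by apply/funext => n; rewrite /series /= big_split.
Qed.

Lemma abs_summableZ (a : C) u : abs_summable u -> abs_summable (fun k => a * u k).
Proof.
move=> su; rewrite /abs_summable; under eq_fun do rewrite cabsM.
exact: is_cvg_seriesZ.
Qed.

Lemma csumB u v : abs_summable u -> abs_summable v ->
  csum (fun k => u k - v k) = csum u - csum v.
Proof.
move=> su sv; have sv' := abs_summableZ (a := -1) sv.
rewrite -mulN1r -csumZ// -csumD//; congr csum; apply/funext => k.
by rewrite mulN1r.
Qed.

Lemma abs_summableB u v : abs_summable u -> abs_summable v ->
  abs_summable (fun k => u k - v k).
Proof.
move=> su sv; have := abs_summableD su (abs_summableZ (a := -1) sv).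
by congr abs_summable; apply/funext => k; rewrite mulN1r.
Qed.

Lemma abs_summable_shift u : abs_summable u -> abs_summable (fun k => u k.+1).
Proof.
move=> /cvg_ex[l ul]; apply/cvg_ex; exists (l - cabs (u 0%N)).
have -> : series (fun k => cabs (u k.+1)) =
  (fun n => series (fun k => cabs (u k)) n.+1 - cabs (u 0%N)).
  by apply/funext => n; rewrite /series /= big_nat_recl//= addrC addKr.
by apply: cvgB; [rewrite (cvg_shiftS (series (fun k => cabs (u k))))|exact: cvg_cst].
Qed.

Lemma csum_shift u : abs_summable u -> csum u = u 0%N + csum (fun k => u k.+1).
Proof.
move=> su; apply: csumE.
rewrite -(cvg_shiftS (series u)).
rewrite (_ : (fun n => _) = (fun n => u 0%N + series (fun k => u k.+1) n)).
  apply: cvgD; first exact: cvg_cst.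
  exact: abs_summable_cvg (abs_summable_shift su).
by apply/funext => n; rewrite /series /= big_nat_recl.
Qed.

Lemma finite_series (V : zmodType) (u : nat -> V) N : (forall k, (N <= k)%N -> u k = 0) ->
  forall n, (N <= n)%N -> series u n = \sum_(k < N) u k.
Proof.
move=> u0 n Nn; rewrite /series /= (big_cat_nat_idem _ _ (n:=N))//= ?addr0//.
rewrite [X in _ + X]big_nat_cond [X in _ + X]big1 ?addr0 ?big_mkord//.
by move=> k /andP[/andP[Nk _] _]; exact: u0.
Qed.

Lemma csum_finite u N : (forall k, (N <= k)%N -> u k = 0) -> csum u = \sum_(k < N) u k.
Proof.
move=> u0; apply: csumE; apply/cvg_cabsP => e e0; exists N => // n /= Nn.
by rewrite (finite_series u0 Nn) subrr cabs0.
Qed.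

Lemma abs_summable_finite u N : (forall k, (N <= k)%N -> u k = 0) -> abs_summable u.
Proof.
move=> u0; apply/cvg_ex; exists (\sum_(k < N) cabs (u k)).
apply/cvgrPdist_lt => e e0; exists N => // n /= Nn.
by rewrite (finite_series _ Nn) ?subrr ?normr0// => k /u0 ->; rewrite cabs0.
Qed.

End ComplexSeries.

(** * Power series with radius of convergence at least one *)

Section PowerSeries.
Variable R : realType.
Local Notation C := R[i].
Implicit Types (c : nat -> C) (z w : C).

(** The radius of convergence is at least 1. Unlike boundedness of the coefficients, this form
    survives multiplication by k, hence differentiation. *)
Definition subgeometric c : Prop :=
  forall rho : R, 0 <= rho < 1 -> exists M : R, forall k, cabs (c k) * rho ^+ k <= M.

Definition psum c z : C := csum (fun k => c k * z ^+ k).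

Lemma exists_between (r : R) : 0 <= r -> r < 1 ->
  exists s : R, [/\ 0 < s, s < 1 & r < s].
Proof. by move=> r0 r1; exists ((1 + r) / 2); split; lra. Qed.

(** The number [1 - q ^+ k] is [1 - q] times a sum of k powers of q, each at least [q ^+ k]. *)
Lemma natmul_expr_le (q : R) k : 0 <= q <= 1 -> k%:R * q ^+ k * (1 - q) <= 1 - q ^+ k.
Proof.
move=> /andP[q0 q1]; elim: k => [|k IH]; first by rewrite mul0r mul0r expr0 subrr.
have qk0 : 0 <= q ^+ k by rewrite exprn_ge0.
have qk1 : q ^+ k <= 1 by rewrite exprn_ile1.
move: IH; rewrite -natr1 exprS; set s := q ^+ k; set N := k%:R => IH.
have : q * (N * s * (1 - q)) <= q * (1 - s) by rewrite ler_wpM2l.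
have : 0 <= (1 - q) * (1 - q * s).
  by rewrite mulr_ge0 ?subr_ge0// mulr_ile1.
rewrite -subr_ge0; nra.
Qed.

Lemma natmul_expr_bounded (q : R) : 0 <= q < 1 -> exists M, forall k, k%:R * q ^+ k <= M.
Proof.
move=> /andP[q0 q1]; exists (1 - q)^-1 => k.
rewrite -[leRHS]mul1r ler_pdivlMr ?subr_gt0//.
apply: le_trans (natmul_expr_le k _) _; first by rewrite q0 ltW.
by rewrite gerBl exprn_ge0.
Qed.

(** For a radius s strictly between r and 1, the factor k is absorbed by (r/s)^k. *)
Lemma subgeometricM c : subgeometric c -> subgeometric (fun k => k%:R * c k).
Proof.
move=> gc r /andP[r0 r1]; have [s [s0 s1 rs]] := exists_between r0 r1.
have [|M hM] := gc s; first by rewrite (ltW s0).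
have [|B hB] := @natmul_expr_bounded (r / s).
  by rewrite divr_ge0 ?(ltW s0)//= ltr_pdivrMr// mul1r.
exists (M * B) => k; rewrite cabsM cabs_nat.
have -> : k%:R * cabs (c k) * r ^+ k = (cabs (c k) * s ^+ k) * (k%:R * (r / s) ^+ k).
  by rewrite expr_div_n; field; rewrite expf_neq0// gt_eqF.
have q0 : 0 <= r / s by rewrite divr_ge0 // ltW.
by apply: ler_pM => //; rewrite mulr_ge0 ?cabs_ge0 ?exprn_ge0// ltW.
Qed.

Lemma subgeometric_shift c : subgeometric c -> subgeometric (fun k => c k.+1).
Proof.
move=> gc r /andP[r0 r1]; have [s [s0 s1 /ltW rs]] := exists_between r0 r1.
have [|M hM] := gc s; first by rewrite (ltW s0).
exists (M / s) => k; rewrite ler_pdivlMr//; apply: le_trans (hM k.+1).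
rewrite exprSr mulrA ler_wpM2r ?(ltW s0)// ler_wpM2l ?cabs_ge0//.
by rewrite lerXn2r// nnegrE// ltW.
Qed.

Lemma bounded_subgeometric c (M : R) : (forall k, cabs (c k) <= M) -> subgeometric c.
Proof.
move=> cM r /andP[r0 r1]; exists M => k.
rewrite -[leRHS]mulr1; apply: ler_pM; rewrite ?cabs_ge0 ?exprn_ge0//.
by rewrite exprn_ile1// ltW.
Qed.

Lemma cvg_geometric_scaled (M q : R) : 0 <= q < 1 -> cvgn (series (fun k => M * q ^+ k)).
Proof.
move=> /andP[q0 q1]; apply: is_cvg_geometric_series; by rewrite ger0_norm.
Qed.

(** Boundedness at a slightly larger radius s becomes a geometric majorant of ratio rho/s. *)
Lemma subgeometric_majorant c (rho : R) : subgeometric c -> 0 <= rho < 1 ->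
  exists2 v : nat -> R, cvgn (series v) & forall k, cabs (c k) * rho ^+ k <= v k.
Proof.
move=> gc /andP[r0 r1]; have [s [s0 s1 rs]] := exists_between r0 r1.
have [|M hM] := gc s; first by rewrite (ltW s0).
exists (fun k => M * (rho / s) ^+ k).
  by apply: cvg_geometric_scaled; rewrite divr_ge0 ?(ltW s0)//= ltr_pdivrMr// mul1r.
move=> k; rewrite expr_div_n mulrA mulrAC ler_wpM2r ?exprn_ge0//.
by rewrite ler_pdivlMr ?exprn_gt0.
Qed.

Lemma subgeometric_summable c z :
  subgeometric c -> cabs z < 1 -> abs_summable (fun k => c k * z ^+ k).
Proof.
move=> gc z1; have [|v cv hv] := @subgeometric_majorant c (cabs z) gc.
  by rewrite cabs_ge0.
by apply: abs_summable_le cv => k; rewrite cabsM cabsX.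
Qed.

(* First-order Taylor remainder of a monomial, multiplied by [rho ^+ 2] to avoid
   negative exponents. *)
Lemma monomial_remainder (rho : R) z w k : cabs z <= rho -> cabs w <= rho ->
  cabs (w ^+ k - z ^+ k - k%:R * z ^+ k.-1 * (w - z)) * rho ^+ 2
    <= k%:R ^+ 2 * rho ^+ k * cabs (w - z) ^+ 2.
Proof.
move=> hz hw; have r0 : 0 <= rho := le_trans (cabs_ge0 z) hz.
set d := cabs (w - z); have d0 : 0 <= d by exact: cabs_ge0.
elim: k => [|k IH].
  by rewrite !expr0 subrr mul0r mul0r subrr cabs0 mul0r expr0n/= mul0r mul0r.
set A := w ^+ k - z ^+ k - _ in IH.
(* Recursion for the remainder: the previous one is multiplied by w, and the linear terms then
   differ by k z^(k-1) (w - z)^2. The induction closes because k^2 + k <= (k + 1)^2. *)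
have -> : w ^+ k.+1 - z ^+ k.+1 - k.+1%:R * z ^+ k.+1.-1 * (w - z) =
    w * A + k%:R * z ^+ k.-1 * (w - z) ^+ 2.
  rewrite /A; case: k {A IH} => [|k]; first by rewrite /= !expr1 !expr0; ring.
  by rewrite /= -[k.+2%:R]natr1 !exprS; ring.
have h1 : cabs (w * A) * rho ^+ 2 <= rho * (k%:R ^+ 2 * rho ^+ k * d ^+ 2).
  rewrite cabsM -mulrA; apply: ler_pM => //; first exact: cabs_ge0.
  by rewrite mulr_ge0 ?cabs_ge0 ?exprn_ge0.
have h2 : cabs (k%:R * z ^+ k.-1 * (w - z) ^+ 2) * rho ^+ 2 <=
    k%:R * rho ^+ k.+1 * d ^+ 2.
  rewrite cabsM [cabs (_ ^+ 2)]cabsX -/d cabsM cabs_nat cabsX; case: k {A IH h1} => [|k].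
    by rewrite !mul0r.
  rewrite mulrAC ler_wpM2r ?exprn_ge0// -!mulrA ler_wpM2l// /=.
  rewrite [rho ^+ k.+2](_ : _ = rho ^+ k * rho ^+ 2); last by rewrite -exprD addn2.
  by rewrite ler_wpM2r ?exprn_ge0// lerXn2r ?nnegrE ?cabs_ge0.
apply: (@le_trans _ _ (rho * (k%:R ^+ 2 * rho ^+ k * d ^+ 2) + k%:R * rho ^+ k.+1 * d ^+ 2)).
  apply: le_trans (lerD h1 h2); rewrite -mulrDl ler_wpM2r ?exprn_ge0//.
  exact: cabsD.
rewrite -natr1 ![rho ^+ k.+1]exprS.
set N : R := k%:R; set s := rho ^+ k; set t := d ^+ 2.
rewrite -subr_ge0 (_ : _ - _ = rho * s * t * (N + 1)); last by ring.
by rewrite !mulr_ge0 ?exprn_ge0 ?addr_ge0.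
Qed.

Definition deriv_coef c k : C := k.+1%:R * c k.+1.

Lemma subgeometric_deriv c : subgeometric c -> subgeometric (deriv_coef c).
Proof. by move=> /subgeometricM /subgeometric_shift. Qed.

(** Monomial remainders are summed against a majorant of k^2 c_k r^k, with r strictly between the
    modulus of z and 1. Then K is the sum of that majorant divided by r^2, and h keeps w in the disk
    of radius r. *)
Lemma psum_remainder c z : subgeometric c -> cabs z < 1 ->
  exists2 K : R, 0 <= K & \forall h \near (0 : R)^'+, forall w, cabs (w - z) <= h ->
    cabs (psum c w - psum c z - (w - z) * psum (deriv_coef c) z)
      <= K * cabs (w - z) ^+ 2.
Proof.
move=> gc z1; have [r [r0 r1 zr]] := exists_between (cabs_ge0 z) z1.
have [|v cv hv] := @subgeometric_majorant _ r (subgeometricM (subgeometricM gc)).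
  by rewrite (ltW r0).
have v0 k : 0 <= v k.
  by apply: le_trans (hv k); rewrite mulr_ge0 ?cabs_ge0 ?exprn_ge0// ltW.
exists (limn (series v) / r ^+ 2).
  rewrite divr_ge0 ?exprn_ge0 ?(ltW r0)//.
  by apply: limr_ge => //; near=> n; rewrite /series /= sumr_ge0.
near=> h => w hw; have wr : cabs w <= r.
  rewrite -(subrK z w) (le_trans (cabsD _ _))// (le_trans (lerD hw (lexx _)))//.
  by rewrite -lerBrDr; near: h; apply: nbhs_right_le; rewrite subr_gt0.
have w1 : cabs w < 1 := le_lt_trans wr r1.
have sw := subgeometric_summable gc w1; have sz := subgeometric_summable gc z1.
pose u k := (w - z) * (k%:R * c k * z ^+ k.-1).
(* The derived series is written with k c_k z^(k-1); its term of index 0 vanishes, and dropping it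
   leaves the series of [deriv_coef]. *)
have su' : abs_summable (fun k => k%:R * c k * z ^+ k.-1).
  have /cvg_ex[l hl] := subgeometric_summable (subgeometric_deriv gc) z1.
  apply/cvg_ex; exists l; rewrite -cvg_shiftS.
  rewrite (_ : (fun n => _) =
    series (fun k => cabs (deriv_coef c k * z ^+ k)))//.
  by apply/funext => n; rewrite /series /= big_nat_recl// !mul0r cabs0 add0r.
have su : abs_summable u := abs_summableZ su'.
have -> : (w - z) * psum (deriv_coef c) z = csum u.
  by rewrite csumZ// (csum_shift su') mul0r mul0r add0r.
rewrite /psum -csumB// -csumB//; last exact: abs_summableB.
have hk k : cabs (c k * w ^+ k - c k * z ^+ k - u k) <= v k * (cabs (w - z) ^+ 2 / r ^+ 2).
  have -> : c k * w ^+ k - c k * z ^+ k - u k =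
      c k * (w ^+ k - z ^+ k - k%:R * z ^+ k.-1 * (w - z)) by rewrite /u; ring.
  rewrite cabsM [v k * _]mulrA ler_pdivlMr ?exprn_gt0// -[leLHS]mulrA.
  apply: (@le_trans _ _ (cabs (c k) * (k%:R ^+ 2 * r ^+ k * cabs (w - z) ^+ 2))).
    by rewrite ler_wpM2l ?cabs_ge0// monomial_remainder// ltW.
  have := hv k; rewrite !cabsM !cabs_nat => hvk.
  have := ler_wpM2r (exprn_ge0 2 (cabs_ge0 (w - z))) hvk.
  by apply: le_trans; rewrite le_eqVlt; apply/orP; left; apply/eqP; ring.
set q := cabs (w - z) ^+ 2 / r ^+ 2 in hk *.
have -> : limn (series v) / r ^+ 2 * cabs (w - z) ^+ 2 = q * limn (series v).
  by rewrite /q -[LHS]mulrA [RHS]mulrC; congr (_ * _); rewrite [LHS]mulrC.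
rewrite -[_ * _](lim_seriesZ _ cv); apply: csum_le; last exact: is_cvg_seriesZ.
move=> k; by rewrite (le_trans (hk k))// mulrC.
Unshelve. all: by end_near. Qed.

End PowerSeries.

(** * Complex derivatives and Taylor coefficients *)

Section ComplexDerivative.
Variable R : realType.
Local Notation C := R[i].
Implicit Types (f g : C -> C) (c : nat -> C) (z w : C).

Lemma nbhs_cabsP z (P : set C) :
  nbhs z P <-> exists2 d : R, 0 < d & forall w, cabs (w - z) < d -> P w.
Proof.
split=> [/nbhs_ballP[e /= /gt0_complexE[eE e0] zP]|[d d0 h]].
  exists (complex.Re e) => // w wz; apply: zP.
  by rewrite -ball_normE /= eE normCE ltcR cabsBC.
apply/nbhs_ballP; exists d%:C%C; rewrite /= ?ltcR// => w.
by rewrite -ball_normE /= normCE ltcR cabsBC; exact: h.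
Qed.

(** The difference quotient with its denominator cleared: w = z needs no exception and compositions
    are direct. [has_derivative_cvg] links it to the limit behind [derivable]. *)
Definition has_derivative f z d : Prop := forall e : R, 0 < e ->
  exists2 r : R, 0 < r & forall w, cabs (w - z) < r ->
    cabs (f w - f z - (w - z) * d) <= e * cabs (w - z).

Lemma has_derivative_cvg f z d : has_derivative f z d <->
  h^-1 *: (f (h *: 1 + z) - f z) @[h --> (0 : C)^'] --> d.
Proof.
rewrite cvg_cabsP; split.
  move=> h e e0; have e2 : 0 < e / 2 by rewrite divr_gt0.
  have [r r0 hr] := h _ e2; apply/nbhs_cabsP; exists r => // w; rewrite subr0 => wr w0.
  have w0' : 0 < cabs w.
    by rewrite lt_neqAle cabs_ge0 andbT eq_sym; apply: contra_neq w0 => /cabs0_eq.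
  have := hr (w + z); rewrite addrK => /(_ wr) hw.
  rewrite -[w *: 1]/(w * 1) mulr1 -[_ *: _]/(_ * _).
  have -> : w^-1 * (f (w + z) - f z) - d = w^-1 * (f (w + z) - f z - w * d).
    by rewrite [RHS]mulrBr mulKf.
  rewrite cabsM cabsV ltr_pdivrMl// (le_lt_trans hw)// mulrC ltr_pM2l//.
  by rewrite ltr_pdivrMr// ltr_pMr// ltr1n.
move=> h e e0; have /nbhs_cabsP[r r0 hr] := h _ e0; exists r => // w wr.
have [->|wz] := eqVneq w z; first by rewrite !subrr mul0r subrr cabs0 mulr0.
have w0 : w - z != 0 by rewrite subr_eq0.
have w0' : 0 < cabs (w - z).
  by rewrite lt_neqAle cabs_ge0 andbT eq_sym; apply: contra_neq w0 => /cabs0_eq.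
have := hr (w - z); rewrite subr0 => /(_ wr w0).
rewrite -[_ *: 1]/(_ * 1) mulr1 -[_ *: _]/(_ * _) subrK.
move=> /ltW hw.
have -> : f w - f z - (w - z) * d = (w - z) * ((w - z)^-1 * (f w - f z) - d).
  by rewrite [RHS]mulrBr mulVKf.
by rewrite cabsM mulrC ler_wpM2r ?cabs_ge0.
Qed.

Lemma has_derivative_derivable f z d : has_derivative f z d -> derivable f z 1.
Proof. by move=> /has_derivative_cvg h; apply/cvg_ex; exists d. Qed.

Lemma has_derivative_derive1 f z d : has_derivative f z d -> derive1 f z = d.
Proof. by move=> /has_derivative_cvg h; rewrite derive1E; apply: cvg_lim. Qed.

Lemma derivable_has_derivative f z : derivable f z 1 -> exists d, has_derivative f z d.
Proof. by move=> /cvg_ex[d h]; exists d; apply/has_derivative_cvg. Qed.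

Lemma has_derivative_near f g z d : (\forall w \near z, f w = g w) ->
  has_derivative f z d -> has_derivative g z d.
Proof.
move=> /nbhs_cabsP[r r0 hr] h e e0; have [s s0 hs] := h _ e0.
exists (Num.min r s); first by rewrite lt_min r0.
by move=> w; rewrite lt_min => /andP[wr ws]; rewrite -!hr ?subrr ?cabs0// hs.
Qed.

Lemma has_derivative_continuous f z d : has_derivative f z d -> {for z, continuous f}.
Proof.
move=> h; apply/(@cvg_cabsP _ _ (nbhs z)) => e e0; have [r r0 hr] := h _ ltr01.
have k0 : 0 < 1 + cabs d by have := cabs_ge0 d; lra.
apply/nbhs_cabsP; exists (Num.min r (e / (1 + cabs d))); first by rewrite lt_min r0 divr_gt0.
move=> w; rewrite lt_min ltr_pdivlMr// => /andP[wr ws].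
rewrite -[f w - f z](subrK ((w - z) * d)) (le_lt_trans (cabsD _ _))//.
rewrite cabsM (le_lt_trans _ ws)// mulrDr mulr1 lerD2r.
by rewrite (le_trans (hr _ wr))// mul1r.
Qed.

Lemma has_derivative_psum c z : subgeometric c -> cabs z < 1 ->
  has_derivative (psum c) z (psum (deriv_coef c) z).
Proof.
move=> gc z1 e e0; have [K K0 hK] := psum_remainder gc z1.
have K1 : 0 < K + 1 by lra.
have [h [h0 he hh]] : exists h : R, [/\ 0 < h, h < e / (K + 1) &
    forall w, cabs (w - z) <= h -> cabs (psum c w - psum c z - (w - z) * psum (deriv_coef c) z)
      <= K * cabs (w - z) ^+ 2].
  apply: (@filter_ex _ (0 : R)^'+); near=> h; split; last by near: h.
    by near: h; exact: nbhs_right_gt.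
  by near: h; apply: nbhs_right_lt; rewrite divr_gt0.
exists h => // w wh; rewrite (le_trans (hh _ (ltW wh)))// expr2 mulrA.
rewrite ler_wpM2r ?cabs_ge0//.
apply: (@le_trans _ _ ((K + 1) * h)).
  by apply: ler_pM; rewrite ?cabs_ge0 ?lerDl// ltW.
by rewrite mulrC -ler_pdivlMr// ltW.
Unshelve. all: by end_near. Qed.

Lemma has_derivative_eq_psum f c z : subgeometric c ->
  (forall w, cabs w < 1 -> f w = psum c w) -> cabs z < 1 ->
  has_derivative f z (psum (deriv_coef c) z).
Proof.
move=> gc fc z1; apply: (has_derivative_near _ (has_derivative_psum gc z1)).
apply/nbhs_cabsP; exists (1 - cabs z); rewrite ?subr_gt0// => w wz.
rewrite fc// -(subrK z w) (le_lt_trans (cabsD _ _))// -ltrBrDr.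
by rewrite ltrBrDr -ltrBrDr.
Qed.

Lemma psum0 c : psum c 0 = c 0%N.
Proof.
rewrite /psum (@csum_finite _ _ 1%N) ?big_ord1 ?expr0 ?mulr1//.
by case=> // k _; rewrite expr0n mulr0.
Qed.

Lemma iter_deriv_coef c n k :
  iter n (@deriv_coef R) c k = ((k + n) ^_ n)%:R * c (k + n)%N.
Proof.
elim: n c k => [|n IH] c k; first by rewrite addn0 ffactn0 mul1r.
rewrite iterS /deriv_coef IH addSnnS mulrA -natrM; congr (_%:R * _).
by rewrite [RHS]ffactnSr mulnC; congr (_ * _)%N; rewrite addnS -addSn addnK.
Qed.

Lemma subgeometric_iter c n : subgeometric c -> subgeometric (iter n (@deriv_coef R) c).
Proof. by move=> gc; elim: n => //= n; exact: subgeometric_deriv. Qed.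

(** The identity is kept on the whole open disk, since one more differentiation needs it near every
    point. *)
Lemma derive1n_psum f c n : subgeometric c ->
  (forall w, cabs w < 1 -> f w = psum c w) ->
  forall w, cabs w < 1 -> derive1n n f w = psum (iter n (@deriv_coef R) c) w.
Proof.
move=> gc fc; elim: n => [//|n IH] w w1.
rewrite derive1nS iterS; apply: has_derivative_derive1.
exact: has_derivative_eq_psum (subgeometric_iter n gc) IH w1.
Qed.

(** At 0 the n-th derived series has constant term n! c_n. Being an equality of sequences, this also
    contains uniqueness of the expansion, and it is how every later Taylor coefficient is
    computed. *)
Lemma taylor_psum f c : subgeometric c ->
  (forall w, cabs w < 1 -> f w = psum c w) -> taylor f = c.
Proof.
move=> gc fc; apply/funext => k; rewrite /taylor (derive1n_psum k gc fc) ?cabs0//.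
rewrite psum0 iter_deriv_coef add0n ffactnn mulrAC divff ?mul1r//.
Qed.

End ComplexDerivative.

(** * Complex integrals through real and imaginary parts *)

Section ComplexIntegral.
Context d (T : measurableType d) (R : realType).
Variables (mu : {measure set T -> \bar R}) (D : set T).
Hypothesis mD : measurable D.
Local Notation C := R[i].
Implicit Types (h g : T -> C).

Definition cmeasurable h : Prop :=
  measurable_fun D (fun t => complex.Re (h t)) /\ measurable_fun D (fun t => complex.Im (h t)).

Definition cintegrable h : Prop :=
  mu.-integrable D (fun t => (complex.Re (h t))%:E) /\
  mu.-integrable D (fun t => (complex.Im (h t))%:E).

Definition cintg h : C :=
  Complex (\int[mu]_(t in D) complex.Re (h t)) (\int[mu]_(t in D) complex.Im (h t)).

Lemma cintegrable_measurable h : cintegrable h -> cmeasurable h.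
Proof.
by move=> [h1 h2]; split; apply/measurable_EFinP; [move: h1|move: h2] => /measurable_int.
Qed.

Lemma eq_cintg h g : {in D, h =1 g} -> cintg h = cintg g.
Proof.
by move=> hg; congr Complex; apply: eq_Rintegral => x xD; rewrite hg.
Qed.

Lemma eq_cintegrable h g : {in D, h =1 g} -> cintegrable h -> cintegrable g.
Proof.
move=> hg [h1 h2]; split.
  by apply: eq_integrable h1 => // x xD; rewrite hg.
by apply: eq_integrable h2 => // x xD; rewrite hg.
Qed.

Lemma cintegrableD h g : cintegrable h -> cintegrable g -> cintegrable (fun t => h t + g t).
Proof.
move=> [h1 h2] [g1 g2]; split.
  apply: (@eq_integrable _ _ _ _ _ mD _ _ _ (integrableD mD h1 g1)) => x xD.
  by rewrite /= Re_addc.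
apply: (@eq_integrable _ _ _ _ _ mD _ _ _ (integrableD mD h2 g2)) => x xD.
by rewrite /= Im_addc.
Qed.

Lemma cintegrableZ (a : C) h : cintegrable h -> cintegrable (fun t => a * h t).
Proof.
move=> [h1 h2].
have H (x : R) (f : T -> R) : mu.-integrable D (fun t => (f t)%:E) ->
    mu.-integrable D (fun t => (x * f t)%:E).
  by move=> fi; have := integrableZl mD x fi; apply: eq_integrable => // t _; rewrite /= EFinM.
split.
  apply: (@eq_integrable _ _ _ _ _ mD _ _ _ (integrableB mD (H (complex.Re a) _ h1) (H (complex.Im a) _ h2))).
  by move=> x xD; rewrite /= Re_mulc.
apply: (@eq_integrable _ _ _ _ _ mD _ _ _ (integrableD mD (H (complex.Re a) _ h2) (H (complex.Im a) _ h1))).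
by move=> x xD; rewrite /= Im_mulc.
Qed.

Lemma cintegrableB h g : cintegrable h -> cintegrable g -> cintegrable (fun t => h t - g t).
Proof.
move=> hi gi; apply: eq_cintegrable (cintegrableD hi (cintegrableZ (-1) gi)).
by move=> x _; rewrite mulN1r.
Qed.

Lemma cintgD h g : cintegrable h -> cintegrable g ->
  cintg (fun t => h t + g t) = cintg h + cintg g.
Proof.
move=> [h1 h2] [g1 g2]; apply/eqP; rewrite eq_complex /=; apply/andP; split; apply/eqP.
  by under eq_Rintegral do rewrite Re_addc; rewrite RintegralD.
by under eq_Rintegral do rewrite Im_addc; rewrite RintegralD.
Qed.

Lemma cintgZ (a : C) h : cintegrable h -> cintg (fun t => a * h t) = a * cintg h.
Proof.
move=> [h1 h2].
have H (x : R) (f : T -> R) : mu.-integrable D (fun t => (f t)%:E) ->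
    mu.-integrable D (EFin \o (fun t => (x * f t))).
  by move=> fi; have := integrableZl mD x fi; apply: eq_integrable => // t _; rewrite /= EFinM.
apply/eqP; rewrite eq_complex; apply/andP; split; apply/eqP.
  rewrite [LHS]/=; under eq_Rintegral do rewrite Re_mulc.
  by rewrite RintegralB ?RintegralZl ?Re_mulc//; exact: H.
rewrite [LHS]/=; under eq_Rintegral do rewrite Im_mulc.
by rewrite RintegralD ?RintegralZl ?Im_mulc//; exact: H.
Qed.

Lemma cintgB h g : cintegrable h -> cintegrable g ->
  cintg (fun t => h t - g t) = cintg h - cintg g.
Proof.
move=> hi gi; rewrite -mulN1r -cintgZ// -cintgD//; last exact: cintegrableZ.
by apply: eq_cintg => x _; rewrite mulN1r.
Qed.

Lemma cintg0 : cintg (fun=> 0) = 0.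
Proof.
by apply/eqP; rewrite eq_complex /= !Rintegral_cst// mul0r !eqxx.
Qed.

Lemma cintegrable0 : cintegrable (fun=> 0).
Proof. by split; exact: integrable0. Qed.

Lemma cintegrable_sum (I : Type) (r : seq I) (F : I -> T -> C) :
  (forall i, cintegrable (F i)) -> cintegrable (fun t => \sum_(i <- r) F i t).
Proof.
move=> Fi; elim: r => [|i r IH].
  by apply: eq_cintegrable cintegrable0 => x _; rewrite big_nil.
by apply: eq_cintegrable (cintegrableD (Fi i) IH) => x _; rewrite big_cons.
Qed.

Lemma cintg_sum (I : Type) (r : seq I) (F : I -> T -> C) :
  (forall i, cintegrable (F i)) ->
  cintg (fun t => \sum_(i <- r) F i t) = \sum_(i <- r) cintg (F i).
Proof.
move=> Fi; elim: r => [|i r IH].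
  by rewrite big_nil -[RHS]cintg0; apply: eq_cintg => x _; rewrite big_nil.
rewrite big_cons -IH -cintgD//; last exact: cintegrable_sum.
by apply: eq_cintg => x _; rewrite big_cons.
Qed.

Lemma cmeasurable_cabs h : cmeasurable h -> measurable_fun D (fun t => cabs (h t)).
Proof.
move=> [h1 h2].
rewrite (_ : (fun t => _) = (fun t => Num.sqrt (complex.Re (h t) ^+ 2 + complex.Im (h t) ^+ 2))).
  apply: (measurableT_comp (continuous_measurable_fun (@sqrt_continuous R))).
  by apply: measurable_funD; apply: measurable_funX.
by apply/funext => t; case: (h t).
Qed.

Lemma cintegrable_cabs h : cintegrable h -> mu.-integrable D (fun t => (cabs (h t))%:E).
Proof.
move=> hi; have [h1 h2] := hi.
have hb : mu.-integrable D (fun t => (`|complex.Re (h t)| + `|complex.Im (h t)|)%:E).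
  have := integrableD mD (integrable_norm h1) (integrable_norm h2).
  by apply: eq_integrable.
apply: (le_integrable mD _ _ hb).
  by apply/measurable_EFinP; apply: cmeasurable_cabs; exact: cintegrable_measurable.
move=> x Dx; rewrite lee_fin [leLHS]ger0_norm ?cabs_ge0// [leRHS]ger0_norm ?addr_ge0//; exact: cabs_le_ReIm.
Qed.

(* Real and imaginary parts are bounded separately, hence the constant 2. *)
Lemma cabs_cintg_le h : cintegrable h -> cabs (cintg h) <= 2 * \int[mu]_(t in D) cabs (h t).
Proof.
move=> hi; have ci := cintegrable_cabs hi; have [h1 h2] := hi.
apply: le_trans (cabs_le_ReIm _) _; rewrite mulr_natl mulr2n; apply: lerD => /=.
  apply: le_trans (le_normr_Rintegral mD h1) _; apply: le_Rintegral => //.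
    exact: integrable_norm h1.
  by move=> x _; exact: Re_le_cabs.
apply: le_trans (le_normr_Rintegral mD h2) _; apply: le_Rintegral => //.
  exact: integrable_norm h2.
by move=> x _; exact: Im_le_cabs.
Qed.

Lemma cintegrable_le h (v : T -> R) : cmeasurable h ->
  mu.-integrable D (fun t => (v t)%:E) -> (forall t, D t -> cabs (h t) <= v t) ->
  cintegrable h.
Proof.
move=> [h1 h2] vi hv; split; apply: (le_integrable mD _ _ vi).
- exact/measurable_EFinP.
- move=> t Dt; rewrite lee_fin (le_trans (Re_le_cabs _))// (le_trans (hv _ Dt))//.
  exact: ler_norm.
- exact/measurable_EFinP.
- move=> t Dt; rewrite lee_fin (le_trans (Im_le_cabs _))// (le_trans (hv _ Dt))//.
  exact: ler_norm.
Qed.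

Lemma cmeasurableM h g : cmeasurable h -> cmeasurable g -> cmeasurable (fun t => h t * g t).
Proof.
move=> [h1 h2] [g1 g2]; split.
  under eq_fun do rewrite Re_mulc.
  by apply: measurable_funB; apply: measurable_funM.
under eq_fun do rewrite Im_mulc.
by apply: measurable_funD; apply: measurable_funM.
Qed.

Lemma cintegrable_mul_bounded h g (M : R) : cintegrable g -> cmeasurable h ->
  (forall t, D t -> cabs (h t) <= M) -> cintegrable (fun t => h t * g t).
Proof.
move=> gi mh hM.
apply: (@cintegrable_le _ (fun t => M * cabs (g t))).
- by apply: cmeasurableM => //; exact: cintegrable_measurable.
- have := integrableZl mD M (cintegrable_cabs gi).
  by apply: eq_integrable => // t _; rewrite EFinM.
- by move=> t Dt; rewrite cabsM ler_wpM2r ?cabs_ge0// hM.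
Qed.

Lemma cabs_cintg_mul_le h g (M : R) : cintegrable g -> cmeasurable h ->
  (forall t, D t -> cabs (h t) <= M) ->
  cabs (cintg (fun t => h t * g t)) <= 2 * M * \int[mu]_(t in D) cabs (g t).
Proof.
move=> gi mh hM; have hi := cintegrable_mul_bounded gi mh hM.
rewrite (le_trans (cabs_cintg_le hi))// -mulrA ler_wpM2l//.
have gi' := cintegrable_cabs gi.
rewrite -RintegralZl//; apply: le_Rintegral => //.
- exact: cintegrable_cabs hi.
- have := integrableZl mD M gi'; apply: eq_integrable => // t _.
- by move=> t Dt; rewrite cabsM ler_wpM2r ?cabs_ge0// hM.
Qed.

Hypothesis muD : (mu D < +oo)%E.

Lemma integrable_cst_on (M : R) : mu.-integrable D (fun=> M%:E).
Proof.
apply: (measurable_bounded_integrable mD muD (f := fun=> M)) => //.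
by exists `|M|; split; [exact: num_real|move=> x /ltW Mx t _].
Qed.

Lemma cintegrable_bounded h (M : R) : cmeasurable h ->
  (forall t, D t -> cabs (h t) <= M) -> cintegrable h.
Proof.
move=> mh hM; apply: (@cintegrable_le _ (fun=> M)) => //.
exact: integrable_cst_on.
Qed.

Lemma cabs_cintg_bounded h (M : R) : cmeasurable h ->
  (forall t, D t -> cabs (h t) <= M) -> cabs (cintg h) <= 2 * M * fine (mu D).
Proof.
move=> mh hM; have hi := cintegrable_bounded mh hM.
rewrite (le_trans (cabs_cintg_le hi))// -mulrA ler_wpM2l//.
rewrite -Rintegral_cst//; apply: le_Rintegral => //.
- exact: cintegrable_cabs.
- exact: integrable_cst_on.
Qed.

End ComplexIntegral.

(** * Boundary integrals over rectangles *)

Section Goursat.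
Variable R : realType.
Local Notation C := R[i].
Local Notation mu := (@lebesgue_measure R).
Implicit Types (h : R -> C) (F : C -> C) (a b c d : R) (w : C).

Definition segint a b h : C := cintg mu `[a, b] h.

Definition continuous_on_seg a b h : Prop :=
  forall t, a <= t <= b -> {for t, continuous h}.

Lemma cintegrable_seg a b h : continuous_on_seg a b h -> cintegrable mu `[a, b] h.
Proof.
move=> hc; split; apply: continuous_compact_integrable;
    try exact: segment_compact; apply: continuous_in_subspaceT => t;
  rewrite inE /= in_itv /= => /hc/cvg_ReIm[]//.
Qed.

Lemma segint_split a m b h : a <= m -> m <= b -> continuous_on_seg a b h ->
  segint a b h = segint a m h + segint m b h.
Proof.
move=> am mb hc; have [h1 h2] := cintegrable_seg hc.
have H (f : R -> R) : mu.-integrable `[a, b] (fun t => (f t)%:E) ->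
    \int[mu]_(t in `[a, b]) f t = \int[mu]_(t in `[a, m]) f t + \int[mu]_(t in `[m, b]) f t.
  move=> fi; have := @Rintegral_itvB _ f (BLeft a) (BRight b) m fi.
  rewrite !bnd_simp => /(_ am mb) e.
  rewrite -[X in _ = _ + X](@Rintegral_itv_obnd_cbnd _ m (BRight b)).
    by rewrite -e addrC subrK.
  apply: integrableS fi => // x /=; rewrite !in_itv /= => /andP[mx ->].
  by rewrite (le_trans am (ltW mx)).
by rewrite /segint /cintg !H.
Qed.

Lemma fine_lebesgue_seg a b : a <= b -> fine (mu `[a, b]) = b - a.
Proof.
move=> ab; rewrite lebesgue_measure_itv /= lte_fin.
case: ltP => //= ba; have -> : a = b by apply/eqP; rewrite eq_le ab.
by rewrite subrr.
Qed.

Lemma lebesgue_seg_lty a b : (mu `[a, b] < +oo)%E.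
Proof. by rewrite lebesgue_measure_itv; case: ifP => // _; rewrite ltry. Qed.

Lemma segint_bound a b h (M : R) : a <= b -> continuous_on_seg a b h ->
  (forall t, a <= t <= b -> cabs (h t) <= M) -> cabs (segint a b h) <= 2 * M * (b - a).
Proof.
move=> ab hc hM; rewrite -(fine_lebesgue_seg ab); apply: cabs_cintg_bounded => //.
- exact: lebesgue_seg_lty.
- exact: cintegrable_measurable (cintegrable_seg hc).
Qed.

Lemma segint_cst a b (k : C) : a <= b -> segint a b (fun=> k) = k * (b - a)%:C%C.
Proof.
case: k => x y ab; rewrite /segint /cintg !Rintegral_cst// fine_lebesgue_seg//.
by simpc.
Qed.

Lemma continuous_on_segB a b h k : continuous_on_seg a b h ->
  continuous_on_seg a b k -> continuous_on_seg a b (fun t => h t - k t).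
Proof. by move=> hc kc t tab; apply: cvgB; [exact: hc|exact: kc]. Qed.

Lemma segintB a b h k : continuous_on_seg a b h -> continuous_on_seg a b k ->
  segint a b (fun t => h t - k t) = segint a b h - segint a b k.
Proof. by move=> hc kc; apply: cintgB => //; exact: cintegrable_seg. Qed.

(** The contour integral along the boundary of [a, b] x [c, d], counterclockwise: bottom minus top,
    then right minus left with dz = i dt. *)
Definition rectint F a b c d : C :=
  segint a b (fun s => F (Complex s c) - F (Complex s d)) +
  'i%C * segint c d (fun t => F (Complex b t) - F (Complex a t)).

Definition in_rect a b c d w : Prop :=
  a <= complex.Re w <= b /\ c <= complex.Im w <= d.

Definition holo_on (A : set C) F : Prop := forall w, A w -> exists k, has_derivative F w k.

Lemma cabs_re (x : R) : cabs (Complex x 0) = `|x|.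
Proof. exact: cabs_real. Qed.

Lemma cabs_im (x : R) : cabs (Complex 0 x) = `|x|.
Proof. by rewrite /cabs /= expr0n/= add0r sqrtr_sqr. Qed.

Lemma continuous_horizontal F c (t : R) : {for Complex t c, continuous F} ->
  {for t, continuous (fun s => F (Complex s c))}.
Proof.
move=> /(@cvg_cabsP _ _ (nbhs _)) h; apply/cvg_cabsP => e e0.
have /nbhs_cabsP[r r0 hr] := h _ e0.
apply/nbhs_ballP; exists r => // s; rewrite /ball /= distrC => st; apply: hr.
rewrite (_ : _ - _ = Complex (s - t) 0); first by rewrite cabs_re.
by apply/eqP; rewrite eq_complex /= subrr !eqxx.
Qed.

Lemma continuous_vertical F a (t : R) : {for Complex a t, continuous F} ->
  {for t, continuous (fun s => F (Complex a s))}.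
Proof.
move=> /(@cvg_cabsP _ _ (nbhs _)) h; apply/cvg_cabsP => e e0.
have /nbhs_cabsP[r r0 hr] := h _ e0.
apply/nbhs_ballP; exists r => // s; rewrite /ball /= distrC => st; apply: hr.
rewrite (_ : _ - _ = Complex 0 (s - t)); first by rewrite cabs_im.
by apply/eqP; rewrite eq_complex /= subrr !eqxx.
Qed.

Lemma holo_horizontal F a b c d y : holo_on (in_rect a b c d) F -> c <= y <= d ->
  continuous_on_seg a b (fun s => F (Complex s y)).
Proof.
move=> hF yc t tab; apply: continuous_horizontal.
by have [//|k] := hF (Complex t y); exact: has_derivative_continuous.
Qed.

Lemma holo_vertical F a b c d x : holo_on (in_rect a b c d) F -> a <= x <= b ->
  continuous_on_seg c d (fun t => F (Complex x t)).
Proof.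
move=> hF xc t tab; apply: continuous_vertical.
by have [//|k] := hF (Complex x t); exact: has_derivative_continuous.
Qed.

Lemma in_rectS a b c d a' b' c' d' : a <= a' -> b' <= b -> c <= c' -> d' <= d ->
  forall w, in_rect a' b' c' d' w -> in_rect a b c d w.
Proof.
move=> aa bb cc dd w [/andP[h1 h2] /andP[h3 h4]]; split.
  by rewrite (le_trans aa h1) (le_trans h2 bb).
by rewrite (le_trans cc h3) (le_trans h4 dd).
Qed.

Lemma rectint_split_horizontal F a m b c d : a <= m -> m <= b -> c <= d ->
  holo_on (in_rect a b c d) F ->
  rectint F a b c d = rectint F a m c d + rectint F m b c d.
Proof.
move=> am mb cd hF; rewrite /rectint.
have ab := le_trans am mb.
have cc : c <= c <= d by rewrite lexx.
have dd : c <= d <= d by rewrite lexx andbT.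
have V x : a <= x <= b -> continuous_on_seg c d (fun t => F (Complex x t)).
  exact: holo_vertical.
have Va := V a; have Vm := V m; have Vb := V b.
rewrite lexx ab in Va; rewrite am mb in Vm; rewrite ab lexx in Vb.
rewrite (segint_split am mb); last first.
  by apply: continuous_on_segB; apply: holo_horizontal; eauto.
rewrite (segintB (Vb isT) (Va isT)) (segintB (Vm isT) (Va isT)) (segintB (Vb isT) (Vm isT)).
ring.
Qed.

Lemma rectint_split_vertical F a b c m d : a <= b -> c <= m -> m <= d ->
  holo_on (in_rect a b c d) F ->
  rectint F a b c d = rectint F a b c m + rectint F a b m d.
Proof.
move=> ab cm md hF; rewrite /rectint.
have cd := le_trans cm md.
have H y : c <= y <= d -> continuous_on_seg a b (fun t => F (Complex t y)).
  exact: holo_horizontal.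
have Hc := H c; have Hm := H m; have Hd := H d.
rewrite lexx cd in Hc; rewrite cm md in Hm; rewrite cd lexx in Hd.
have aa : a <= a <= b by rewrite lexx.
have bb : a <= b <= b by rewrite lexx andbT.
rewrite (segint_split cm md); last first.
  by apply: continuous_on_segB; apply: holo_vertical; eauto.
rewrite (segintB (Hc isT) (Hd isT)) (segintB (Hc isT) (Hm isT)) (segintB (Hm isT) (Hd isT)).
ring.
Qed.

End Goursat.

(** * Goursat's theorem *)

Section GoursatTheorem.
Variable R : realType.
Local Notation C := R[i].
Implicit Types (F : C -> C) (a b c d : R) (w : C).

Lemma continuous_on_seg_cst a b (k : C) : continuous_on_seg a b (fun=> k).
Proof. by move=> t _; exact: cvg_cst. Qed.

Lemma in_rect_dist a b c d w w0 : in_rect a b c d w -> in_rect a b c d w0 ->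
  cabs (w - w0) <= (b - a) + (d - c).
Proof.
move=> [/andP[h1 h2] /andP[h3 h4]] [/andP[k1 k2] /andP[k3 k4]].
apply: le_trans (cabs_le_ReIm _) _; rewrite Re_subc Im_subc.
by apply: lerD; rewrite ler_norml; apply/andP; split; lra.
Qed.

(* The affine part of [F] has zero boundary integral, so only the remainder
   contributes. *)
Lemma rectint_small F a b c d w0 (k : C) (e : R) : a <= b -> c <= d -> 0 <= e ->
  holo_on (in_rect a b c d) F -> in_rect a b c d w0 ->
  (forall w, in_rect a b c d w -> cabs (F w - F w0 - (w - w0) * k) <= e * cabs (w - w0)) ->
  cabs (rectint F a b c d) <= 4 * e * ((b - a) + (d - c)) ^+ 2.
Proof.
move=> ab cd e0 hF w0r hE; set L := (b - a) + (d - c).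
have hE' w : in_rect a b c d w -> cabs (F w - F w0 - (w - w0) * k) <= e * L.
  by move=> wr; rewrite (le_trans (hE _ wr))// ler_wpM2l// in_rect_dist.
have hEE w w' : in_rect a b c d w -> in_rect a b c d w' ->
    cabs (F w - F w' - (w - w') * k) <= 2 * e * L.
  move=> wr wr'; rewrite (_ : _ - _ =
     (F w - F w0 - (w - w0) * k) - (F w' - F w0 - (w' - w0) * k)); last by ring.
  apply: le_trans (cabsB _ _) _; have := hE' _ wr; have := hE' _ wr'; lra.
have cc : c <= c <= d by rewrite lexx.
have dd : c <= d <= d by rewrite lexx andbT.
have aa : a <= a <= b by rewrite lexx.
have bb : a <= b <= b by rewrite lexx andbT.
(* [k1] and [k2] are the increments of z -> z k between facing sides. Their contributions k1 (b - a)
   and i k2 (d - c) cancel, so both can be subtracted freely; what remains is at most 2 e L on each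
   pair of sides. *)
pose k1 : C := Complex 0 (c - d) * k; pose k2 : C := Complex (b - a) 0 * k.
pose g1 s := F (Complex s c) - F (Complex s d).
pose g2 t := F (Complex b t) - F (Complex a t).
have cg1 : continuous_on_seg a b g1.
  by apply: continuous_on_segB; apply: holo_horizontal; eauto.
have cg2 : continuous_on_seg c d g2.
  by apply: continuous_on_segB; apply: holo_vertical; eauto.
have I1 : cabs (segint a b (fun s => g1 s - k1)) <= 2 * (2 * e * L) * (b - a).
  apply: (@segint_bound _ _ _ _ (2 * e * L) ab) => [|t tab].
    by apply: continuous_on_segB; [exact: cg1|exact: continuous_on_seg_cst].
  have := hEE (Complex t c) (Complex t d).
  rewrite (_ : Complex t c - Complex t d = Complex 0 (c - d)).
    by apply; split.
  by apply/eqP; rewrite eq_complex /= subrr !eqxx.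
have I2 : cabs (segint c d (fun s => g2 s - k2)) <= 2 * (2 * e * L) * (d - c).
  apply: (@segint_bound _ _ _ _ (2 * e * L) cd) => [|t tab].
    by apply: continuous_on_segB; [exact: cg2|exact: continuous_on_seg_cst].
  have := hEE (Complex b t) (Complex a t).
  rewrite (_ : Complex b t - Complex a t = Complex (b - a) 0).
    by apply; split.
  by apply/eqP; rewrite eq_complex /= subrr !eqxx.
have -> : rectint F a b c d =
    segint a b (fun s => g1 s - k1) + 'i%C * segint c d (fun s => g2 s - k2).
  rewrite (segintB cg1 (@continuous_on_seg_cst a b k1)) (segintB cg2 (@continuous_on_seg_cst c d k2)).
  rewrite (segint_cst _ ab) (segint_cst _ cd) /rectint -/g1 -/g2.
  apply/eqP; rewrite -subr_eq0; apply/eqP.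
  rewrite (_ : _ - _ = k1 * (b - a)%:C%C + 'i%C * k2 * (d - c)%:C%C); last by ring.
  rewrite /k1 /k2; case: k {hE hE' hEE k1 k2 I1 I2} => x y.
  by simpc; apply/eqP; rewrite eq_complex /=; apply/andP; split; apply/eqP; ring.
apply: le_trans (cabsD _ _) _; rewrite cabsM cabs_im normr1 mul1r.
apply: le_trans (lerD I1 I2) _.
by rewrite -mulrDr -/L expr2 le_eqVlt; apply/orP; left; apply/eqP; ring.
Qed.

Lemma nested_point (lo hi : nat -> R) :
  (forall n, lo n <= lo n.+1) -> (forall n, hi n.+1 <= hi n) -> (forall n, lo n <= hi n) ->
  exists x, forall n, lo n <= x <= hi n.
Proof.
move=> hlo hhi h.
have lom : {homo lo : m n / (m <= n)%N >-> m <= n} by apply/nondecreasing_seqP.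
have him : {homo hi : m n / (m <= n)%N >-> n <= m} by apply/nonincreasing_seqP.
have lohi m n : lo m <= hi n.
  apply: le_trans (lom m (maxn m n) (leq_maxl _ _)) _.
  exact: le_trans (h _) (him _ _ (leq_maxr _ _)).
have ub : has_ubound (range lo) by exists (hi 0%N) => _ [n _ <-].
exists (sup (range lo)) => n; apply/andP; split.
  by apply: ub_le_sup => //; exists n.
by apply: ge_sup; [exists (lo 0%N), 0%N|move=> _ [m _ <-]].
Qed.

(** Bisection by contradiction: if the quadratic bound fails for some e, one quarter violates the
    bound scaled by 1/4. The nested violating rectangles shrink to a point, where differentiability
    and [rectint_small] contradict them. *)
Theorem goursat F a b c d : a <= b -> c <= d -> holo_on (in_rect a b c d) F ->
  rectint F a b c d = 0.
Proof.
move=> ab cd hF; set L := (b - a) + (d - c).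
have L0 : 0 <= L by rewrite addr_ge0// subr_ge0.
suff small e : 0 < e -> cabs (rectint F a b c d) <= 4 * e * L ^+ 2.
  apply: cabs0_eq; apply/eqP; rewrite eq_le cabs_ge0 andbT.
  apply/ler_addgt0Pr => e e0; rewrite add0r.
  have L2 : 0 <= L ^+ 2 by rewrite exprn_ge0.
  (* K is positive even for a degenerate rectangle with L = 0, so e/K can be formed. *)
  have [K [K0 KL]] : exists K, 0 < K /\ 4 * L ^+ 2 <= K.
    by exists (4 * L ^+ 2 + 1); split; lra.
  apply: le_trans (small (e / K) _) _; first by rewrite divr_gt0.
  rewrite (_ : 4 * (e / K) * L ^+ 2 = e * ((4 * L ^+ 2) / K)); last by ring.
  by rewrite ger_pMr// ler_pdivrMr// mul1r.
move=> e0; case: leP => // bad0; exfalso.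
pose h (n : nat) : R := 2 ^- n.
have h0 n : 0 <= h n by rewrite invr_ge0 exprn_ge0.
have hS n : h n = h n.+1 + h n.+1.
  by rewrite /h exprS invfM; set x := (2 ^+ n)^-1; lra.
pose A := b - a; pose B := d - c.
have A0 : 0 <= A by rewrite subr_ge0.
have B0 : 0 <= B by rewrite subr_ge0.
(* At stage n the side lengths are A and B times 2^-n, so the lower left corner determines the
   rectangle. *)
pose I n (p : R * R) := rectint F p.1 (p.1 + A * h n) p.2 (p.2 + B * h n).
pose inside n (p : R * R) := [/\ a <= p.1, p.1 + A * h n <= b, c <= p.2 & p.2 + B * h n <= d].
pose bad n p := inside n p /\ 4 * e * (L * h n) ^+ 2 < cabs (I n p).
pose sub n (p q : R * R) := [/\ p.1 <= q.1, q.1 + A * h n.+1 <= p.1 + A * h n,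
   p.2 <= q.2 & q.2 + B * h n.+1 <= p.2 + B * h n].
(* Putting the hypothesis under the existential makes the step total, as [choice] requires; from a
   corner that is not bad any value will do. *)
have step (np : nat * (R * R)) : exists q, bad np.1 np.2 -> bad np.1.+1 q /\ sub np.1 np.2 q.
  case: np => n [x y] /=.
  have [|nb] := pselect (bad n (x, y)); last by exists (x, y) => /nb.
  move=> [[i1 i2 i3 i4] hb]; rewrite /= in i1 i2 i3 i4.
  have [x' x'E] : exists x', x' = x + A * h n.+1 by eexists.
  have [y' y'E] : exists y', y' = y + B * h n.+1 by eexists.
  have Ah : 0 <= A * h n.+1 by rewrite mulr_ge0.
  have Bh : 0 <= B * h n.+1 by rewrite mulr_ge0.
  have ex : x + A * h n = x' + A * h n.+1 by rewrite x'E (hS n); ring.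
  have ey : y + B * h n = y' + B * h n.+1 by rewrite y'E (hS n); ring.
  have hR : holo_on (in_rect x (x + A * h n) y (y + B * h n)) F.
    by move=> w wr; apply: hF; apply: in_rectS wr.
  have sumI : I n (x, y) = I n.+1 (x, y) + I n.+1 (x, y') + (I n.+1 (x', y) + I n.+1 (x', y')).
    rewrite /I /= -x'E -y'E -ex -ey.
    rewrite (@rectint_split_horizontal _ _ _ x'); first last.
    - exact: hR.
    - by rewrite lerDl mulr_ge0.
    - by rewrite ex lerDl.
    - by rewrite x'E lerDl.
    have yy : y <= y' by rewrite y'E lerDl.
    have yy' : y' <= y + B * h n by rewrite ey lerDl.
    have xx : x <= x' by rewrite x'E lerDl.
    have xx' : x' <= x + A * h n by rewrite ex lerDl.
    rewrite (rectint_split_vertical xx yy yy'); last first.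
      by move=> w wr; apply: hR; apply: in_rectS wr.
    rewrite (rectint_split_vertical xx' yy yy') //.
    by move=> w wr; apply: hR; apply: in_rectS wr.
  have [//|good] := pselect (exists q, [/\ inside n.+1 q, sub n (x, y) q &
      4 * e * (L * h n.+1) ^+ 2 < cabs (I n.+1 q)]).
    by move=> [q [q1 q2 q3]]; exists q => _; split.
  exfalso.
  have bound q : inside n.+1 q -> sub n (x, y) q -> cabs (I n.+1 q) <= 4 * e * (L * h n.+1) ^+ 2.
    by move=> q1 q2; case: leP => // q3; exfalso; apply: good; exists q.
  have Q u v : (u = x \/ u = x') -> (v = y \/ v = y') ->
      cabs (I n.+1 (u, v)) <= 4 * e * (L * h n.+1) ^+ 2.
    by case=> ->; case=> ->; apply: bound; split=> /=;
      move: i1 i2 i3 i4 Ah Bh x'E y'E ex ey;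
      move: (A * h n.+1) (B * h n.+1) (A * h n) (B * h n) => p q p' q'; clear; lra.
  have := Q x y (or_introl erefl) (or_introl erefl).
  have := Q x y' (or_introl erefl) (or_intror erefl).
  have := Q x' y (or_intror erefl) (or_introl erefl).
  have := Q x' y' (or_intror erefl) (or_intror erefl).
  move: hb; rewrite sumI (hS n) => hb q1 q2 q3 q4.
  have := cabsD (I n.+1 (x, y) + I n.+1 (x, y')) (I n.+1 (x', y) + I n.+1 (x', y')).
  have := cabsD (I n.+1 (x, y)) (I n.+1 (x, y')).
  have := cabsD (I n.+1 (x', y)) (I n.+1 (x', y')).
  move: hb; have -> : 4 * e * (L * (h n.+1 + h n.+1)) ^+ 2 = 4 * (4 * e * (L * h n.+1) ^+ 2) by ring.
  lra.
have [st hst] := choice step.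
pose p := fix p n := if n is m.+1 then st (m, p m) else (a, c).
have hp n : bad n (p n) /\ (forall m, (m < n)%N -> sub m (p m) (p m.+1)).
  elim: n => [|n [IH1 IH2]].
    split=> //; split; last by rewrite /I /h expr0 invr1 !mulr1 /A /B addrC subrK [c + _]addrC subrK.
    by split => //=; rewrite /h expr0 invr1 !mulr1 /A /B addrC subrK.
  have [q1 q2] := hst (n, p n) IH1; split => // m; rewrite ltnS leq_eqVlt => /predU1P[->//|].
  exact: IH2.
have hsub n : sub n (p n) (p n.+1) by have [_] := hp n.+1; exact.
have [x hx] : exists x, forall n, (p n).1 <= x <= (p n).1 + A * h n.
  apply: nested_point => n; [by have [] := hsub n|by have [] := hsub n|].
  by rewrite lerDl mulr_ge0.
have [y hy] : exists y, forall n, (p n).2 <= y <= (p n).2 + B * h n.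
  apply: nested_point => n; [by have [] := hsub n|by have [] := hsub n|].
  by rewrite lerDl mulr_ge0.
have [|k hk] := hF (Complex x y).
  have [[[j1 j2 j3 j4] _] _] := hp 0%N; have := hx 0%N; have := hy 0%N.
  by move=> /andP[? ?] /andP[? ?]; split => /=; apply/andP; split; lra.
have [r r0 hr] := hk e e0.
(* L 2^-n bounds the distance between two points of the stage n rectangle, which then lies where the
   linear approximation at the limit point is valid. *)
have [n hn] : exists n, L * h n < r.
  have hc : L * h n @[n --> \oo] --> 0.
    rewrite -(mulr0 L); apply: cvgM; first exact: cvg_cst.
    rewrite (_ : h = GRing.exp 2^-1); first by apply: cvg_expr; rewrite ger0_norm//; lra.
    by apply/funext => n; rewrite /h exprVn.
  by have /cvgrPdist_lt/(_ _ r0)[N _ /(_ N (leqnn N))] := hc;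
    rewrite /= sub0r normrN => hN; exists N; apply: le_lt_trans hN; exact: ler_norm.
have [[[j1 j2 j3 j4] hb] _] := hp n.
have hA : (p n).1 + A * h n - (p n).1 = A * h n by rewrite addrAC subrr add0r.
have hB : (p n).2 + B * h n - (p n).2 = B * h n by rewrite addrAC subrr add0r.
have := @rectint_small F (p n).1 ((p n).1 + A * h n) (p n).2 ((p n).2 + B * h n) (Complex x y) k e.
rewrite hA hB -mulrDl -/L !lerDl !mulr_ge0// => /(_ isT isT (ltW e0)).
have hR : forall w, in_rect (p n).1 ((p n).1 + A * h n) (p n).2 ((p n).2 + B * h n) w -> in_rect a b c d w.
  exact: in_rectS.
have xyr : in_rect (p n).1 ((p n).1 + A * h n) (p n).2 ((p n).2 + B * h n) (Complex x y).
  by split; [exact: hx|exact: hy].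
move=> /(_ (fun w wr => hF w (hR w wr)) xyr) H.
move: hb; rewrite ltNge => /negP; apply; apply: H => w wr.
apply: hr; apply: le_lt_trans (in_rect_dist wr xyr) _.
by rewrite hA hB -mulrDl.
Qed.

End GoursatTheorem.

(** * The complex exponential and rules of differentiation *)

Section ComplexExponential.
Variable R : realType.
Local Notation C := R[i].
Implicit Types (f g : C -> C) (w z : C).

Lemma real_derive_remainder (g : R -> R) (d e : R) : is_derive (0 : R) 1 g d -> 0 < e ->
  exists2 r : R, 0 < r & forall x, `|x| < r -> `|g x - g 0 - x * d| <= e * `|x|.
Proof.
move=> [gd gv] e0.
have : (h^-1 *: (g (h *: 1 + 0) - g 0)) @[h --> (0 : R)^'] --> d by rewrite -gv; exact: gd.
move=> /cvgrPdist_lt/(_ _ e0)/nbhs_ballP[r r0 hr]; exists r => // x xr.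
have [->|x0] := eqVneq x 0; first by rewrite subrr mul0r subrr normr0 mulr0.
have := hr x; rewrite /ball /= sub0r normrN => /(_ xr x0).
rewrite addr0 -[x *: 1]/(x * 1) mulr1 -[_ *: _]/(_ * _) => /ltW hx.
have -> : g x - g 0 - x * d = x * (x^-1 * (g x - g 0) - d) by rewrite [RHS]mulrBr mulVKf.
by rewrite normrM mulrC ler_wpM2r// distrC.
Qed.

Definition cexp w : C := (expR (complex.Re w))%:C%C * expi (complex.Im w).

Lemma cexpD w z : cexp (w + z) = cexp w * cexp z.
Proof.
by rewrite /cexp Re_addc Im_addc expRD expiD rmorphM /=; ring.
Qed.

Lemma cabs_cexp w : cabs (cexp w) = expR (complex.Re w).
Proof. by rewrite cabsM cabs_expi mulr1 cabs_real ger0_norm// expR_ge0. Qed.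

Lemma cexp_remainder0 (e : R) : 0 < e ->
  exists2 r : R, 0 < r & forall w, cabs w < r -> cabs (cexp w - 1 - w) <= e * cabs w.
Proof.
(* Real and imaginary parts each cost 3 k times the modulus of w, hence the 6. The cap k <= 1/6
   gives 1 + k <= 2 and (1 + k)^2 <= 2. *)
move=> e0; pose k : R := Num.min e 1 / 6.
have k0 : 0 < k by rewrite divr_gt0// lt_min e0 ltr01.
have k1 : k <= 1 / 6 by rewrite ler_pM2r ?invr_gt0// ge_min lexx orbT.
have ke : 6 * k <= e by rewrite /k mulrC divfK// ge_min lexx.
clearbody k.
have [r1 r10 h1] := real_derive_remainder (is_derive_expR 0) k0.
have [r2 r20 h2] := real_derive_remainder (is_derive_cos 0) k0.
have [r3 r30 h3] := real_derive_remainder (is_derive_sin 0) k0.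
exists (Num.min (Num.min r1 r2) (Num.min r3 k)).
  by rewrite !lt_min r10 r20 r30 k0.
case=> x y; rewrite !lt_min => /andP[/andP[w1 w2] /andP[w3 w4]].
have xw : `|x| <= cabs (Complex x y) := Re_le_cabs (Complex x y).
have yw : `|y| <= cabs (Complex x y) := Im_le_cabs (Complex x y).
have := cabs_ge0 (Complex x y).
move: (cabs _) w1 w2 w3 w4 xw yw => u w1 w2 w3 w4 xw yw u0.
have := h1 x (le_lt_trans xw w1); have := h2 y (le_lt_trans yw w2).
have := h3 y (le_lt_trans yw w3).
rewrite expR0 cos0 sin0 !(subr0, oppr0, mulr0, addr0, mulr1) => hs hc he.
apply: le_trans (cabs_le_ReIm _) _; rewrite !Re_subc !Im_subc /cexp Re_mulc Im_mulc /=.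
rewrite !mul0r subr0 addr0.
set E := expR x in he *; set c := cos y in hc *; set s := sin y in hs *.
have c1 : `|c| <= 1 by rewrite ler_norml cos_geN1 cos_le1.
have xk : `|x| <= k by rewrite (le_trans xw)// ltW.
have H1 : `|E * c - 1 - x| <= k * u + 2 * (k * u).
  rewrite (_ : _ - _ = (E - 1 - x) * c + (1 + x) * (c - 1)); last by ring.
  apply: le_trans (ler_normD _ _) _; rewrite !normrM; apply: lerD.
    rewrite -[leRHS]mulr1; apply: ler_pM => //; apply: le_trans he _.
    by rewrite ler_wpM2l// ltW.
  apply: ler_pM => //; last by apply: le_trans hc _; rewrite ler_wpM2l// ltW.
  by apply: le_trans (ler_normD _ _) _; rewrite normr1; lra.
have H2 : `|E * s - 0 - y| <= 2 * (k * u) + k * u.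
  rewrite subr0 (_ : _ - _ = (E - 1) * s + (s - y)); last by ring.
  apply: le_trans (ler_normD _ _) _; rewrite normrM; apply: lerD; last first.
    by apply: le_trans hs _; rewrite ler_wpM2l// ltW.
  have s2 : `|s| <= (1 + k) * u.
    rewrite -[s](subrK y); apply: le_trans (ler_normD _ _) _.
    have := ler_wpM2l (ltW k0) yw; lra.
  have E2 : `|E - 1| <= (1 + k) * k.
    rewrite -[E - 1](subrK x); apply: le_trans (ler_normD _ _) _.
    have := ler_wpM2l (ltW k0) xk; lra.
  apply: (@le_trans _ _ ((1 + k) * k * ((1 + k) * u))); first exact: ler_pM.
  have kk : (1 + k) * (1 + k) <= 2 by nra.
  by rewrite mulrACA ler_wpM2r// mulr_ge0// ltW.
have : 6 * k * u <= e * u by rewrite ler_wpM2r.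
by rewrite -[6 * k * u]mulrA; move: H1 H2; set P := k * u; lra.
Qed.

(** The functional equation moves the estimate to 0; dividing e by the modulus of [cexp w]
    compensates the common factor. *)
Lemma has_derivative_cexp w : has_derivative cexp w (cexp w).
Proof.
move=> e e0; set K := expR (complex.Re w); have K0 : 0 < K by exact: expR_gt0.
have [r r0 hr] := cexp_remainder0 (divr_gt0 e0 K0); exists r => // v vr.
have -> : cexp v - cexp w - (v - w) * cexp w = cexp w * (cexp (v - w) - 1 - (v - w)).
  have -> : cexp v = cexp (v - w) * cexp w by rewrite -cexpD subrK.
  by ring.
rewrite cabsM cabs_cexp -/K -ler_pdivlMl//.
by apply: le_trans (hr _ vr) _; rewrite mulrA [_^-1 * _]mulrC.
Qed.

Lemma has_derivative_lip f z d : has_derivative f z d ->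
  exists2 r : R, 0 < r & forall w, cabs (w - z) < r ->
    cabs (f w - f z) <= (1 + cabs d) * cabs (w - z).
Proof.
move=> h; have [r r0 hr] := h _ ltr01; exists r => // w wr.
rewrite -[f w - f z](subrK ((w - z) * d)); apply: le_trans (cabsD _ _) _.
by rewrite cabsM [leRHS]mulrDl [cabs d * _]mulrC lerD2r hr.
Qed.

Lemma has_derivative_comp f g z d d' : has_derivative f z d -> has_derivative g (f z) d' ->
  has_derivative (g \o f) z (d * d').
Proof.
move=> hf hg e e0; have [r1 r10 h1] := has_derivative_lip hf.
set K := 1 + cabs d in h1; have K0 : 0 < K by have := cabs_ge0 d; rewrite /K; lra.
set L := 1 + cabs d'; have L0 : 0 < L by have := cabs_ge0 d'; rewrite /L; lra.
have e2 : 0 < e / 2 by rewrite divr_gt0.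
have [r2 r20 h2] := hg (e / 2 / K) (divr_gt0 e2 K0).
have [r3 r30 h3] := hf (e / 2 / L) (divr_gt0 e2 L0).
exists (Num.min (Num.min r1 (r2 / K)) r3); first by rewrite !lt_min r10 r30 divr_gt0.
move=> w; rewrite !lt_min ltr_pdivlMr// => /andP[/andP[w1 w2] w3] /=.
have fw := h1 _ w1; set u := cabs (w - z) in w1 w2 w3 fw *.
have u0 : 0 <= u by exact: cabs_ge0.
have := h2 (f w); have -> : cabs (f w - f z) < r2.
  by apply: le_lt_trans fw _; rewrite mulrC.
move=> /(_ isT) gw; have := h3 _ w3; rewrite -/u => fw3.
have -> : g (f w) - g (f z) - (w - z) * (d * d') =
  (g (f w) - g (f z) - (f w - f z) * d') + d' * (f w - f z - (w - z) * d) by ring.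
apply: le_trans (cabsD _ _) _; rewrite cabsM [leRHS](_ : _ = e / 2 * u + e / 2 * u); last by lra.
apply: lerD.
  apply: le_trans gw _; rewrite -[leLHS]mulrA ler_wpM2l ?divr_ge0 ?(ltW e0)//.
  by rewrite ler_pdivrMl.
apply: (@le_trans _ _ (L * (e / 2 / L * u))).
  by apply: ler_pM => //; rewrite ?cabs_ge0// /L lerDr.
by rewrite mulrA mulrCA mulfV ?gt_eqF// mulr1.
Qed.

Lemma has_derivative_mul f g z d d' : has_derivative f z d -> has_derivative g z d' ->
  has_derivative (fun w => f w * g w) z (d * g z + f z * d').
Proof.
move=> hf hg e e0; have e3 : 0 < e / 3 by rewrite divr_gt0.
have [r1 r10 h1] := has_derivative_lip hf; have [r2 r20 h2] := has_derivative_lip hg.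
set K := 1 + cabs d in h1; have K0 : 0 < K by have := cabs_ge0 d; rewrite /K; lra.
set L := 1 + cabs d' in h2; have L0 : 0 < L by have := cabs_ge0 d'; rewrite /L; lra.
pose A : R := 1 + cabs (g z); have A0 : 0 < A by have := cabs_ge0 (g z); rewrite /A; lra.
pose B : R := 1 + cabs (f z); have B0 : 0 < B by have := cabs_ge0 (f z); rewrite /B; lra.
have [r3 r30 h3] := hf _ (divr_gt0 e3 A0); have [r4 r40 h4] := hg _ (divr_gt0 e3 B0).
exists (Num.min (Num.min r1 r2) (Num.min (Num.min r3 r4) (e / 3 / (K * L)))).
  by rewrite !lt_min r10 r20 r30 r40 divr_gt0// mulr_gt0.
move=> w; rewrite !lt_min ltr_pdivlMr ?mulr_gt0//.
move=> /andP[/andP[/h1 w1 /h2 w2] /andP[/andP[/h3 w3 /h4 w4] w5]].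
have u0 := cabs_ge0 (w - z); move: (cabs (w - z)) u0 w1 w2 w3 w4 w5 => u u0 w1 w2 w3 w4 w5.
have -> : f w * g w - f z * g z - (w - z) * (d * g z + f z * d') =
  g z * (f w - f z - (w - z) * d) + f z * (g w - g z - (w - z) * d') +
  (f w - f z) * (g w - g z) by ring.
apply: le_trans (cabsD _ _) _.
have H (D x : R) y : 0 < D -> 0 <= x -> x <= D -> cabs y <= e / 3 / D * u -> x * cabs y <= e / 3 * u.
  move=> D0 x0 xD hy; apply: (@le_trans _ _ (D * (e / 3 / D * u))).
    by apply: ler_pM => //; exact: cabs_ge0.
  by rewrite mulrA [D * _]mulrC divfK ?gt_eqF.
have H1 : cabs (g z * (f w - f z - (w - z) * d)) <= e / 3 * u.
  by rewrite cabsM; apply: (H A) => //; rewrite ?cabs_ge0// /A lerDr.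
have H2 : cabs (f z * (g w - g z - (w - z) * d')) <= e / 3 * u.
  by rewrite cabsM; apply: (H B) => //; rewrite ?cabs_ge0// /B lerDr.
have H3 : cabs ((f w - f z) * (g w - g z)) <= e / 3 * u.
  rewrite cabsM; apply: (@le_trans _ _ (K * u * (L * u))).
    by apply: ler_pM => //; exact: cabs_ge0.
  rewrite (_ : _ * _ = (u * (K * L)) * u); last by ring.
  by rewrite ler_wpM2r// ltW.
have := cabsD (g z * (f w - f z - (w - z) * d)) (f z * (g w - g z - (w - z) * d')).
move: H1 H2 H3; rewrite (_ : e * u = e / 3 * u + e / 3 * u + e / 3 * u); last by lra.
by set x := e / 3 * u; lra.
Qed.

Lemma has_derivative_scale (m : C) z : has_derivative (fun w => m * w) z m.
Proof.
move=> e e0; exists 1 => // w _.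
by rewrite (_ : _ - _ = 0) ?cabs0 ?mulr_ge0 ?cabs_ge0 ?(ltW e0)//; ring.
Qed.

End ComplexExponential.

(** * Circle integrals and their dependence on the radius *)

Section CircleMeans.
Variable R : realType.
Local Notation C := R[i].
Implicit Types (f : C -> C) (r m : R).

Definition circle_integral f r m : C :=
  segint 0 (2 * pi) (fun t => f (r%:C%C * expi t) * expi (m * t)).

Lemma expi_2pi : expi (2 * pi) = 1 :> C.
Proof. by rewrite /expi mulr_natl cos2pi sin2pi. Qed.

Lemma expi_nat_2pi k : expi (k%:R * (2 * pi)) = 1 :> C.
Proof. by rewrite -expiX expi_2pi expr1n. Qed.

Lemma expi_Nnat_2pi k : expi (- k%:R * (2 * pi)) = 1 :> C.
Proof. by rewrite mulNr expiN expi_nat_2pi conjc1. Qed.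

Lemma cabs_circle r t : 0 <= r -> cabs (r%:C%C * expi t) = r.
Proof. by move=> r0; rewrite cabsM cabs_expi mulr1 cabs_real ger0_norm. Qed.

Lemma cexp_polar (s t : R) : cexp (Complex s t) = (expR s)%:C%C * expi t.
Proof. by []. Qed.

Lemma twopi_ge0 : 0 <= 2 * pi :> R.
Proof. by rewrite mulr_ge0// pi_ge0. Qed.

Lemma has_derivative_polar f m w k : has_derivative f (cexp w) k ->
  exists d, has_derivative (fun w => f (cexp w) * cexp (m%:C%C * w)) w d.
Proof.
move=> hf; eexists; apply: has_derivative_mul.
  exact: (has_derivative_comp (@has_derivative_cexp R w) hf).
exact: (has_derivative_comp (has_derivative_scale _ _) (has_derivative_cexp _)).
Qed.

(** Goursat is applied to f(e^w) e^(mw) over [ln r1, ln r2] x [0, 2 pi]. The horizontal sides cancel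
    by periodicity, which is what the condition on m says, and the vertical side at ln r is r^m
    times the circle integral. The origin has no logarithm, hence 0 < r1. *)
Lemma circle_integral_scale f m r1 r2 : (forall z, cabs z < 1 -> derivable f z 1) ->
  expi (m * (2 * pi)) = 1 :> C -> 0 < r1 -> r1 <= r2 -> r2 < 1 ->
  (expR (m * ln r1))%:C%C * circle_integral f r1 m =
  (expR (m * ln r2))%:C%C * circle_integral f r2 m.
Proof.
move=> hf m1 r10 r12 r21; have r20 : 0 < r2 := lt_le_trans r10 r12.
pose F w := f (cexp w) * cexp (m%:C%C * w).
have ab : ln r1 <= ln r2 by rewrite ler_ln.
have hF : holo_on (in_rect (ln r1) (ln r2) 0 (2 * pi)) F.
  move=> w [/andP[_ w2] _].
  have [|k hk] := @derivable_has_derivative _ f (cexp w); last exact: has_derivative_polar hk.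
  by apply: hf; rewrite cabs_cexp (le_lt_trans _ r21)// -(lnK r20) ler_expR.
have Fv r t : 0 < r -> F (Complex (ln r) t) =
    (expR (m * ln r))%:C%C * (f (r%:C%C * expi t) * expi (m * t)).
  move=> r0; rewrite /F cexp_polar lnK//.
  have -> : m%:C%C * Complex (ln r) t = Complex (m * ln r) (m * t) by simpc.
  by rewrite cexp_polar; ring.
have Fseg r : r1 <= r <= r2 -> segint 0 (2 * pi) (fun t => F (Complex (ln r) t)) =
    (expR (m * ln r))%:C%C * circle_integral f r m.
  move=> /andP[r1r rr2]; have r0 := lt_le_trans r10 r1r.
  have fi : cintegrable lebesgue_measure `[0, 2 * pi]
     (fun t => f (r%:C%C * expi t) * expi (m * t)).
    apply: eq_cintegrable (cintegrableZ _ (expR (- (m * ln r)))%:C%C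
      (cintegrable_seg (holo_vertical (x := ln r) hF _))) => //.
      move=> t _; rewrite /= Fv// mulrA -rmorphM /= -expRD addNr expR0 mul1r//.
    by rewrite !ler_ln ?posrE// r1r.
  rewrite /circle_integral /segint -cintgZ//.
  by apply: eq_cintg => t _; rewrite Fv.
have := goursat ab twopi_ge0 hF; rewrite /rectint.
have -> : segint (ln r1) (ln r2)
    (fun s => F (Complex s 0) - F (Complex s (2 * pi))) = 0.
  rewrite -(mul0r (ln r2 - ln r1)%:C%C) -(segint_cst _ ab).
  apply: eq_cintg => s _; rewrite /F.
  have -> : m%:C%C * Complex s 0 = Complex (m * s) 0 by simpc.
  have -> : m%:C%C * Complex s (2 * pi) = Complex (m * s) (m * (2 * pi)) by simpc.
  by rewrite !cexp_polar m1 expi0 expi_2pi subrr.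
rewrite add0r segintB; last 2 first.
- by apply: (holo_vertical hF); rewrite ab lexx.
- by apply: (holo_vertical hF); rewrite ab lexx.
move=> /eqP; rewrite mulf_eq0 => /orP[|].
  by rewrite eq_complex /= oner_eq0 andbF.
by rewrite subr_eq0 !Fseg ?lexx ?r12// => /eqP.
Qed.

(* Applied to the constant function 1, the scaling identity forces the integral
   of a nontrivial character to vanish. *)
Lemma segint_expi m : expi (m * (2 * pi)) = 1 :> C -> m != 0 ->
  segint 0 (2 * pi) (fun t => expi (m * t)) = 0 :> C.
Proof.
move=> m1 m0.
have E r : segint 0 (2 * pi) (fun t => expi (m * t)) = circle_integral (fun=> 1) r m.
  by apply: eq_cintg => t _; rewrite mul1r.
have hf : forall z : C, cabs z < 1 -> derivable (fun=> 1 : C) z 1.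
  by move=> z _; exact: derivable_cst.
have h4 : (0 : R) < 1/4 by lra.
have h42 : (1/4 : R) <= 1/2 by lra.
have h21 : (1/2 : R) < 1 by lra.
have := circle_integral_scale hf m1 h4 h42 h21.
rewrite -!E => /eqP; rewrite -subr_eq0 -mulrBl mulf_eq0 => /orP[|/eqP//].
rewrite subr_eq0 => /eqP/complexI/expR_inj/(mulfI m0) H.
by exfalso; have := @ln_inj R (1 / 4) (1 / 2); rewrite !posrE H => /(_ _ _ erefl); lra.
Qed.

Lemma segint_expi0 : segint 0 (2 * pi) (fun t => expi (0 * t)) = (2 * pi)%:C%C :> C.
Proof.
rewrite -[RHS]mul1r -{2}(subr0 (2 * pi)) -(segint_cst _ twopi_ge0).
by apply: eq_cintg => t _; rewrite mul0r expi0.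
Qed.

End CircleMeans.

(** * The Fejer kernel *)

Section FejerKernel.
Variable R : realType.
Local Notation C := R[i].
Local Notation mu := (@lebesgue_measure R).
Implicit Types (phi : R -> C) (s t theta m : R) (n : nat).

Definition dirichlet n s : C := \sum_(j < n) expi (j%:R * s).

(** The usual kernel, the sum of (1 - |m|/n) e^(ims) over |m| < n, written as a square of a
    one-sided sum: nonnegativity is then visible. For n = 0 the division gives 0, hence the
    condition 0 < n in later lemmas. *)
Definition fejer n s : R := cabs (dirichlet n s) ^+ 2 / n%:R.

Lemma fejer_ge0 n s : 0 <= fejer n s.
Proof. by rewrite divr_ge0// exprn_ge0// cabs_ge0. Qed.

Lemma cabs_sqr (z : C) : (cabs z ^+ 2)%:C%C = z * z^*%C.
Proof. by rewrite -sqr_normc normCE rmorphXn. Qed.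

Lemma fejerE n s : (fejer n s)%:C%C =
  n%:R^-1 * \sum_(j < n) \sum_(l < n) expi ((j%:R - l%:R) * s).
Proof.
rewrite /fejer rmorphM /= fmorphV /= rmorph_nat cabs_sqr mulrC; congr (_ * _).
have -> : (dirichlet n s)^*%C = \sum_(l < n) expi (- (l%:R * s)).
  by rewrite /dirichlet rmorph_sum; apply: eq_bigr => l _; rewrite expiN.
rewrite /dirichlet mulr_suml; apply: eq_bigr => j _.
rewrite mulr_sumr; apply: eq_bigr => l _.
by rewrite -expiD; congr expi; ring.
Qed.

Lemma fejerN n s : fejer n (- s) = fejer n s.
Proof.
apply: (@complexI R); rewrite !fejerE exchange_big /=; congr (_ * _).
by apply: eq_bigr => j _; apply: eq_bigr => l _; congr expi; ring.
Qed.

Lemma dirichlet_telescope n s : dirichlet n s * (expi s - 1) = expi (n%:R * s) - 1.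
Proof.
elim: n => [|n IH]; first by rewrite /dirichlet big_ord0 !mul0r expi0 subrr.
rewrite /dirichlet big_ord_recr /= mulrDl -/(dirichlet n s) IH.
by rewrite -[n.+1%:R]natr1 mulrDl mul1r expiD; ring.
Qed.

(** The square of |e^(is) - 1| is 2 (1 - cos s), and the telescoped Dirichlet sum times e^(is) - 1
    has modulus at most 2. The kernel is thus small wherever 1 - cos s is not. *)
Lemma fejer_cos n s : (0 < n)%N -> fejer n s * (1 - cos s) <= 2 / n%:R.
Proof.
move=> n0; have n0' : 0 < n%:R :> R by rewrite ltr0n.
have E : cabs (expi s - 1 : C) ^+ 2 = 2 * (1 - cos s).
  rewrite /expi /cabs /= sqr_sqrtr ?addr_ge0 ?sqr_ge0//.
  by rewrite subr0; have := cos2Dsin2 s; rewrite !expr2; lra.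
have B : cabs (expi (n%:R * s) - 1 : C) <= 2.
  by rewrite (le_trans (cabsB _ _))// cabs_expi cabs1; lra.
rewrite /fejer mulrAC ler_pM2r ?invr_gt0//.
have : (cabs (dirichlet n s) * cabs (expi s - 1 : C)) ^+ 2 <= 2 ^+ 2.
  rewrite -cabsM dirichlet_telescope; apply: lerXn2r => //; rewrite nnegrE//.
  exact: cabs_ge0.
by rewrite exprMn E; set x := _ ^+ 2; rewrite [2 ^+ 2]expr2; lra.
Qed.

Lemma continuous_expi : continuous (@expi R).
Proof.
move=> t; apply/cvg_ReIm; split; [exact: continuous_cos|exact: continuous_sin].
Qed.

Lemma continuous_expi_affine (a b : R) : continuous (fun t => expi (a * t + b) : C).
Proof.
move=> t; apply: (@continuous_comp _ _ _ (fun t => a * t + b) (@expi R)); last exact: continuous_expi.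
by apply: cvgD; [apply: cvgM; [exact: cvg_cst|exact: cvg_id]|exact: cvg_cst].
Qed.

Lemma continuous_expiM m : continuous (fun t => expi (m * t) : C).
Proof.
move=> t; rewrite (_ : (fun _ => _) = (fun t => expi (m * t + 0) : C)).
  exact: continuous_expi_affine.
by apply/funext => u; rewrite addr0.
Qed.

Lemma continuous_on_segM (a b : R) (h k : R -> C) : continuous_on_seg a b h ->
  continuous_on_seg a b k -> continuous_on_seg a b (fun t => h t * k t).
Proof. by move=> hc kc t tab; apply: cvgM; [exact: hc|exact: kc]. Qed.

Lemma continuous_on_segW (a b : R) (h : R -> C) : continuous h -> continuous_on_seg a b h.
Proof. by move=> hc t _; exact: hc. Qed.

Lemma continuous_sumC (I : Type) (r : seq I) (h : I -> R -> C) :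
  (forall i, continuous (h i)) -> continuous (fun t => \sum_(i <- r) h i t).
Proof.
move=> hc; elim: r => [|i r IH] t.
  by under eq_fun do rewrite big_nil; exact: cvg_cst.
under eq_fun do rewrite big_cons.
by apply: cvgD; [exact: hc|exact: IH].
Qed.

Lemma continuous_fejer n theta : continuous (fun t => (fejer n (theta - t))%:C%C : C).
Proof.
move=> t; under eq_fun do rewrite fejerE.
apply: cvgM; first exact: cvg_cst.
apply: continuous_sumC => j; apply: continuous_sumC => l u.
rewrite (_ : (fun _ => _) = (fun t => expi ((l%:R - j%:R) * t + (j%:R - l%:R) * theta) : C)).
  exact: continuous_expi_affine.
by apply/funext => v; congr expi; ring.
Qed.

Definition fcoef phi m : C :=
  ((2 * pi)^-1)%:C%C * segint 0 (2 * pi) (fun t => phi t * expi (- (m * t))).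

Definition fejer_mean n phi theta : C :=
  ((2 * pi)^-1)%:C%C * segint 0 (2 * pi) (fun t => (fejer n (theta - t))%:C%C * phi t).

Lemma cintegrable_expi_mul phi m : continuous_on_seg 0 (2 * pi) phi ->
  cintegrable mu `[0, 2 * pi] (fun t => phi t * expi (- (m * t))).
Proof.
move=> pc; apply: cintegrable_seg; apply: continuous_on_segM; first exact: pc.
apply: continuous_on_segW; rewrite (_ : (fun _ => _) = (fun t => expi (- m * t) : C)).
  exact: continuous_expiM.
by apply/funext => t; rewrite mulNr.
Qed.

(** The sum stays over pairs (j, l) and is not grouped by j - l: once negative coefficients vanish,
    row j is the partial sum with j + 1 terms, and the mean is visibly a Cesaro mean. *)
Lemma fejer_meanE n phi theta : continuous_on_seg 0 (2 * pi) phi ->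
  fejer_mean n phi theta = n%:R^-1 *
    \sum_(j < n) \sum_(l < n) expi ((j%:R - l%:R) * theta) * fcoef phi (j%:R - l%:R).
Proof.
move=> pc; rewrite /fejer_mean.
have ci := fun m => cintegrable_expi_mul m pc.
have -> : segint 0 (2 * pi) (fun t => (fejer n (theta - t))%:C%C * phi t) =
  segint 0 (2 * pi) (fun t => n%:R^-1 * \sum_(j < n) \sum_(l < n)
     expi ((j%:R - l%:R) * theta) * (phi t * expi (- ((j%:R - l%:R) * t)))).
  apply: eq_cintg => t _; rewrite fejerE -mulrA; congr (_ * _).
  rewrite mulr_suml; apply: eq_bigr => j _; rewrite mulr_suml; apply: eq_bigr => l _.
  by rewrite [phi t * _]mulrC mulrA -expiD; congr (expi _ * _); ring.
have c1 j l : cintegrable mu `[0, 2 * pi] (fun t => expi ((j%:R - l%:R) * theta) *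
    (phi t * expi (- ((j%:R - l%:R) * t)))) by apply: cintegrableZ.
rewrite /segint cintgZ//; last first.
  by apply: cintegrable_sum => // j; exact: cintegrable_sum.
rewrite cintg_sum//; last by move=> j; exact: cintegrable_sum.
rewrite mulrCA; congr (_ * _); rewrite mulr_sumr; apply: eq_bigr => j _.
rewrite cintg_sum// mulr_sumr; apply: eq_bigr => l _.
by rewrite cintgZ// /fcoef mulrCA.
Qed.

Lemma nat_sub_neq0 (j l : nat) : j != l -> (j%:R - l%:R : R) != 0.
Proof. by rewrite subr_eq0 eqr_nat. Qed.

Lemma expi_sub_2pi (j l : nat) : expi ((j%:R - l%:R) * (2 * pi)) = 1 :> C.
Proof.
rewrite mulrBl expiD expi_nat_2pi mul1r -mulNr; exact: expi_Nnat_2pi.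
Qed.

Lemma fcoef_cst1 (j l : nat) : fcoef (fun=> 1) (j%:R - l%:R) = (j == l)%:R.
Proof.
rewrite /fcoef.
have -> : segint 0 (2 * pi) (fun t => 1 * expi (- ((j%:R - l%:R) * t))) =
  segint 0 (2 * pi) (fun t => expi ((l%:R - j%:R) * t)) :> C.
  by apply: eq_cintg => t _; rewrite mul1r; congr expi; ring.
have [->|kl] := eqVneq j l.
  rewrite subrr segint_expi0 -rmorphM /= mulVf ?rmorph1//.
  by rewrite mulf_neq0// ?gt_eqF// pi_gt0.
by rewrite segint_expi ?mulr0 ?expi_sub_2pi// nat_sub_neq0// eq_sym.
Qed.

Lemma fejer_mean_cst1 n theta : (0 < n)%N -> fejer_mean n (fun=> 1) theta = 1.
Proof.
move=> n0; rewrite fejer_meanE; last by apply: continuous_on_segW => t; exact: cvg_cst.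
rewrite (eq_bigr (fun=> 1)) => [|j _].
  by rewrite sumr_const card_ord mulVf// pnatr_eq0 -lt0n.
rewrite (bigD1 j)//= fcoef_cst1 eqxx subrr mul0r expi0 mulr1 big1 ?addr0// => l lj.
rewrite fcoef_cst1 (_ : (j == l :> nat) = false) ?mulr0//.
by apply/negbTE; rewrite eq_sym; exact: lj.
Qed.

Lemma continuous_fejerR n theta : continuous (fun t => fejer n (theta - t)).
Proof. by move=> t; have /cvg_ReIm[] := @continuous_fejer n theta t. Qed.

Lemma integrable_seg (f : R -> R) (a b : R) : continuous f ->
  mu.-integrable `[a, b] (fun t => (f t)%:E).
Proof.
move=> fc; apply: continuous_compact_integrable; first exact: segment_compact.
by apply: continuous_in_subspaceT => t _; exact: fc.
Qed.

Lemma fejer_integral n theta : (0 < n)%N ->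
  \int[mu]_(t in `[0, 2 * pi]) fejer n (theta - t) = 2 * pi.
Proof.
move=> n0; have := fejer_mean_cst1 theta n0; rewrite /fejer_mean /segint /cintg.
have p0 : (2 * pi : R) != 0 by rewrite mulf_neq0// ?gt_eqF// pi_gt0.
move=> /(congr1 (fun z => (2 * pi)%:C%C * z)).
rewrite mulrA -rmorphM divff// rmorph1 mul1r mulr1 => -[E _].
rewrite -[RHS]E; apply: eq_Rintegral => t _.
by rewrite mulr1 mulr0 subr0.
Qed.

End FejerKernel.

(** * Pointwise convergence of Fejer means *)

Section FejerConvergence.
Variable R : realType.
Local Notation C := R[i].
Local Notation mu := (@lebesgue_measure R).
Implicit Types (phi : R -> C) (s t theta m : R) (n : nat).

Lemma pi2_gt0 : 0 < 2 * pi :> R.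
Proof. by rewrite mulr_gt0// pi_gt0. Qed.

Lemma cvg_cabs (T : Type) (F : set_system T) {FF : Filter F} (u : T -> C) (l : C) :
  u @ F --> l -> cabs (u x) @[x --> F] --> cabs l.
Proof.
move=> /cvg_cabsP hc; apply/cvgrPdist_lt => e e0; apply: filterS (hc _ e0) => t.
by rewrite distrC; apply: le_lt_trans; exact: cabs_dist.
Qed.

Lemma continuous_on_seg_bounded (a b : R) (h : R -> C) : a <= b ->
  continuous_on_seg a b h -> exists M, forall t, a <= t <= b -> cabs (h t) <= M.
Proof.
move=> ab hc; have [|c _ hM] := @EVT_max R (fun t => cabs (h t)) a b ab.
  apply: continuous_in_subspaceT => t; rewrite inE /= in_itv /= => tab.
  by apply: cvg_cabs; exact: hc.
by exists (cabs (h c)) => t tab; apply: hM; rewrite in_itv.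
Qed.

(** Since [cos] is close to 1 near 2 pi as well as near 0, both have to be avoided. Reflection at pi
    reduces to monotonicity on [0, pi]. *)
Lemma cos_le_away (d s : R) : 0 < d -> d <= pi -> d <= `|s| -> `|s| <= 2 * pi - d ->
  cos s <= cos d.
Proof.
move=> d0 dpi ds sd.
have -> : cos s = cos `|s| by case: (ger0P s) => // _; rewrite cosN.
have mono x y : 0 <= x <= pi -> 0 <= y <= pi -> x <= y -> cos y <= cos x.
  by move=> xp yp; rewrite !leNgt ltr_cos// in_itv.
case: (lerP `|s| pi) => h.
  by apply: mono => //; rewrite ?h ?normr_ge0 ?dpi ?(ltW d0).
have -> : cos `|s| = cos (2 * pi - `|s|).
  by rewrite addrC mulr_natl cosD2pi cosN.
by apply: mono; lra.
Qed.

Lemma integrable_fejer_mul n theta (g : R -> R) : continuous g ->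
  mu.-integrable `[0, 2 * pi] (fun t => (fejer n (theta - t) * g t)%:E).
Proof.
move=> gc; apply: integrable_seg => t.
by apply: cvgM; [exact: continuous_fejerR|exact: gc].
Qed.

(** A majorant e + c (1 - cos) replaces the usual splitting of the integral into near and far parts:
    the total mass of the kernel pays for e, and [fejer_cos] pays for the other term. The factor 2
    comes from [cabs_cintg_le]. *)
Lemma fejer_mean_le n phi theta (e c : R) : (0 < n)%N -> 0 <= c ->
  continuous_on_seg 0 (2 * pi) phi ->
  (forall t, 0 <= t <= 2 * pi -> cabs (phi t) <= e + c * (1 - cos (theta - t))) ->
  cabs (fejer_mean n phi theta) <= 2 * e + 4 * c / n%:R.
Proof.
move=> n0 c0 pc pe; rewrite /fejer_mean cabsM cabs_real.
have pi0 := pi2_gt0; rewrite ger0_norm ?invr_ge0 ?(ltW pi0)// ler_pdivrMl//.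
have kc : continuous_on_seg 0 (2 * pi) (fun t => (fejer n (theta - t))%:C%C * phi t).
  by apply: continuous_on_segM; [apply: continuous_on_segW; exact: continuous_fejer|exact: pc].
have ki := cintegrable_seg kc.
apply: (le_trans (cabs_cintg_le _ ki)); first by [].
have i1 : mu.-integrable `[0, 2 * pi] (fun t => (fejer n (theta - t))%:E).
  by apply: integrable_seg; exact: continuous_fejerR.
have i2 : mu.-integrable `[0, 2 * pi] (fun t => (fejer n (theta - t) * e)%:E).
  by apply: integrable_fejer_mul => t; exact: cvg_cst.
have i3 : mu.-integrable `[0, 2 * pi] (fun t => (c * (2 / n%:R))%:E).
  by apply: integrable_seg => t; exact: cvg_cst.
have -> : 2 * pi * (2 * e + 4 * c / n%:R) = 2 * (2 * pi * e + c * (2 / n%:R) * (2 * pi)).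
  by ring.
rewrite ler_wpM2l//.
have -> : 2 * pi * e + c * (2 / n%:R) * (2 * pi) =
    \int[mu]_(t in `[0, 2 * pi]) (fejer n (theta - t) * e + c * (2 / n%:R)).
  rewrite RintegralD// RintegralZr// fejer_integral// Rintegral_cst//.
  by rewrite fine_lebesgue_seg ?subr0// ltW.
apply: le_Rintegral => //.
- exact: cintegrable_cabs.
- by apply: eq_integrable; [| |apply: (integrableD _ i2 i3)].
- move=> t; rewrite /= in_itv /= => /pe pt.
  rewrite cabsM cabs_real ger0_norm ?fejer_ge0//.
  apply: le_trans (ler_wpM2l (fejer_ge0 _ _) pt) _.
  rewrite mulrDr lerD2l mulrCA ler_wpM2l//; exact: fejer_cos.
Qed.

Lemma fejer_mean_bound n phi theta (M : R) : (0 < n)%N ->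
  continuous_on_seg 0 (2 * pi) phi ->
  (forall t, 0 <= t <= 2 * pi -> cabs (phi t) <= M) ->
  cabs (fejer_mean n phi theta) <= 2 * M.
Proof.
move=> n0 pc pM; have := @fejer_mean_le n phi theta M 0 n0 (lexx _) pc.
by rewrite mulr0 mul0r addr0; apply => t /pM; rewrite mul0r addr0.
Qed.

Lemma fejer_mean_sub_cst n phi theta (k : C) : (0 < n)%N ->
  continuous_on_seg 0 (2 * pi) phi ->
  fejer_mean n phi theta - k = fejer_mean n (fun t => phi t - k) theta.
Proof.
move=> n0 pc; rewrite -{1}[k]mulr1 -(fejer_mean_cst1 theta n0) /fejer_mean.
have kc (h : R -> C) : continuous_on_seg 0 (2 * pi) h ->
    cintegrable mu `[0, 2 * pi] (fun t => (fejer n (theta - t))%:C%C * h t).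
  move=> hc; apply: cintegrable_seg; apply: continuous_on_segM; last exact: hc.
  by apply: continuous_on_segW; exact: continuous_fejer.
have i1 : cintegrable mu `[0, 2 * pi] (fun t => (fejer n (theta - t))%:C%C * (1 : C)).
  by apply: kc; exact: continuous_on_seg_cst.
rewrite mulrCA -mulrBr; congr (_ * _).
rewrite /segint -cintgZ// -cintgB//; [|exact: kc|exact: cintegrableZ].
by apply: eq_cintg => t _; ring.
Qed.

(** [phi] is continuous on the closed interval but not assumed periodic, so the endpoints, which are
    one point of the circle, are excluded. *)
Lemma fejer_mean_cvg phi theta : continuous_on_seg 0 (2 * pi) phi ->
  0 < theta < 2 * pi -> fejer_mean n phi theta @[n --> \oo] --> phi theta.
Proof.
move=> pc /andP[th0 th1]; apply/cvg_cabsP => e e0.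
have [M hM] := continuous_on_seg_bounded (ltW pi2_gt0) pc.
have e4 : 0 < e / 4 by rewrite divr_gt0.
have /cvg_cabsP/(_ _ e4)/nbhs_ballP[d0 d00 hd] : {for theta, continuous phi}.
  by apply: pc; rewrite !ltW.
(* Besides the modulus of continuity, d stays below the distances from theta to 0 and 2 pi: then
   |theta - t| <= 2 pi - d on the whole interval, as [cos_le_away] requires. *)
pose d := Num.min (Num.min d0 theta) (Num.min (2 * pi - theta) pi).
have d_gt0 : 0 < d by rewrite !lt_min d00 th0 subr_gt0 th1 pi_gt0.
have dd0 : d <= d0 by rewrite !ge_min lexx.
have dth : d <= theta by rewrite !ge_min lexx !orbT.
have dth' : d <= 2 * pi - theta by rewrite !ge_min lexx !orbT.
have dpi : d <= pi by rewrite !ge_min lexx !orbT.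
clearbody d.
have M0 : 0 <= M by apply: le_trans (cabs_ge0 _) (hM theta _); rewrite !ltW.
have cosd : cos d < 1.
  by rewrite -cos0 ltr_cos// in_itv /= ?lexx ?pi_ge0// dpi ltW.
have k0 : 0 < 1 - cos d by rewrite subr_gt0.
(* At distance at least d, the factor 1 - cos is at least 1 - cos d, so this c makes the second term
   exceed the crude bound 2 M on the difference. *)
pose c := 2 * M / (1 - cos d).
have c0 : 0 <= c by rewrite divr_ge0 ?mulr_ge0 ?(ltW k0).
have bnd t : 0 <= t <= 2 * pi ->
    cabs (phi t - phi theta) <= e / 4 + c * (1 - cos (theta - t)).
  move=> /andP[t0 t1].
  have cos1 : 0 <= 1 - cos (theta - t) by rewrite subr_ge0 cos_le1.
  case: (ltP `|theta - t| d) => h.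
    apply: (@le_trans _ _ (e / 4)); last by rewrite lerDl mulr_ge0.
    by apply/ltW/hd; apply: lt_le_trans h _.
  apply: (@le_trans _ _ (2 * M)).
    apply: le_trans (cabsB _ _) _.
    by rewrite mulr_natl mulr2n lerD// hM ?t0 ?t1// !ltW.
  apply: ler_wpDl; first exact: ltW.
  rewrite /c mulrAC ler_pdivlMr// ler_wpM2l ?mulr_ge0// lerD2l lerN2.
  apply: cos_le_away => //.
  by rewrite ler_norml; apply/andP; split; lra.
have cc0 : 4 * c / n%:R @[n --> \oo] --> 0.
  rewrite -(mulr0 (4 * c)); apply: cvgM; first exact: cvg_cst.
  rewrite -cvg_shiftS; exact: cvg_harmonic.
have e2 : 0 < e / 2 by rewrite divr_gt0.
near=> n.
have n0 : (0 < n)%N by near: n; exists 1%N.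
rewrite (fejer_mean_sub_cst _ _ n0 pc).
apply: le_lt_trans (fejer_mean_le n0 c0 _ bnd) _.
  by apply: continuous_on_segB; [exact: pc|exact: continuous_on_seg_cst].
suff : 4 * c / n%:R < e / 2 by lra.
apply: le_lt_trans (ler_norm _) _; rewrite -normrN -[- _]add0r.
by near: n; move/cvgrPdist_lt : cc0 => /(_ _ e2).
Unshelve. all: by end_near. Qed.

End FejerConvergence.

(** * Power series expansion in the open disk *)

Section DiskExpansion.
Variable R : realType.
Local Notation C := R[i].
Local Notation mu := (@lebesgue_measure R).
Implicit Types (f : C -> C) (z : C) (r t theta : R).

(** [acos] of the normalised real part only reaches the upper half circle; when the imaginary part
    is negative the angle is 2 pi minus it. *)
Lemma polar z : z != 0 -> exists2 theta, 0 <= theta < 2 * pi & z = (cabs z)%:C%C * expi theta.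
Proof.
move=> z0; have r0 : 0 < cabs z.
  by rewrite lt_neqAle cabs_ge0 andbT eq_sym; apply: contra_neq z0 => /cabs0_eq.
have pi0 := pi_gt0 R.
pose x := complex.Re z / cabs z; pose y := complex.Im z / cabs z.
have xy : x ^+ 2 + y ^+ 2 = 1.
  rewrite /x /y !expr_div_n -mulrDl.
  have -> : complex.Re z ^+ 2 + complex.Im z ^+ 2 = cabs z ^+ 2.
    by case: (z) => a b; rewrite /cabs /= sqr_sqrtr// addr_ge0 ?sqr_ge0.
  by rewrite divff// expf_neq0// gt_eqF.
have x1 : -1 <= x <= 1.
  have : x ^+ 2 <= 1 by rewrite -xy lerDl sqr_ge0.
  by rewrite -[X in _ <= X](expr1n _ 2) -ler_sqrt ?expr1n// sqrtr1 sqrtr_sqr ler_norml.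
have th0 := acos_ge0 x1; have th1 := acos_lepi x1.
have c0 : cos (acos x) = x by rewrite acosK// in_itv.
have s0 : 0 <= sin (acos x) by apply: sin_ge0_pi; rewrite th0 th1.
have s2 : sin (acos x) ^+ 2 = y ^+ 2.
  by have := cos2Dsin2 (acos x); rewrite c0 -xy => /addrI.
have zE u : cos u = x -> sin u = y -> z = (cabs z)%:C%C * expi u.
  move=> cu su; rewrite /expi cu su /x /y; case: (z) (r0) => a b h.
  by simpc; rewrite ![_ * (_ / _)]mulrC !divfK ?gt_eqF.
have [y0|y0] := lerP 0 y.
  exists (acos x); first by rewrite th0; lra.
  apply: zE => //; have := congr1 Num.sqrt s2.
  by rewrite !sqrtr_sqr !ger0_norm.
have th2 : 0 < acos x.
  rewrite lt_neqAle th0 andbT; apply/eqP => h.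
  by move: s2; rewrite -h sin0 expr0n/= => /esym/eqP; rewrite sqrf_eq0 => /eqP yE; lra.
exists (2 * pi - acos x); first by apply/andP; split; lra.
have -> : 2 * pi - acos x = - acos x + pi *+ 2 by rewrite addrC mulr_natl.
apply: zE; first by rewrite cosD2pi cosN.
rewrite sinD2pi sinN; have := congr1 Num.sqrt s2.
by rewrite !sqrtr_sqr ger0_norm// ltr0_norm// => ->; rewrite opprK.
Qed.

Definition trace f r : R -> C := fun t => f (r%:C%C * expi t).

Lemma continuous_trace f r : 0 <= r < 1 ->
  (forall z, cabs z < 1 -> derivable f z 1) -> continuous (trace f r).
Proof.
move=> /andP[r0 r1] hf t.
have [|d hd] := @derivable_has_derivative _ f (r%:C%C * expi t).
  by apply: hf; rewrite cabs_circle.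
apply: (@continuous_comp _ _ _ (fun t => r%:C%C * expi t) f); last first.
  exact: has_derivative_continuous hd.
by apply: cvgM; [exact: cvg_cst|exact: continuous_expi].
Qed.

Lemma fcoef_trace f r m : fcoef (trace f r) m = ((2 * pi)^-1)%:C%C * circle_integral f r (- m).
Proof.
by congr (_ * _); apply: eq_cintg => t _; rewrite mulNr.
Qed.

Lemma fcoef_bound (h : R -> C) (m M : R) : continuous_on_seg 0 (2 * pi) h ->
  (forall t, 0 <= t <= 2 * pi -> cabs (h t) <= M) -> cabs (fcoef h m) <= 2 * M.
Proof.
move=> hc hM; have pi0 := pi2_gt0 R.
rewrite /fcoef cabsM cabs_real ger0_norm ?invr_ge0 ?(ltW pi0)// ler_pdivrMl//.
have cc : continuous_on_seg 0 (2 * pi) (fun t => h t * expi (- (m * t))).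
  apply: continuous_on_segM; first exact: hc.
  apply: continuous_on_segW; rewrite (_ : (fun _ => _) = (fun t => expi (- m * t) : C)).
    exact: continuous_expiM.
  by apply/funext => t; rewrite mulNr.
have H : cabs (segint 0 (2 * pi) (fun t => h t * expi (- (m * t)))) <= 2 * M * (2 * pi - 0).
  by apply: (segint_bound (ltW pi0) cc) => t /hM; rewrite cabsM cabs_expi mulr1.
by apply: le_trans H _; rewrite subr0 [leLHS]mulrC.
Qed.

Lemma expR_nat_ln (k : nat) r : 0 < r -> expR (k%:R * ln r) = r ^+ k.
Proof. by move=> r0; rewrite mulr_natl -lnXn// lnK// posrE exprn_gt0. Qed.

(** Row j of a double Fejer sum: entries depend on j - l and vanish above the diagonal, so reversing
    the index yields the partial sum with j + 1 terms. *)
Lemma sum_lower_triangle (n : nat) (u : nat -> C) (j : 'I_n) (G : 'I_n -> C) :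
  (forall l : 'I_n, (l <= j)%N -> G l = u (j - l)%N) ->
  (forall l : 'I_n, (j < l)%N -> G l = 0) -> \sum_l G l = \sum_(k < j.+1) u k.
Proof.
move=> Gu G0; transitivity (\sum_(l < j.+1) u (j - l)%N); last first.
  by rewrite [RHS](reindex_inj rev_ord_inj) /=; apply: eq_bigr => l _; rewrite subSS.
rewrite (big_ord_widen n (fun l => u (j - l)%N)) //.
rewrite (bigID (fun l : 'I_n => (l < j.+1)%N)) /= [X in _ + X]big1 ?addr0.
  by apply: eq_bigr => l; rewrite ltnS => lj; exact: Gu.
by move=> l; rewrite -leqNgt; exact: G0.
Qed.

Lemma cesaroC (u : nat -> C) (l : C) : u @ \oo --> l ->
  n.+1%:R^-1 * (\sum_(j < n.+1) u j) @[n --> \oo] --> l.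
Proof.
have E (g : nat -> R) (n : nat) : n.+1%:R^-1 * series g n.+1 = arithmetic_mean g n by [].
move=> /cvg_ReIm[h1 h2]; apply/cvg_ReIm.
have P (n : nat) (z : C) : n.+1%:R^-1 * z = Complex (n.+1%:R^-1 * complex.Re z) (n.+1%:R^-1 * complex.Im z).
  rewrite (_ : n.+1%:R^-1 = (n.+1%:R^-1 : R)%:C%C); last by rewrite fmorphV rmorph_nat.
  by case: z => a b; simpc.
split.
  rewrite (_ : (fun n => _) = arithmetic_mean (fun n => complex.Re (u n))); first exact: cesaro h1.
  by apply/funext => n; rewrite P -E -Re_series /series /= big_mkord.
rewrite (_ : (fun n => _) = arithmetic_mean (fun n => complex.Im (u n))); first exact: cesaro h2.
by apply/funext => n; rewrite P -E -Im_series /series /= big_mkord.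
Qed.

(** The radius 1/2 is an arbitrary choice: the coefficient rescaled by r^-k does not depend on r,
    and [2 ^+ k] is that rescaling. *)
Definition disk_coef f (k : nat) : C := (2 ^+ k) * fcoef (trace f (1/2)) k%:R.

Section bounded.
Variables (f : C -> C) (M : R).
Hypothesis hf : forall z, cabs z < 1 -> derivable f z 1.
Hypothesis fM : forall z, cabs z < 1 -> cabs (f z) <= M.

Local Notation c := (disk_coef f).

Lemma fcoef_trace_scale (k : nat) r1 r2 : 0 < r1 -> r1 <= r2 -> r2 < 1 ->
  (r1 ^- k)%:C%C * fcoef (trace f r1) k%:R = (r2 ^- k)%:C%C * fcoef (trace f r2) k%:R.
Proof.
move=> r10 r12 r21; rewrite !fcoef_trace mulrCA [RHS]mulrCA; congr (_ * _).
have := circle_integral_scale hf (expi_Nnat_2pi R k) r10 r12 r21.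
by rewrite !mulNr !expRN !expR_nat_ln// (lt_le_trans r10).
Qed.

Lemma fcoef_trace_nat (k : nat) r : 0 < r < 1 -> fcoef (trace f r) k%:R = (r ^+ k)%:C%C * c k.
Proof.
move=> /andP[r0 r1].
have h : (r ^- k)%:C%C * fcoef (trace f r) k%:R = c k.
  have -> : c k = ((1/2) ^- k)%:C%C * fcoef (trace f (1/2)) k%:R.
    by rewrite /disk_coef mul1r exprVn invrK rmorphXn /= rmorph_nat.
  have h2 : (1/2 : R) < 1 by lra.
  have h20 : (0 : R) < 1/2 by lra.
  by case: (lerP r (1/2)) => [h|/ltW h]; [|apply/esym]; exact: fcoef_trace_scale.
by rewrite -h mulrA -rmorphM /= divff ?rmorph1 ?mul1r// expf_neq0// gt_eqF.
Qed.

Lemma trace_bound r t : 0 <= r < 1 -> cabs (trace f r t) <= M.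
Proof. by move=> /andP[r0 r1]; apply: fM; rewrite cabs_circle. Qed.

(** At negative frequencies the scaling goes the other way: the rescaled coefficient equals its
    value at any smaller radius s, which is at most s times 2 M, and s is arbitrary. *)
Lemma fcoef_trace_neg (k : nat) r : 0 < r < 1 -> (0 < k)%N -> fcoef (trace f r) (- k%:R) = 0.
Proof.
move=> /andP[r0 r1] k0.
have B s : 0 < s -> s <= r -> cabs ((r ^+ k)%:C%C * fcoef (trace f r) (- k%:R)) <= s * (2 * M).
  move=> s0 sr; have s1 : s < 1 := le_lt_trans sr r1.
  have -> : (r ^+ k)%:C%C * fcoef (trace f r) (- k%:R) =
      (s ^+ k)%:C%C * fcoef (trace f s) (- k%:R).
    rewrite !fcoef_trace opprK mulrCA [RHS]mulrCA; congr (_ * _); apply/esym.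
    have := circle_integral_scale hf (expi_nat_2pi R k) s0 sr r1.
    by rewrite !expR_nat_ln.
  have sb : cabs (fcoef (trace f s) (- k%:R)) <= 2 * M.
    apply: fcoef_bound => [|t _]; last by rewrite trace_bound// s1 ltW.
    by apply: continuous_on_segW; apply: continuous_trace; rewrite // s1 ltW.
  rewrite cabsM cabs_real ger0_norm ?exprn_ge0 ?(ltW s0)//.
  apply: ler_pM => //; rewrite ?exprn_ge0 ?cabs_ge0 ?(ltW s0)//.
  by rewrite -{2}[s]expr1 ler_wiXn2l// ltW.
have M0 : 0 <= M by apply: le_trans (cabs_ge0 _) (@fM 0 _); rewrite cabs0.
have E0 : (r ^+ k)%:C%C * fcoef (trace f r) (- k%:R) = 0.
  apply: cabs0_eq; apply/eqP; rewrite eq_le cabs_ge0 andbT.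
  apply/ler_addgt0Pr => e e0; rewrite add0r.
  have M1 : 0 < 2 * M + 1 by lra.
  apply: le_trans (B (Num.min r (e / (2 * M + 1))) _ _) _.
  - by rewrite lt_min r0 divr_gt0.
  - by rewrite ge_min lexx.
  apply: (@le_trans _ _ (e / (2 * M + 1) * (2 * M))).
    by rewrite ler_wpM2r ?mulr_ge0// ge_min lexx orbT.
  by rewrite -mulrA ger_pMr// mulrC ler_pdivrMr// mul1r; lra.
move/eqP: E0; rewrite mulf_eq0 => /orP[|/eqP//].
by rewrite eq_complex /= expf_eq0 (gt_eqF r0) andbF.
Qed.

(** r^k c_k is a Fourier coefficient of a trace bounded by M, and r tends to 1 along 1 - 1/(n+2),
    which is in the open unit interval even for n = 0. *)
Lemma coef_bound k : cabs (c k) <= 2 * M.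
Proof.
have B r : 0 < r < 1 -> r ^+ k * cabs (c k) <= 2 * M.
  move=> /andP[r0 r1].
  have -> : r ^+ k * cabs (c k) = cabs (fcoef (trace f r) k%:R).
    by rewrite fcoef_trace_nat ?r0// cabsM cabs_real ger0_norm// exprn_ge0// ltW.
  apply: fcoef_bound => [|t _]; last by rewrite trace_bound// r1 ltW.
  by apply: continuous_on_segW; apply: continuous_trace; rewrite // r1 ltW.
have h : (1 - n.+2%:R^-1) ^+ k * cabs (c k) @[n --> \oo] --> 1 ^+ k * cabs (c k).
  apply: cvgM; last exact: cvg_cst.
  have h1 : (1 - n.+2%:R^-1 : R) @[n --> \oo] --> (1 : R).
    rewrite -[X in _ --> X]subr0; apply: cvgB; first exact: cvg_cst.
    by rewrite (cvg_shiftS (fun n => n.+1%:R^-1 : R)); exact: cvg_harmonic.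
  exact: (cvg_comp _ _ h1 (@exprn_continuous R k 1)).
rewrite expr1n mul1r in h; apply: (cvgr_to_le h); apply: nearW => n; apply: B.
have n2 : (1 : R) < n.+2%:R by rewrite ltr1n.
have n0 : (0 : R) < n.+2%:R by rewrite ltr0n.
by rewrite subr_gt0 invf_lt1// n2 gtrBl invr_gt0 n0.
Qed.

Lemma fejer_mean_trace n r theta : 0 < r < 1 ->
  fejer_mean n (trace f r) theta =
    n%:R^-1 * \sum_(j < n) series (fun k => c k * (r%:C%C * expi theta) ^+ k) j.+1.
Proof.
move=> /andP[r0 r1]; rewrite fejer_meanE; last first.
  by apply: continuous_on_segW; apply: continuous_trace; rewrite // r1 ltW.
congr (_ * _); apply: eq_bigr => j _.
rewrite /series /= big_mkord.
apply: (@sum_lower_triangle n (fun k => c k * (r%:C%C * expi theta) ^+ k)) => l jl.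
  rewrite -natrB// fcoef_trace_nat ?r0//.
  by rewrite exprMn expiX rmorphXn /=; ring.
rewrite (_ : j%:R - l%:R = - (l - j)%:R); last by rewrite natrB ?opprB// ltnW.
by rewrite fcoef_trace_neg ?mulr0 ?r0// subn_gt0.
Qed.

(** The Fejer means of the trace converge to its value at theta; being Cesaro means of the partial
    sums, they also converge to the sum of the series. *)
Lemma disk_expansion_polar r theta : 0 < r < 1 -> 0 < theta < 2 * pi ->
  f (r%:C%C * expi theta) = psum c (r%:C%C * expi theta).
Proof.
move=> /andP[r0 r1] th; set z := _ * _.
have tc : continuous_on_seg 0 (2 * pi) (trace f r).
  by apply: continuous_on_segW; apply: continuous_trace; rewrite // r1 ltW.
have h1 := fejer_mean_cvg tc th; rewrite -cvg_shiftS in h1.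
have h2 : series (fun k => c k * z ^+ k) n.+1 @[n --> \oo] --> psum c z.
  rewrite (cvg_shiftS (series (fun k => c k * z ^+ k))); apply: abs_summable_cvg.
  apply: subgeometric_summable; first exact: bounded_subgeometric coef_bound.
  by rewrite cabs_circle// ltW.
have := cesaroC h2.
rewrite (_ : (fun n => _) = (fun n => fejer_mean n.+1 (trace f r) theta)).
  by move=> h3; have := cvg_unique _ h1 h3; apply.
by apply/funext => n; rewrite fejer_mean_trace// r0.
Qed.

(** The angle 0 is out of reach of the previous lemma. Points off the real axis are treated first; a
    real z is the limit of z + i s, and both sides are continuous. *)
Lemma disk_expansion z : cabs z < 1 -> f z = psum c z.
Proof.
move=> z1; have gc : subgeometric c by exact: bounded_subgeometric coef_bound.
have Hp w : cabs w < 1 -> complex.Im w != 0 -> f w = psum c w.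
  move=> w1 w0; have wn0 : w != 0 by apply: contra_neq w0 => ->.
  have [th /andP[th0 th1] wE] := polar wn0.
  have r0 : 0 < cabs w.
    by rewrite lt_neqAle cabs_ge0 andbT eq_sym; apply: contra_neq wn0 => /cabs0_eq.
  rewrite wE; apply: disk_expansion_polar; first by rewrite r0.
  rewrite th1 andbT lt_neqAle th0 andbT; apply/eqP => th00; move: w0.
  by rewrite wE -th00 expi0 mulr1 /= eqxx.
have [z0|] := eqVneq (complex.Im z) 0; last exact: Hp.
have [d /has_derivative_continuous /(@cvg_cabsP _ _ (nbhs z)) fc] := derivable_has_derivative (hf z1).
have /has_derivative_continuous /(@cvg_cabsP _ _ (nbhs z)) pc := has_derivative_psum gc z1.
apply/eqP; rewrite -subr_eq0; apply/eqP/cabs0_eq/eqP; rewrite eq_le cabs_ge0 andbT.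
apply/ler_addgt0Pr => e e0; rewrite add0r.
have e2 : 0 < e / 2 by rewrite divr_gt0.
have /nbhs_cabsP[r1 r10 h1] := fc _ e2; have /nbhs_cabsP[r2 r20 h2] := pc _ e2.
pose s := Num.min (Num.min r1 r2) (1 - cabs z) / 2.
have m0 : 0 < Num.min (Num.min r1 r2) (1 - cabs z) by rewrite !lt_min r10 r20 subr_gt0.
have s0 : 0 < s by rewrite divr_gt0.
have sm : s < Num.min (Num.min r1 r2) (1 - cabs z).
  by rewrite ltr_pdivrMr// ltr_pMr// ltr1n.
move: sm; rewrite !lt_min => /andP[/andP[s1 s2] s3].
pose w := z + Complex 0 s.
have wz : cabs (w - z) = s by rewrite /w addrC addKr cabs_im ger0_norm// ltW.
have fw : f w = psum c w.
  apply: Hp; last by rewrite /w Im_addc z0 add0r /= gt_eqF.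
  rewrite /w (le_lt_trans (cabsD _ _))// cabs_im ger0_norm ?(ltW s0)//; lra.
have := h1 w; have := h2 w; rewrite wz fw => /(_ s2) k2 /(_ s1) k1.
rewrite (_ : f z - _ = (psum c w - psum c z) - (psum c w - f z)); last first.
  by rewrite opprB [RHS]addrC addrA subrK.
by apply/ltW/(le_lt_trans (cabsB _ _)); rewrite [ltRHS]splitr ltrD.
Qed.

End bounded.
End DiskExpansion.

(** * The disk algebra and its sup-norm *)

Section DiskAlgebra.
Variable R : realType.
Local Notation C := R[i].
Implicit Types (f g : C -> C) (z w : C).

Lemma within_cdiskP f : {within @cdisk R, continuous f} <->
  forall z, cabs z <= 1 -> forall e : R, 0 < e -> exists2 d : R, 0 < d &
    forall w, cabs w <= 1 -> cabs (w - z) < d -> cabs (f w - f z) < e.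
Proof.
split.
  move=> /subspace_continuousP h z z1 e e0.
  have /cvg_cabsP/(_ _ e0)/nbhs_cabsP[d d0 hd] := h z z1.
  by exists d => // w w1 wz; exact: hd.
move=> h; apply/subspace_continuousP => z z1; apply/cvg_cabsP => e e0.
have [d d0 hd] := h z z1 e e0.
by apply/nbhs_cabsP; exists d => // w wz w1; exact: hd.
Qed.

Lemma compact_cdisk : compact (@cdisk R).
Proof.
pose p (q : R * R) : C := Complex q.1 q.2.
have pc : continuous p.
  by move=> q; apply/cvg_ReIm; split; [exact: cvg_fst|exact: cvg_snd].
have -> : @cdisk R = p @` [set q | cabs (p q) <= 1].
  apply/seteqP; split=> [z z1|_ [q q1 <-]//].
  by exists (complex.Re z, complex.Im z); rewrite /= /p /=; case: z z1.
apply: continuous_compact; first by apply: continuous_subspaceT.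
have cK : compact (`[-1, 1]%classic `*` `[-1, 1]%classic : set (R * R)).
  by apply: compact_setX; exact: segment_compact.
apply: (subclosed_compact _ cK).
  have cc : continuous (fun q => cabs (p q)) by move=> q; apply: cvg_cabs; exact: pc.
  rewrite (_ : [set _ | _] = (fun q => cabs (p q)) @^-1` [set x | x <= 1])//.
  by apply: closed_comp => [q _|]; [exact: cc|exact: closed_le].
move=> [x y] /= h; split=> /=; rewrite in_itv /= -ler_norml.
  exact: le_trans (Re_le_cabs (Complex x y)) h.
exact: le_trans (Im_le_cabs (Complex x y)) h.
Qed.

Lemma disk_algebra_bounded f : disk_algebra f ->
  exists2 M, 0 <= M & forall z, cabs z <= 1 -> cabs (f z) <= M.
Proof.
move=> [_ /within_cdiskP fc].
have /compact_near_coveringP/(_ R +oo (fun M z => cabs z <= 1 -> cabs (f z) <= M)) := compact_cdisk.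
case.
  move=> z z1; have [d d0 hd] := fc z z1 1 ltr01.
  exists ([set w | cabs (w - z) < d], [set M | cabs (f z) + 1 <= M]); first split.
  - by apply/nbhs_cabsP; exists d.
  - by apply: nbhs_pinfty_ge; exact: num_real.
  move=> [w M] /= [wz hM] w1; apply: le_trans hM.
  rewrite -lerBlDl; apply: le_trans (ltW (hd _ w1 wz)).
  rewrite lerBlDr; apply: le_trans (cabsD _ _) => //.
  by rewrite subrK.
move=> M [_ h]; exists (Num.max 0 (M + 1)); first by rewrite le_max lexx.
move=> z z1; apply: (@le_trans _ _ (M + 1)); last by rewrite le_max lexx orbT.
by apply: h => //; rewrite ltrDl.
Qed.

(** Uniformity in z is compactness of the closed disk: near a given point, both w and r w are close
    to it once r is close to 1. *)
Lemma dilation_cvg f : disk_algebra f -> forall e : R, 0 < e ->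
  \forall r \near (1 : R)^'-, forall z, cabs z <= 1 -> cabs (f (r%:C%C * z) - f z) < e.
Proof.
move=> [_ /within_cdiskP fc] e e0; have e2 : 0 < e / 2 by rewrite divr_gt0.
suff K : \forall r \near (1 : R)^'-, @cdisk R `<=`
    (fun z => cabs z <= 1 -> cabs (f (r%:C%C * z) - f z) < e).
  by apply: filterS K => r h z z1; exact: h.
have /compact_near_coveringP := compact_cdisk; apply => z z1.
have [d d0 hd] := fc z z1 _ e2.
exists ([set w | cabs (w - z) < d / 2], [set r | (0 <= r < 1) /\ 1 - r < d / 2]); first split.
- by apply/nbhs_cabsP; exists (d / 2); rewrite // divr_gt0.
- have d2 : 0 < d / 2 by rewrite divr_gt0.
  near=> r; split; last first.
    by rewrite /= ltrBlDr -ltrBlDl; near: r; apply: nbhs_left_gt; rewrite gtrBl.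
  by apply/andP; split; near: r; [apply: nbhs_left_ge; exact: ltr01|exact: nbhs_left_lt].
move=> [w r] /= [wz [/andP[r0 r1] rd]] w1.
have rw1 : cabs (r%:C%C * w) <= 1.
  by rewrite cabsM cabs_real ger0_norm// mulr_ile1 ?cabs_ge0// ltW.
have wz' : cabs (w - z) < d by apply: lt_le_trans wz _; lra.
have rwz : cabs (r%:C%C * w - z) < d.
  rewrite (_ : _ - z = (w - z) - (1 - r)%:C%C * w); last by rewrite rmorphB rmorph1; ring.
  apply: le_lt_trans (cabsB _ _) _; rewrite cabsM cabs_real ger0_norm ?subr_ge0 ?(ltW r1)//.
  rewrite [ltRHS]splitr; apply: ltr_leD => //.
  rewrite -[leRHS]mulr1; apply: ler_pM; rewrite ?cabs_ge0 ?subr_ge0//; exact: ltW.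
rewrite (_ : _ - _ = (f (r%:C%C * w) - f z) - (f w - f z)); last by ring.
by apply: le_lt_trans (cabsB _ _) _; rewrite [ltRHS]splitr ltrD// hd.
Unshelve. all: by end_near. Qed.

Lemma supnorm_le f M : (forall z, cabs z <= 1 -> cabs (f z) <= M) -> supnorm f <= M.
Proof.
move=> h; apply: ge_sup; first by exists (cabs (f 0)), 0; rewrite // /cdisk /mkset cabs0.
by move=> _ [z z1 <-]; exact: h.
Qed.

Lemma supnorm_ub_bounded f M z : (forall z, cabs z <= 1 -> cabs (f z) <= M) ->
  cabs z <= 1 -> cabs (f z) <= supnorm f.
Proof.
move=> h z1; apply: ub_le_sup; last by exists z.
by exists M => _ [w w1 <-]; exact: h.
Qed.

Lemma supnorm_ub f z : disk_algebra f -> cabs z <= 1 -> cabs (f z) <= supnorm f.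
Proof. by move=> /disk_algebra_bounded[M _ hM]; exact: (supnorm_ub_bounded hM). Qed.

Lemma supnorm_ge0 f : disk_algebra f -> 0 <= supnorm f.
Proof.
by move=> hf; apply: le_trans (cabs_ge0 (f 0)) _; apply: (supnorm_ub hf); rewrite cabs0 ler01.
Qed.

Lemma disk_algebra_expansion f : disk_algebra f ->
  [/\ subgeometric (taylor f), (forall z, cabs z < 1 -> f z = psum (taylor f) z) &
      forall k, cabs (taylor f k) <= 2 * supnorm f].
Proof.
move=> hf; have [hd _] := hf.
have fM z : cabs z < 1 -> cabs (f z) <= supnorm f by move=> /ltW; exact: supnorm_ub.
have cb := coef_bound hd fM; have gc := bounded_subgeometric cb.
have fe := disk_expansion hd fM.
by rewrite (taylor_psum gc fe); split.
Qed.

Lemma disk_algebra_psum f c : subgeometric c -> (forall z, cabs z < 1 -> f z = psum c z) ->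
  {within @cdisk R, continuous f} -> disk_algebra f.
Proof.
move=> gc fc cf; split=> // z z1.
exact: has_derivative_derivable (has_derivative_eq_psum gc fc z1).
Qed.

Lemma disk_algebraD f g : disk_algebra f -> disk_algebra g -> disk_algebra (f \+ g).
Proof.
move=> [df cf] [dg cg]; split=> [z z1|].
  by apply: derivableD; [exact: df|exact: dg].
by move=> z; apply: cvgD; [exact: cf|exact: cg].
Qed.

Lemma disk_algebraZ (a : C) f : disk_algebra f -> disk_algebra (fun z => a * f z).
Proof.
move=> [df cf]; split=> [z z1|].
  have [d hd] := derivable_has_derivative (df z z1); apply: has_derivative_derivable.
  exact: (has_derivative_comp hd (has_derivative_scale a (f z))).
by move=> z; apply: cvgM; [exact: cvg_cst|exact: cf].
Qed.

Lemma disk_algebraB f g : disk_algebra f -> disk_algebra g -> disk_algebra (fun z => f z - g z).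
Proof.
move=> hf hg; have := disk_algebraD hf (disk_algebraZ (-1) hg).
by congr disk_algebra; apply/funext => z /=; rewrite mulN1r.
Qed.

Lemma disk_algebraM f g : disk_algebra f -> disk_algebra g -> disk_algebra (fun z => f z * g z).
Proof.
move=> [df cf] [dg cg]; split=> [z z1|].
  have [d hd] := derivable_has_derivative (df z z1).
  have [k hk] := derivable_has_derivative (dg z z1).
  exact: has_derivative_derivable (has_derivative_mul hd hk).
by move=> z; apply: cvgM; [exact: cf|exact: cg].
Qed.

Lemma disk_algebra_cst (a : C) : disk_algebra (fun=> a).
Proof. by split=> [z _|z]; [exact: derivable_cst|exact: cvg_cst]. Qed.

Lemma disk_algebraX f n : disk_algebra f -> disk_algebra (fun z => f z ^+ n).
Proof.
move=> hf; elim: n => [|n IH].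
  by under eq_fun do rewrite expr0; exact: disk_algebra_cst.
by under eq_fun do rewrite exprS; exact: disk_algebraM.
Qed.

Lemma within_cdisk_uniform_limit f (F : nat -> C -> C) :
  (forall n, {within @cdisk R, continuous (F n)}) ->
  (forall e : R, 0 < e -> exists n, forall z, cabs z <= 1 -> cabs (F n z - f z) <= e) ->
  {within @cdisk R, continuous f}.
Proof.
move=> Fc Ff; apply/within_cdiskP => z z1 e e0.
have e4 : 0 < e / 4 by rewrite divr_gt0.
have [n hn] := Ff _ e4; have /within_cdiskP/(_ z z1 _ e4)[d d0 hd] := Fc n.
exists d => // w w1 wz.
rewrite (_ : f w - f z = (F n w - F n z) - (F n w - f w) + (F n z - f z)); last by ring.
have := hn w w1; have := hn z z1; have := hd w w1 wz.
have := cabsD ((F n w - F n z) - (F n w - f w)) (F n z - f z).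
have := cabsB (F n w - F n z) (F n w - f w); lra.
Qed.

Lemma disk_algebra_id : disk_algebra (fun z : C => z).
Proof.
split=> [z _|]; last by apply: continuous_subspaceT => z; exact: cvg_id.
have := has_derivative_scale (1 : C) z; rewrite (_ : (fun w => 1 * w) = (fun w => w)).
  exact: has_derivative_derivable.
by apply/funext => w; rewrite mul1r.
Qed.

Lemma disk_algebra_poly (c : nat -> C) n : disk_algebra (fun z : C => \sum_(k < n) c k * z ^+ k).
Proof.
elim: n => [|n IH].
  by under eq_fun do rewrite big_ord0; exact: disk_algebra_cst.
under eq_fun do rewrite big_ord_recr /=.
apply: (disk_algebraD IH); apply: disk_algebraZ; apply: disk_algebraX.
exact: disk_algebra_id.
Qed.

Lemma abs_summable_bounded (u : nat -> C) : abs_summable u ->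
  exists2 M, 0 <= M & forall k, cabs (u k) <= M.
Proof.
move=> su; exists (limn (series (fun k => cabs (u k)))).
  apply: limr_ge => //; exists 0%N => // n _.
  by rewrite /series /= sumr_ge0// => k _; exact: cabs_ge0.
move=> k; apply: limr_ge => //; exists k.+1 => // n /= kn.
rewrite /series /= (bigD1_seq k) ?mem_index_iota ?iota_uniq//= lerDl sumr_ge0// => j _.
exact: cabs_ge0.
Qed.

(** Absolute summability makes the partial sums converge uniformly on the closed disk, which gives
    continuity up to the circle. This produces the elements of the disk algebra used as test
    functions. *)
Lemma disk_algebra_abs_summable (c : nat -> C) : abs_summable c ->
  disk_algebra (psum c) /\ taylor (psum c) = c.
Proof.
move=> sc; have [M M0 cM] := abs_summable_bounded sc.
have gc := bounded_subgeometric cM; split; last exact: (taylor_psum gc).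
apply: (disk_algebra_psum gc) => //.
apply: (@within_cdisk_uniform_limit _ (fun n z => \sum_(k < n) c k * z ^+ k)).
  by move=> n; have [] := disk_algebra_poly c n.
move=> e e0; have /cvgrPdist_le/(_ _ e0)[n _ /(_ n (leqnn n)) /= hn] := sc.
exists n => z z1; rewrite cabsBC.
rewrite (_ : \sum_(k < n) _ = series (fun k => c k * z ^+ k) n); last by rewrite /series /= big_mkord.
apply: le_trans (csum_tail_le n _ sc) (le_trans (ler_norm _) hn) => k.
by rewrite cabsM cabsX -[leRHS]mulr1 ler_wpM2l ?cabs_ge0// exprn_ile1 ?cabs_ge0.
Qed.

End DiskAlgebra.

(** * Maximum principle and density of polynomials *)

Section MaximumPrinciple.
Variable R : realType.
Local Notation C := R[i].
Implicit Types (f g : C -> C) (z w : C).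

(** A constant independent of m disappears under m-th roots: this ends the power trick of the
    maximum principle. *)
Lemma pow_le_const_mul (x M K : R) : 0 <= x -> 0 <= M ->
  (forall m : nat, x ^+ m <= K * M ^+ m) -> x <= M.
Proof.
move=> x0 M0 h; case: leP => // Mx; exfalso.
have xp : 0 < x := le_lt_trans M0 Mx.
have q0 : 0 <= M / x by rewrite divr_ge0.
have q1 : M / x < 1 by rewrite ltr_pdivrMr// mul1r.
have hq m : 1 <= K * (M / x) ^+ m.
  by rewrite expr_div_n mulrA ler_pdivlMr ?exprn_gt0// mul1r.
have c0 : K * (M / x) ^+ m @[m --> \oo] --> 0.
  rewrite -(mulr0 K); apply: cvgM; first exact: cvg_cst.
  by apply: cvg_expr; rewrite ger0_norm.
have /cvgrPdist_lt/(_ _ ltr01)[N _ /(_ N (leqnn N))] := c0.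
by rewrite /= sub0r normrN ltNge (le_trans (hq N) (ler_norm _)).
Qed.

Lemma taylor_disk_coef f : disk_algebra f -> taylor f = disk_coef f.
Proof.
move=> hf; have [hd _] := hf; have [M _ hM] := disk_algebra_bounded hf.
have fM z : cabs z < 1 -> cabs (f z) <= M by move=> /ltW; exact: hM.
apply: taylor_psum; first exact: bounded_subgeometric (coef_bound hd fM).
exact: disk_expansion fM.
Qed.

Lemma cvg_expr_left (k : nat) : r ^+ k @[r --> (1 : R)^'-] --> (1 : R).
Proof.
by rewrite -[X in _ --> X](expr1n R k); apply: cvg_at_left_filter; exact: exprn_continuous.
Qed.

(** The bound M is known on the unit circle, while coefficients are read on inner circles; uniform
    dilation connects them as r tends to 1. *)
Lemma taylor_circle_bound f (M : R) k : disk_algebra f ->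
  (forall t, cabs (f (expi t)) <= M) -> cabs (taylor f k) <= 2 * M.
Proof.
move=> hf fM; have [hd _] := hf; have [B _ hB] := disk_algebra_bounded hf.
have fB z : cabs z < 1 -> cabs (f z) <= B by move=> /ltW; exact: hB.
apply/ler_addgt0Pr => e e0; have e2 : 0 < e / 2 by rewrite divr_gt0.
have h : r ^+ k * cabs (taylor f k) @[r --> (1 : R)^'-] --> 1 * cabs (taylor f k).
  by apply: cvgM; [exact: cvg_expr_left|exact: cvg_cst].
rewrite mul1r in h; apply: (cvgr_to_le h).
near=> r; have r0 : 0 < r by near: r; apply: nbhs_left_gt; exact: ltr01.
have r1 : r < 1 by near: r; exact: nbhs_left_lt.
have hr : forall z, cabs z <= 1 -> cabs (f (r%:C%C * z) - f z) < e / 2.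
  by near: r; exact: dilation_cvg.
have -> : r ^+ k * cabs (taylor f k) = cabs (fcoef (trace f r) k%:R).
  rewrite (fcoef_trace_nat hd) ?r0// taylor_disk_coef// cabsM cabs_real ger0_norm//.
  by rewrite exprn_ge0// ltW.
have -> : 2 * M + e = 2 * (M + e / 2) by lra.
apply: fcoef_bound => [|t _].
  by apply: continuous_on_segW; apply: continuous_trace; rewrite // r1 ltW.
rewrite -[trace f r t](subrK (f (expi t))) addrC; apply: le_trans (cabsD _ _) _.
by apply: lerD => //; apply/ltW/hr; rewrite cabs_expi.
Unshelve. all: by end_near. Qed.

(* Powers of [f] sharpen the crude coefficient estimate to the sharp bound. *)
Lemma maximum_principle f (M : R) z : disk_algebra f ->
  (forall t, cabs (f (expi t)) <= M) -> cabs z <= 1 -> cabs (f z) <= M.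
Proof.
move=> hf fM; have M0 : 0 <= M := le_trans (cabs_ge0 _) (fM 0).
rewrite le_eqVlt => /predU1P[z1|z1].
  have z0 : z != 0 by apply: contra_eq_neq z1 => ->; rewrite cabs0 eq_sym oner_neq0.
  by have [t _ ->] := polar z0; rewrite z1 mul1r; exact: fM.
pose K := limn (series (fun k => 2 * cabs z ^+ k)).
have cK : cvgn (series (fun k => 2 * cabs z ^+ k)).
  by apply: cvg_geometric_scaled; rewrite cabs_ge0.
apply: (@pow_le_const_mul _ _ K) => //; first exact: cabs_ge0.
move=> m; have hfm := disk_algebraX m hf.
have [_ fe _] := disk_algebra_expansion hfm.
rewrite -cabsX fe// mulrC /K -[_ * _](lim_seriesZ _ cK); apply: csum_le; last exact: is_cvg_seriesZ.
move=> k; rewrite cabsM cabsX.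
apply: (@le_trans _ _ (2 * M ^+ m * cabs z ^+ k)).
  rewrite ler_wpM2r ?exprn_ge0 ?cabs_ge0//; apply: taylor_circle_bound hfm _ => t.
  by rewrite cabsX lerXn2r// nnegrE cabs_ge0.
by rewrite le_eqVlt; apply/orP; left; apply/eqP; rewrite /= -mulrA mulrCA.
Qed.

Lemma taylorD f g k : disk_algebra f -> disk_algebra g ->
  taylor (f \+ g) k = taylor f k + taylor g k.
Proof.
move=> hf hg; have [gf fe fb] := disk_algebra_expansion hf.
have [gg ge gb] := disk_algebra_expansion hg.
pose c k := taylor f k + taylor g k.
rewrite (@taylor_psum _ _ c)//.
  apply: (@bounded_subgeometric _ _ (2 * supnorm f + 2 * supnorm g)) => j.
  by apply: le_trans (cabsD _ _) _; rewrite lerD.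
move=> w w1; rewrite /= fe// ge// /psum -csumD; try exact: subgeometric_summable.
by congr csum; apply/funext => j; rewrite mulrDl.
Qed.

(** A dilate of f is uniformly close to f, and its Taylor series converges uniformly on the closed
    disk, so it can be truncated. *)
Lemma polynomial_dense f (e : R) : disk_algebra f -> 0 < e ->
  exists (c : nat -> C) n, forall z, cabs z <= 1 -> cabs (f z - \sum_(k < n) c k * z ^+ k) <= e.
Proof.
move=> hf e0; have e2 : 0 < e / 2 by rewrite divr_gt0.
have [r [r0 r1 hr]] : exists r : R, [/\ 0 < r, r < 1 &
    forall z, cabs z <= 1 -> cabs (f (r%:C%C * z) - f z) < e / 2].
  apply: (@filter_ex _ (1 : R)^'-); near=> r; split.
  - by near: r; apply: nbhs_left_gt; exact: ltr01.
  - by near: r; exact: nbhs_left_lt.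
  - by near: r; exact: dilation_cvg.
have [gc fe _] := disk_algebra_expansion hf.
have [|v cv hv] := @subgeometric_majorant _ _ r gc; first by rewrite r1 ltW.
have /cvgrPdist_le/(_ _ e2)[n _ /(_ n (leqnn n)) /= hn] := cv.
exists (fun k => taylor f k * (r ^+ k)%:C%C), n => z z1.
have rz1 : cabs (r%:C%C * z) < 1.
  rewrite cabsM cabs_real ger0_norm ?(ltW r0)// (le_lt_trans _ r1)//.
  by rewrite ler_piMr// ltW.
rewrite -[f z](subrK (f (r%:C%C * z))) -addrA.
apply: le_trans (cabsD _ _) _; rewrite [leRHS]splitr; apply: lerD.
  by rewrite cabsBC ltW// hr.
rewrite fe// (_ : \sum_(k < n) _ = series (fun k => taylor f k * (r%:C%C * z) ^+ k) n).
  apply: le_trans (csum_tail_le n _ cv) (le_trans (ler_norm _) hn) => k.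
  rewrite cabsM cabsX cabsM cabs_real ger0_norm ?(ltW r0)//; apply: le_trans (hv k).
  rewrite ler_wpM2l ?cabs_ge0// lerXn2r ?nnegrE ?mulr_ge0 ?cabs_ge0 ?(ltW r0)//.
  by rewrite ler_piMr// ltW.
rewrite /series /= big_mkord; apply: eq_bigr => k _.
by rewrite exprMn rmorphXn mulrA.
Unshelve. all: by end_near. Qed.

Lemma continuous_circle_trace f : disk_algebra f -> continuous (fun t : R => f (expi (- t))).
Proof.
move=> [_ /within_cdiskP fc] t; apply/cvg_cabsP => e e0.
have [|d d0 hd] := fc (expi (- t)) _ e e0; first by rewrite cabs_expi.
have c : continuous (fun t : R => expi (- 1 * t) : C) by exact: continuous_expiM.
have /cvg_cabsP/(_ _ d0) := c t; apply: filterS => s.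
by rewrite !mulN1r => h; apply: hd => //; rewrite cabs_expi.
Qed.

(** * Abel limits and bounded functionals on continuous functions *)

Section pairing.
Variables (Phi : (R -> C) -> C) (K : R).
Hypothesis Philin : forall (a : C) (h g : R -> C), continuous h -> continuous g ->
  Phi (fun t => a * h t + g t) = a * Phi h + Phi g.
Hypothesis Phibd : forall (h : R -> C) (M : R), continuous h ->
  (forall t, cabs (h t) <= M) -> cabs (Phi h) <= K * M.

Let e_ (k : nat) : R -> C := fun t => expi (- (k%:R * t)).

Lemma continuous_expiN (k : nat) : continuous (e_ k).
Proof.
rewrite (_ : e_ k = (fun t => expi (- k%:R * t))); first exact: continuous_expiM.
by apply/funext => t; rewrite mulNr.
Qed.

Lemma functional0 : Phi (fun=> 0) = 0.
Proof.
have c0 : continuous (fun _ : R => 0 : C) by move=> t; exact: cvg_cst.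
apply: cabs0_eq; apply/eqP; rewrite eq_le cabs_ge0 andbT -(mulr0 K).
by apply: Phibd => // t; rewrite cabs0.
Qed.

Lemma functional_sub (h g : R -> C) : continuous h -> continuous g ->
  Phi (fun t => h t - g t) = Phi h - Phi g.
Proof.
move=> hc gc; rewrite addrC -mulN1r -(Philin (-1) gc hc); congr Phi; apply/funext => t.
by rewrite mulN1r addrC.
Qed.

Lemma functional_expi_sum (c : nat -> C) n :
  Phi (fun t => \sum_(k < n) c k * e_ k t) = \sum_(k < n) c k * Phi (e_ k) /\
  continuous (fun t => \sum_(k < n) c k * e_ k t).
Proof.
elim: n => [|n [IH IHc]].
  rewrite big_ord0 -[RHS]functional0; split.
    by congr Phi; apply/funext => t; rewrite big_ord0.
  by move=> t; under eq_fun do rewrite big_ord0; exact: cvg_cst.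
have E : (fun t => \sum_(k < n.+1) c k * e_ k t) =
    (fun t => c n * e_ n t + \sum_(k < n) c k * e_ k t).
  by apply/funext => t; rewrite big_ord_recr addrC.
rewrite E; split.
  by rewrite (Philin (c n) (@continuous_expiN n) IHc) IH big_ord_recr /= addrC.
move=> t; apply: cvgD; last exact: IHc.
by apply: cvgM; [exact: cvg_cst|exact: continuous_expiN].
Qed.

(** [Phi] stands for integration against a measure or an L^1 density. For r < 1 the Taylor series
    converges uniformly on the circle of radius r, so the Abel sum is [Phi] of the dilated trace;
    uniform dilation then gives the limit. The trace is reflected because [e_ k] is e^(-ikt). *)
Lemma pairK_cvg f : disk_algebra f ->
  csum (fun k => taylor f k * Phi (e_ k) * r%:C%C ^+ k) @[r --> (1 : R)^'-]
    --> Phi (fun t => f (expi (- t))).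
Proof.
move=> hf; have [gc fe fb] := disk_algebra_expansion hf.
have fc := continuous_circle_trace hf.
have rc r : 0 <= r < 1 -> continuous (fun t => f (r%:C%C * expi (- t))).
  move=> r01 t; have [hd _] := hf; have tc := continuous_trace r01 hd.
  apply: (@continuous_comp _ _ _ (fun t => - t) (trace f r)); last exact: tc.
  by apply: cvgN; exact: cvg_id.
have K0 : 0 <= K.
  have c1 : continuous (fun _ : R => 1 : C) by move=> t; exact: cvg_cst.
  have := Phibd (M := 1) c1; rewrite mulr1 => H; apply: le_trans (cabs_ge0 _) (H _) => t.
  by rewrite cabs1.
have rE r : 0 < r < 1 -> csum (fun k => taylor f k * Phi (e_ k) * r%:C%C ^+ k) =
    Phi (fun t => f (r%:C%C * expi (- t))).
  move=> /andP[r0 r1]; have r01 : 0 <= r < 1 by rewrite r1 ltW.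
  have [v cv hv] := subgeometric_majorant gc r01.
  apply: csumE; apply/cvg_cabsP => e e0.
  have k0 : 0 < e / (K + 1) by rewrite divr_gt0// ltr_wpDl.
  have /cvgrPdist_lt/(_ _ k0) := cv; apply: filterS => n hn.
  pose c k := taylor f k * r%:C%C ^+ k.
  have [Ps Pc] := functional_expi_sum c n.
  rewrite (_ : series _ n = Phi (fun t => \sum_(k < n) c k * e_ k t)); last first.
    by rewrite Ps /series /= big_mkord; apply: eq_bigr => k _; rewrite /c mulrAC.
  rewrite cabsBC -(functional_sub (rc r r01) Pc).
  apply: le_lt_trans (Phibd (M := limn (series v) - series v n) _ _) _.
  - by move=> t; apply: cvgB; [exact: rc|exact: Pc].
  - move=> t; rewrite fe ?cabsM ?cabs_expi ?mulr1 ?cabs_real ?ger0_norm ?(ltW r0)//.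
    rewrite (_ : \sum_(k < n) _ = series (fun k => taylor f k * (r%:C%C * expi (- t)) ^+ k) n).
      apply: csum_tail_le => // k; apply: le_trans (hv k).
      by rewrite cabsM cabsX cabs_circle ?(ltW r0).
    rewrite /series /= big_mkord; apply: eq_bigr => k _.
    by rewrite /c /e_ exprMn expiX mulrN mulrA.
  apply: (@le_lt_trans _ _ ((K + 1) * `|limn (series v) - series v n|)).
    apply: (@le_trans _ _ (K * `|limn (series v) - series v n|)).
      by rewrite ler_wpM2l// ler_norm.
    by rewrite ler_wpM2r// lerDl.
  by rewrite mulrC -ltr_pdivlMr// ltr_wpDl.
apply/cvg_cabsP => e e0; have k0 : 0 < e / (K + 1) by rewrite divr_gt0// ltr_wpDl.
near=> r; have r01 : 0 < r < 1.
  by apply/andP; split; near: r; [apply: nbhs_left_gt; exact: ltr01|exact: nbhs_left_lt].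
have r01' : 0 <= r < 1 by have /andP[r0 ->] := r01; rewrite ltW.
have hr : forall z, cabs z <= 1 -> cabs (f (r%:C%C * z) - f z) < e / (K + 1).
  by near: r; exact: dilation_cvg.
rewrite rE// -(functional_sub (rc r r01') fc).
apply: (@le_lt_trans _ _ (K * (e / (K + 1)))).
  apply: Phibd.
    by move=> t; apply: cvgB; [exact: rc|exact: fc].
  by move=> t; apply/ltW/hr; rewrite cabs_expi.
by rewrite mulrCA gtr_pMr// ltr_pdivrMr ?mul1r ?ltrDl// ltr_wpDl.
Unshelve. all: by end_near. Qed.

Lemma pairK_functional f : disk_algebra f ->
  pairK f (fun k => Phi (e_ k)) = Phi (fun t => f (expi (- t))).
Proof. by move=> hf; apply: cvg_lim (pairK_cvg hf). Qed.

End pairing.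
End MaximumPrinciple.

(** * Measures, densities and multipliers *)

Section Functionals.
Variable R : realType.
Local Notation C := R[i].
Local Notation leb := (@lebesgue_measure R).
Local Notation T := (@Tdom R).
Implicit Types (f : C -> C) (g h : R -> C).

Lemma TdomE : T = `[0, 2 * pi[%classic.
Proof. by apply/seteqP; split=> t /=; rewrite in_itv. Qed.

Lemma measurable_Tdom : measurable (T : set (measurableTypeR R)).
Proof. by rewrite TdomE. Qed.

Lemma lebesgue_Tdom : leb T = (2 * pi)%:E.
Proof.
by rewrite TdomE lebesgue_measure_itv /= lte_fin pi2_gt0 -EFinB subr0.
Qed.

Lemma lebesgue_Tdom_lty : (leb T < +oo)%E.
Proof. by rewrite lebesgue_Tdom ltry. Qed.

Lemma cintE (mu : {measure set (measurableTypeR R) -> \bar R}) h : cint mu h = cintg mu T h.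
Proof.
rewrite /cint /cintg; set a := Rintegral _ _ _; set b := Rintegral _ _ _.
by simpc.
Qed.

Lemma continuous_cmeasurable (D : set (measurableTypeR R)) h : continuous h -> cmeasurable D h.
Proof.
by move=> hc; split; apply: measurable_funTS; apply: continuous_measurable_fun => t;
  have /cvg_ReIm[] := hc t.
Qed.

Lemma finite_measure_Tdom (mu : {finite_measure set (measurableTypeR R) -> \bar R}) :
  (mu T < +oo)%E.
Proof. by rewrite -ge0_fin_numE//; apply: fin_num_measure; exact: measurable_Tdom. Qed.

Lemma cint_lin (mu : {finite_measure set (measurableTypeR R) -> \bar R}) (a : C) h g (M N : R) :
  continuous h -> continuous g -> (forall t, T t -> cabs (h t) <= M) ->
  (forall t, T t -> cabs (g t) <= N) ->
  cint mu (fun t => a * h t + g t) = a * cint mu h + cint mu g.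
Proof.
move=> hc gc hM gN; have mT := measurable_Tdom.
have muT := finite_measure_Tdom mu.
have hi : cintegrable mu T h by apply: (cintegrable_bounded mT muT _ hM); exact: continuous_cmeasurable.
have gi : cintegrable mu T g by apply: (cintegrable_bounded mT muT _ gN); exact: continuous_cmeasurable.
rewrite !cintE (cintgD mT) ?(cintgZ mT)//; exact: cintegrableZ.
Qed.

Lemma cabs_cint_le (mu : {finite_measure set (measurableTypeR R) -> \bar R}) h (M : R) :
  continuous h -> (forall t, cabs (h t) <= M) -> cabs (cint mu h) <= 2 * fine (mu T) * M.
Proof.
move=> hc hM; have muT := finite_measure_Tdom mu.
rewrite cintE mulrAC.
apply: (cabs_cintg_bounded measurable_Tdom muT) => [|t _ //]; exact: continuous_cmeasurable.
Qed.

Lemma continuous_seg_bound h : continuous h -> exists M, forall t, T t -> cabs (h t) <= M.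
Proof.
move=> hc; have [M hM] := continuous_on_seg_bounded (ltW (pi2_gt0 R)) (continuous_on_segW (a := 0) (b := 2 * pi) hc).
by exists M => t /andP[t0 t1]; apply: hM; rewrite t0 ltW.
Qed.

Definition cmeasure_functional (mu : cmeasure R) h : C :=
  cint (cm1 mu) h - cint (cm2 mu) h + 'i%C * (cint (cm3 mu) h - cint (cm4 mu) h).

Definition L1_functional g h : C := ((2 * pi)^-1)%:C%C * cint leb (fun t => g t * h t).

Lemma cmeasure_functional_lin mu (a : C) h g : continuous h -> continuous g ->
  cmeasure_functional mu (fun t => a * h t + g t) =
  a * cmeasure_functional mu h + cmeasure_functional mu g.
Proof.
move=> hc gc; have [M hM] := continuous_seg_bound hc; have [N gN] := continuous_seg_bound gc.
by rewrite /cmeasure_functional !(cint_lin _ _ hc gc hM gN); ring.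
Qed.

Lemma cmeasure_functional_le mu : exists K : R, forall h M, continuous h ->
  (forall t, cabs (h t) <= M) -> cabs (cmeasure_functional mu h) <= K * M.
Proof.
exists (2 * fine (cm1 mu T) + 2 * fine (cm2 mu T) + (2 * fine (cm3 mu T) + 2 * fine (cm4 mu T))).
move=> h M hc hM; rewrite /cmeasure_functional mulrDl [X in _ <= X + _]mulrDl [X in _ <= _ + X]mulrDl.
apply: le_trans (cabsD _ _) _; apply: lerD.
  by apply: le_trans (cabsB _ _) _; apply: lerD; exact: cabs_cint_le.
rewrite cabsM cabs_im normr1 mul1r.
by apply: le_trans (cabsB _ _) _; apply: lerD; exact: cabs_cint_le.
Qed.

Lemma L1_mul_integrable g h : L1T g -> continuous h -> cintegrable leb T (fun t => g t * h t).
Proof.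
move=> gi hc; have [M hM] := continuous_seg_bound hc.
have := cintegrable_mul_bounded measurable_Tdom gi (continuous_cmeasurable T hc) hM.
by apply: eq_cintegrable; [exact: measurable_Tdom|move=> t _; rewrite mulrC].
Qed.

Lemma L1_functional_lin g (a : C) h k : L1T g -> continuous h -> continuous k ->
  L1_functional g (fun t => a * h t + k t) = a * L1_functional g h + L1_functional g k.
Proof.
move=> gi hc kc; rewrite /L1_functional mulrCA -mulrDr; congr (_ * _).
have hi := L1_mul_integrable gi hc; have ki := L1_mul_integrable gi kc.
have mT := measurable_Tdom.
rewrite !cintE -(cintgZ mT)// -(cintgD mT)//; last exact: cintegrableZ.
by apply: eq_cintg => t _; ring.
Qed.

Lemma L1_functional_le_on g h (M : R) : L1T g -> continuous h ->
  (forall t, T t -> cabs (h t) <= M) ->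
  cabs (L1_functional g h) <= 2 * l1norm g * M.
Proof.
move=> gi hc hM; rewrite /L1_functional cabsM cabs_real /l1norm.
have pi0 := pi2_gt0 R; rewrite ger0_norm ?invr_ge0 ?(ltW pi0)//.
set I := Rintegral _ _ _; rewrite (_ : 2 * _ * M = (2 * pi)^-1 * (2 * M * I)); last by ring.
rewrite ler_wpM2l ?invr_ge0 ?(ltW pi0)// cintE.
have -> : cintg leb T (fun t => g t * h t) = cintg leb T (fun t => h t * g t).
  by apply: eq_cintg => t _; rewrite mulrC.
by apply: (cabs_cintg_mul_le measurable_Tdom gi) => //; exact: continuous_cmeasurable.
Qed.

Lemma L1_functional_le g h (M : R) : L1T g -> continuous h ->
  (forall t, cabs (h t) <= M) -> cabs (L1_functional g h) <= 2 * l1norm g * M.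
Proof. by move=> gi hc hM; apply: L1_functional_le_on. Qed.

Lemma pairK_cmhat mu f : disk_algebra f ->
  pairK f (cmhat mu) = cmeasure_functional mu (fun t => f (expi (- t))).
Proof.
move=> hf; have [K hK] := cmeasure_functional_le mu.
exact: (pairK_functional (@cmeasure_functional_lin mu) hK hf).
Qed.

Lemma pairK_ghat g f : L1T g -> disk_algebra f ->
  pairK f (ghat g) = L1_functional g (fun t => f (expi (- t))).
Proof.
move=> gi hf; pose K := 2 * l1norm g.
have hK h M : continuous h -> (forall t, cabs (h t) <= M) -> cabs (L1_functional g h) <= K * M.
  by move=> hc hM; exact: L1_functional_le.
exact: (pairK_functional (fun a h k => @L1_functional_lin g a h k gi) hK hf).
Qed.

Lemma cabs_pairK_ghat_le g f (M : R) : L1T g -> disk_algebra f ->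
  (forall z, cabs z <= 1 -> cabs (f z) <= M) -> cabs (pairK f (ghat g)) <= 2 * l1norm g * M.
Proof.
move=> gi hf fM; rewrite pairK_ghat//; apply: L1_functional_le => //.
  exact: continuous_circle_trace.
by move=> t; apply: fM; rewrite cabs_expi.
Qed.

Lemma cabs_pairK_cmhat_le mu : exists K : R, forall f (M : R), disk_algebra f ->
  (forall z, cabs z <= 1 -> cabs (f z) <= M) -> cabs (pairK f (cmhat mu)) <= K * M.
Proof.
have [K hK] := cmeasure_functional_le mu; exists K => f M hf fM.
rewrite pairK_cmhat//; apply: hK; first exact: continuous_circle_trace.
by move=> t; apply: fM; rewrite cabs_expi.
Qed.

Section multiplier.
Variable a : nat -> C.
Hypothesis sa : abs_summable a.

Definition multiplier f : C -> C := psum (fun k => a k * taylor f k).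

Lemma multiplier_summable f : disk_algebra f -> abs_summable (fun k => a k * taylor f k).
Proof.
move=> hf; have [_ _ fb] := disk_algebra_expansion hf.
apply: (@abs_summable_le _ _ (fun k => (2 * supnorm f) * cabs (a k))).
  by move=> k; rewrite cabsM [leLHS]mulrC; apply: ler_wpM2r; [exact: cabs_ge0|exact: fb].
exact: is_cvg_seriesZ.
Qed.

Lemma multiplier_disk_algebra f : disk_algebra f -> disk_algebra (multiplier f).
Proof. by move=> /multiplier_summable/disk_algebra_abs_summable[]. Qed.

Lemma taylor_multiplier f k : disk_algebra f -> taylor (multiplier f) k = a k * taylor f k.
Proof.
by move=> /multiplier_summable/disk_algebra_abs_summable[_ h]; rewrite /multiplier h.
Qed.

(** This bound depends on the row [a]. It is the boundedness of each single operator from which the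
    uniform boundedness principle starts. *)
Lemma multiplier_le f : disk_algebra f ->
  supnorm (multiplier f) <= 2 * limn (series (fun k => cabs (a k))) * supnorm f.
Proof.
move=> hf; have [_ _ fb] := disk_algebra_expansion hf; apply: supnorm_le => z z1.
rewrite mulrAC -[_ * _](lim_seriesZ _ sa).
apply: csum_le; last exact: is_cvg_seriesZ.
move=> k; rewrite cabsM cabsX (cabsM (a k) (taylor f k)) -[leRHS]mulr1; apply: ler_pM; rewrite ?mulr_ge0 ?exprn_ge0 ?cabs_ge0//.
  by rewrite [leLHS]mulrC; apply: ler_wpM2r; [exact: cabs_ge0|exact: fb].
by rewrite exprn_ile1 ?cabs_ge0.
Qed.

(** The two Abel sums agree term by term for every r, so the identity holds for an arbitrary
    sequence [b], whether or not the limits exist. *)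
Lemma pairK_multiplier f b : disk_algebra f ->
  pairK f (fun k => a k * b k) = pairK (multiplier f) b.
Proof.
move=> hf; rewrite /pairK; set F := (fun r : R => _); set G := (fun r : R => _).
suff -> : F = G by [].
apply/funext => r; congr csum; apply/funext => k; rewrite taylor_multiplier//; ring.
Qed.

End multiplier.

End Functionals.

(** * Finite measures given by a density *)

Section DensityMeasure.
Variable R : realType.
Local Notation leb := (@lebesgue_measure R).
Local Notation RT := (measurableTypeR R).
Variable w : R -> R.
Hypothesis w0 : forall x, 0 <= w x.
Hypothesis wi : leb.-integrable setT (fun x => (w x)%:E).
Local Open Scope ereal_scope.

(** The two proofs are arguments so that the measure and finiteness structures below can be attached
    to this term. *)
Definition density_measure (_ : forall x, (0 <= w x)%R)
  (_ : leb.-integrable setT (fun x => (w x)%:E)) : set RT -> \bar R :=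
  fun A => \int[leb]_(x in A) (w x)%:E.

Local Notation nu := (density_measure w0 wi).

Let nu0 : nu set0 = 0.
Proof. by rewrite /density_measure integral_set0. Qed.

Let nu_ge0 A : 0 <= nu A.
Proof. by apply: integral_ge0 => x _; rewrite lee_fin. Qed.

Let nu_sigma_additive : semi_sigma_additive nu.
Proof.
move=> /= F mF tF mUF; rewrite /density_measure; apply: cvg_toP.
  apply: ereal_nondecreasing_is_cvgn => m n mn.
  by apply: lee_sum_nneg_natr => // k _ _; apply: integral_ge0 => x _; rewrite lee_fin.
rewrite ge0_integral_bigcup//=.
- by apply: measurable_funTS; exact: measurable_int wi.
- by move=> x _; rewrite lee_fin.
Qed.

HB.instance Definition _ := isMeasure.Build _ _ _ nu nu0 nu_ge0 nu_sigma_additive.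

Let nu_finite : fin_num_fun nu.
Proof.
move=> A mA; apply: integrable_fin_num => //; exact: integrableS wi.
Qed.

HB.instance Definition _ := Measure_isFinite.Build _ _ _ nu nu_finite.

Let nu_dom : nu `<< leb.
Proof.
apply/null_content_dominatesP => A mA A0; apply: null_set_integral => //=.
by apply: measurable_funTS; exact: measurable_int wi.
Qed.

(** The Radon-Nikodym derivative and [w] have the same integrals over measurable sets, hence agree
    almost everywhere on E; change of variables is then available with [w]. *)
Lemma integral_density_measure (f : R -> \bar R) (E : set RT) : measurable E ->
  (nu : {finite_measure set RT -> \bar R}).-integrable E f ->
  \int[nu]_(x in E) f x = \int[leb]_(x in E) (f x * (w x)%:E).
Proof.
move=> mE fi; have mf := measurable_int _ fi.
have wE := measurable_funTS (measurable_int _ wi) : measurable_fun E (fun x => (w x)%:E).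
rewrite -(Radon_Nikodym_change_of_variables nu_dom mE fi).
apply: ae_eq_integral => //.
- apply: emeasurable_funM => //; apply: (measurable_int leb).
  apply: (integrableS _ _ (@subsetT _ _)) => //=.
  by apply: Radon_Nikodym_integrable; exact: nu_dom.
- exact: emeasurable_funM.
- apply: ae_eqe_mul2l => /=.
  rewrite Radon_NikodymE /=; case: cid => /= h [h1 h2 h3].
  apply: integral_ae_eq => //=; first exact: integrableS h2.
  by move=> A AE mA; rewrite -h3.
Qed.

End DensityMeasure.

(** * From integrable functions to complex measures *)

Section L1ToMeasure.
Variable R : realType.
Local Notation C := R[i].
Local Notation leb := (@lebesgue_measure R).
Local Notation RT := (measurableTypeR R).
Local Notation T := (@Tdom R).

Lemma cint_density_measure (w : R -> R) (w0 : forall x, 0 <= w x)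
  (wi : leb.-integrable setT (fun x => (w x)%:E)) (h : R -> C) : continuous h ->
  cint (density_measure w0 wi : {finite_measure set RT -> \bar R}) h =
  cint leb (fun t => (w t)%:C%C * h t).
Proof.
move=> hc; have mT := @measurable_Tdom R; rewrite !cintE.
set nu := (density_measure w0 wi : {finite_measure set RT -> \bar R}).
have [M hM] := continuous_seg_bound hc.
have [h1 h2] : cintegrable nu T h.
  apply: (cintegrable_bounded mT (finite_measure_Tdom nu) _ hM).
  exact: continuous_cmeasurable.
have e1 := integral_density_measure mT h1.
have e2 := integral_density_measure mT h2.
apply/eqP; rewrite eq_complex /=; apply/andP; split; apply/eqP; rewrite /Rintegral.
  rewrite e1; congr fine; apply: eq_integral => t _.
  by rewrite -EFinM Re_mulc /= mul0r subr0 mulrC.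
rewrite e2; congr fine; apply: eq_integral => t _.
by rewrite -EFinM Im_mulc /= mul0r addr0 mulrC.
Qed.

(** The positive part is extended by 0 outside [0, 2 pi), because the components of a [cmeasure] are
    measures on the whole line. *)
Lemma L1_density (x : R -> R) : leb.-integrable T (fun t => (x t)%:E) ->
  exists mu : {finite_measure set RT -> \bar R}, forall h : R -> C, continuous h ->
    cint mu h = cint leb (fun t => (Num.max (x t) 0)%:C%C * h t).
Proof.
move=> xi; have mT := @measurable_Tdom R.
pose w := (fun t => Num.max (x t) 0) \_ T.
have w0 t : 0 <= w t by rewrite /w patchE; case: ifP => // _; rewrite le_max lexx orbT.
have wi : leb.-integrable setT (fun t => (w t)%:E).
  have wiT : leb.-integrable T (fun t => (Num.max (x t) 0)%:E).
    apply: (le_integrable mT _ _ xi) => [|t _].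
      apply/measurable_EFinP; apply: measurable_maxr => //.
      by apply/measurable_EFinP; exact: measurable_int xi.
    rewrite lee_fin; case: (leP (x t) 0) => // _.
    by rewrite normr0.
  have := iffLR (integrable_mkcond _ mT) wiT.
  by apply: eq_integrable => // t _; rewrite /w !patchE; case: ifP.
exists (density_measure w0 wi : {finite_measure set RT -> \bar R}) => h hc.
rewrite cint_density_measure// !cintE; apply: eq_cintg => t tT.
by rewrite /w patchE tT.
Qed.

(** The four components carry the positive and negative parts of the real and imaginary parts of
    g/(2 pi). Matching coefficients is enough, since statements (iii) and (iv) see nothing else. *)
Lemma L1_cmeasure (g : R -> C) : L1T g -> exists mu : cmeasure R, cmhat mu = ghat g.
Proof.
move=> gi; have mT := @measurable_Tdom R.
pose p : R := (2 * pi)^-1.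
have p0 : 0 <= p by rewrite invr_ge0 ltW// pi2_gt0.
pose k t := p%:C%C * g t.
have ki : cintegrable leb T k := cintegrableZ mT p%:C%C gi.
have [k1 k2] := ki.
have nk (x : R -> R) : leb.-integrable T (fun t => (x t)%:E) ->
    leb.-integrable T (fun t => (- x t)%:E).
  by move=> xi; have := integrableN xi; apply: eq_integrable.
have [m1 h1] := L1_density k1; have [m2 h2] := L1_density (nk _ k1).
have [m3 h3] := L1_density k2; have [m4 h4] := L1_density (nk _ k2).
exists (CMeasure m1 m2 m3 m4); apply/funext => j.
have ec : continuous (fun t : R => expi (- (j%:R * t)) : C) by exact: continuous_expiN.
rewrite /cmhat /= h1// h2// h3// h4// /ghat !cintE.
set e := (fun t : R => expi (- (j%:R * t)) : C) in ec *.
have ci (x : R -> R) : leb.-integrable T (fun t => (x t)%:E) ->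
    cintegrable leb T (fun t => (Num.max (x t) 0)%:C%C * e t).
  move=> xi; apply: (@L1_mul_integrable _ (fun t => (Num.max (x t) 0)%:C%C)) => //.
  split; last by apply: eq_integrable (integrable0 leb T).
  rewrite /=; apply: (le_integrable mT _ _ xi) => [|t _].
    apply/measurable_EFinP; apply: measurable_maxr => //.
    by apply/measurable_EFinP; exact: measurable_int xi.
  rewrite lee_fin; case: (leP (x t) 0) => // _.
  by rewrite normr0.
have c1 := ci _ k1; have c2 := ci _ (nk _ k1); have c3 := ci _ k2; have c4 := ci _ (nk _ k2).
have c12 := cintegrableB mT c1 c2; have c34 := cintegrableB mT c3 c4.
rewrite -(cintgB mT c1 c2) -(cintgB mT c3 c4) -(cintgZ mT 'i%C c34).
rewrite -(cintgD mT c12 (cintegrableZ mT 'i%C c34)) -(cintgZ mT _ (L1_mul_integrable gi ec)).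
apply: eq_cintg => t _.
have maxE (x : R) : Num.max x 0 - Num.max (- x) 0 = x.
  by case: (leP x 0) => h; case: (leP (- x) 0) => h'; lra.
rewrite [RHS]mulrA.
have -> : p%:C%C * g t = k t by [].
rewrite [in RHS](_ : k t = (Num.max (complex.Re (k t)) 0)%:C%C - (Num.max (- complex.Re (k t)) 0)%:C%C
  + 'i%C * ((Num.max (complex.Im (k t)) 0)%:C%C - (Num.max (- complex.Im (k t)) 0)%:C%C)).
  by ring.
by rewrite -!rmorphB /= !maxE; case: (k t) => x y; simpc.
Qed.

End L1ToMeasure.

(** * The uniform boundedness principle *)

Section UniformBoundedness.
Variables (R : realType) (X : Type).
Local Notation C := R[i].
Local Notation E := (X -> C).
Variables (D : E -> Prop) (N : E -> R) (p : nat -> E -> R).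

Hypothesis D0 : D (fun=> 0).
Hypothesis DD : forall x y, D x -> D y -> D (fun t => x t + y t).
Hypothesis DZ : forall (a : R) x, D x -> D (fun t => a%:C%C * x t).
Hypothesis N_ge0 : forall x, D x -> 0 <= N x.
Hypothesis NZ : forall (a : R) x, D x -> N (fun t => a%:C%C * x t) = `|a| * N x.
Hypothesis pD : forall n x y, D x -> D y -> p n (fun t => x t + y t) <= p n x + p n y.
Hypothesis pZ : forall n (a : R) x, D x -> p n (fun t => a%:C%C * x t) = `|a| * p n x.
Hypothesis p_bounded : forall n, exists K : R, forall x, D x -> p n x <= K * N x.
(** Completeness in the only form the gliding hump uses: terms of size 3^-j, with the explicit tail
    3^-j + 3^-(j+1) + ... = (3/2) 3^-j. *)
Hypothesis complete : forall xi : nat -> E, (forall j, D (xi j)) ->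
  (forall j, N (xi j) <= 3 ^- j) -> exists2 x, D x &
  forall j, N (fun t => x t - \sum_(i < j) xi i t) <= 3 / 2 * 3 ^- j.

Lemma dom_sub x y : D x -> D y -> D (fun t => x t - y t).
Proof.
move=> Dx Dy; have := DD Dx (DZ (-1) Dy); congr D; apply/funext => t.
by rewrite rmorphN1 mulN1r.
Qed.

Lemma seminorm_sub n x y : D x -> D y -> p n (fun t => x t - y t) <= p n x + p n y.
Proof.
move=> Dx Dy; have := pD n Dx (DZ (-1) Dy); rewrite pZ// normrN1 mul1r; congr (p n _ <= _).
by apply/funext => t; rewrite rmorphN1 mulN1r.
Qed.

Lemma seminorm_le_max n x xi : D x -> D xi ->
  p n xi <= p n (fun t => x t + xi t) \/ p n xi <= p n (fun t => x t - xi t).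
Proof.
move=> Dx Dxi; have [|h1] := lerP (p n xi) (p n (fun t => x t + xi t)); first by left.
have [|h2] := lerP (p n xi) (p n (fun t => x t - xi t)); first by right.
have := seminorm_sub n (DD Dx Dxi) (dom_sub Dx Dxi).
have -> : (fun t => x t + xi t - (x t - xi t)) = (fun t => (2 : R)%:C%C * xi t).
  by apply/funext => t; rewrite rmorph_nat; ring.
by rewrite pZ// ger0_norm//; lra.
Qed.

(** The operator norm of the n-th seminorm. It is an infimum of admissible constants, not a supremum
    over unit vectors, because [N] may vanish on nonzero functions. The factor 2/3 < 1 leaves room
    for a near-extremal vector. *)
Lemma best_constant n : exists c : R, [/\ 0 <= c, forall x, D x -> p n x <= c * N x &
  0 < c -> exists2 x, D x & 2 / 3 * c * N x < p n x].
Proof.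
have [K hK] := p_bounded n.
pose S := [set c : R | 0 <= c /\ forall x, D x -> p n x <= c * N x].
have S0 : S !=set0.
  exists `|K|; split=> // x Dx; apply: le_trans (hK _ Dx) _.
  by rewrite ler_wpM2r ?N_ge0// ler_norm.
have hS : has_inf S by split => //; exists 0 => c [].
have i0 : 0 <= inf S by apply: lb_le_inf => // c [].
have iS x : D x -> p n x <= inf S * N x.
  move=> Dx; have [N0|N0] := eqVneq (N x) 0.
    by have [c [_ /(_ x Dx)]] := S0; rewrite N0 !mulr0.
  have Np : 0 < N x by rewrite lt_neqAle eq_sym N0 N_ge0.
  rewrite -ler_pdivrMr//; apply: lb_le_inf => // c [_ /(_ x Dx)].
  by rewrite ler_pdivrMr.
exists (inf S); split => // c0.
have [//|nx] := pselect (exists2 x, D x & 2 / 3 * inf S * N x < p n x).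
exfalso; have : inf S <= 2 / 3 * inf S.
  apply: inf_lbound; first by exists 0 => c [].
  split=> [|x Dx]; first by rewrite mulr_ge0.
  by case: leP => // h; exfalso; apply: nx; exists x.
lra.
Qed.

(* Sokal's gliding hump: whichever sign is chosen, one of [x + xi], [x - xi] is at
   least as large as [xi] for a given seminorm. *)
Theorem uniform_boundedness : (forall x, D x -> exists B : R, forall n, p n x <= B) ->
  exists2 M : R, 0 <= M & forall n x, D x -> p n x <= M * N x.
Proof.
move=> pointwise; have [c hc] := choice best_constant.
have [[M cM]|unb] := pselect (exists M, forall n, c n <= M).
  exists M; first by have [c0 _ _] := hc 0%N; exact: le_trans (cM 0%N).
  move=> n x Dx; have [_ h _] := hc n; apply: le_trans (h x Dx) _.
  by rewrite ler_wpM2r ?N_ge0.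
exfalso.
have big (j : nat) : exists n, 4 ^+ j < c n.
  have [//|nn] := pselect (exists n, 4 ^+ j < c n); exfalso; apply: unb.
  by exists (4 ^+ j) => n; case: leP => // h; exfalso; apply: nn; exists n.
have [n hn] := choice big.
have hump (j : nat) : exists xi, [/\ D xi, N xi = 3 ^- j & 2 / 3 * c (n j) * 3 ^- j < p (n j) xi].
  have [c0 cub /(_ (lt_trans (exprn_gt0 _ (ltr0Sn _ _)) (hn j)))[x Dx hx]] := hc (n j).
  have Np : 0 < N x.
    rewrite lt_neqAle N_ge0// andbT eq_sym; apply/eqP => Nx.
    by move: hx (cub x Dx); rewrite Nx !mulr0 => /lt_le_trans/[apply]; rewrite ltxx.
  have s0 : 0 < 3 ^- j / N x by rewrite divr_gt0// invr_gt0 exprn_gt0.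
  exists (fun t => (3 ^- j / N x)%:C%C * x t); split; first exact: DZ.
    by rewrite NZ// ger0_norm ?ltW// divfK// gt_eqF.
  rewrite pZ// ger0_norm ?(ltW s0)//.
  have := hx; rewrite -(ltr_pM2l s0); apply: le_lt_trans.
  rewrite [leRHS](_ : _ = 2 / 3 * c (n j) * (3 ^- j / N x * N x)); last by ring.
  by rewrite divfK// gt_eqF.
have [xi hxi] := choice hump.
have Dxi j : D (xi j) by have [] := hxi j.
have DN x : D x -> D (fun t => - x t).
  by move=> Dx; have := dom_sub D0 Dx; congr D; apply/funext => t; rewrite sub0r.
(* The sign of the hump is chosen so that adding it to the current sum y keeps the selected seminorm
   at least that of [xi j]. *)
pose delta j (y : E) : E := if p (n j) (xi j) <= p (n j) (fun t => y t + xi j t)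
  then xi j else fun t => - xi j t.
pose x := fix x (j : nat) : E := if j is i.+1 then fun t => x i t + delta i (x i) t else fun=> 0.
have Dd j y : D (delta j y) by rewrite /delta; case: ifP => _ //; exact: DN.
have Dx j : D (x j) by elim: j => //= j IH; exact: DD.
have Nd j y : N (delta j y) <= 3 ^- j.
  have [_ Nj _] := hxi j; rewrite /delta; case: ifP => _; first by rewrite Nj.
  have := NZ (-1) (Dxi j); rewrite normrN1 mul1r Nj => <-.
  rewrite le_eqVlt; apply/orP; left; apply/eqP; congr N; apply/funext => t.
  by rewrite rmorphN1 mulN1r.
have px j : p (n j) (xi j) <= p (n j) (x j.+1).
  rewrite /= /delta; case: ifP => // h.
  by have [|] := seminorm_le_max (n j) (Dx j) (Dxi j); rewrite ?h.
have [y Dy hy] := complete (fun j => Dd j (x j)) (fun j => Nd j (x j)).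
have xE j : x j = fun t => \sum_(i < j) delta i (x i) t.
  elim: j => [|j IH]; apply/funext => t; first by rewrite big_ord0.
  by rewrite big_ord_recr /= -[in RHS](congr1 (fun f => f t) IH).
have [B hB] := pointwise y Dy.
(* With c > 4^j, the hump contributes (2/3) c 3^-j, while the tail after it costs at most c (3/2)
   3^-(j+1) = (1/2) c 3^-j. The difference c 3^-j / 6 exceeds (4/3)^j / 6, which is unbounded. *)
have lower j : (4 / 3) ^+ j / 6 <= B.
  apply: le_trans (hB (n j)).
  have [c0 cub _] := hc (n j); have [_ _ hp] := hxi j.
  have h1 := hy j.+1; rewrite (_ : (fun t => _ - _) = (fun t => y t - x j.+1 t)) in h1; last first.
    by apply/funext => t; rewrite xE.
  have Dyx := dom_sub Dy (Dx j.+1).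
  have h2 := le_trans (cub _ Dyx) (ler_wpM2l c0 h1).
  have h3 : p (n j) (x j.+1) <= p (n j) y + p (n j) (fun t => y t - x j.+1 t).
    have := seminorm_sub (n j) Dy Dyx; congr (p (n j) _ <= _).
    by apply/funext => t; rewrite opprB addrC subrK.
  have h4 := px j; have hcn := hn j.
  have t0 : 0 < (3 : R) ^- j by rewrite invr_gt0 exprn_gt0.
  have h5 : 4 ^+ j * 3 ^- j <= c (n j) * 3 ^- j by rewrite ler_wpM2r ?(ltW t0)// ltW.
  rewrite expr_div_n; move: h2; rewrite exprS invfM.
  have -> : c (n j) * (3 / 2 * (3^-1 * 3 ^- j)) = c (n j) * 3 ^- j / 2 by field; rewrite expf_neq0.
  move: hp h5; rewrite -mulrA; set u := c (n j) * 3 ^- j; set v := 4 ^+ j / 3 ^+ j.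
  by lra.
have B0 : 0 < B by apply: lt_le_trans (lower 0%N); rewrite expr0; lra.
have : (fun j : nat => 6 * B * (3 / 4) ^+ j) @ \oo --> 0.
  rewrite -(mulr0 (6 * B)); apply: cvgM; first exact: cvg_cst.
  by apply: cvg_expr; rewrite ger0_norm; lra.
move=> /cvgrPdist_lt/(_ _ ltr01)[m _ /(_ m (leqnn m))] /=; rewrite sub0r normrN.
move=> /(le_lt_trans (ler_norm _)); apply/negP; rewrite -leNgt.
have := lower m; set u := (4 / 3) ^+ m; have uv : u * (3 / 4) ^+ m = 1.
  by rewrite /u -exprMn (_ : 4 / 3 * (3 / 4) = 1) ?expr1n//; field.
have v0 : 0 <= (3 / 4 : R) ^+ m by rewrite exprn_ge0//; lra.
move=> h; have := ler_wpM2r v0 h; rewrite mulrAC uv; set v := (3 / 4) ^+ m; lra.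
Qed.

End UniformBoundedness.

(** * Completeness of real L^1 *)

Section Completeness.
Variable R : realType.
Local Notation C := R[i].
Local Notation leb := (@lebesgue_measure R).
Local Notation T := (@Tdom R).

Lemma series_inv3 n : series (fun j : nat => 3 ^- j : R) n = 3 / 2 - 3 / 2 * 3 ^- n.
Proof.
elim: n => [|n IH]; first by rewrite /series /= big_geq// expr0 invr1 mulr1 subrr.
rewrite /series /= big_nat_recr//= -[X in X + _]/(series (fun j : nat => 3 ^- j : R) n) IH.
by rewrite exprS invfM; set u := (3 ^+ n)^-1; lra.
Qed.

Lemma cvg_series_inv3 : series (fun j : nat => 3 ^- j : R) @ \oo --> (3 / 2 : R).
Proof.
rewrite (_ : series _ = (fun n => 3 / 2 - 3 / 2 * 3 ^- n)); last by apply/funext; exact: series_inv3.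
rewrite -[X in _ --> X]subr0; apply: cvgB; first exact: cvg_cst.
rewrite -(mulr0 (3 / 2)); apply: cvgM; first exact: cvg_cst.
rewrite (_ : (fun n => _) = GRing.exp (3^-1)); first by apply: cvg_expr; rewrite ger0_norm; lra.
by apply/funext => n; rewrite exprVn.
Qed.

Lemma series_le_inv3 (v : nat -> R) : (forall j, 0 <= v j <= 3 ^- j) ->
  cvgn (series v) /\ forall n, limn (series v) - series v n <= 3 / 2 * 3 ^- n.
Proof.
move=> hv; have c3 : cvgn (series (fun j : nat => 3 ^- j : R)).
  by apply/cvg_ex; eexists; exact: cvg_series_inv3.
have cv : cvgn (series v).
  apply: (series_le_cvg _ _ _ c3) => j;
    by [have /andP[] := hv j|rewrite invr_ge0 exprn_ge0|have /andP[] := hv j].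
split=> // n; rewrite -[leRHS](_ : 3 / 2 - series (fun j : nat => 3 ^- j : R) n = _); last first.
  by rewrite series_inv3; lra.
have h1 : (series v m - series v n) @[m --> \oo] --> limn (series v) - series v n.
  by apply: cvgB => //; exact: cvg_cst.
have h2 : (series (fun j : nat => 3 ^- j : R) m - series (fun j : nat => 3 ^- j : R) n) @[m --> \oo] -->
    3 / 2 - series (fun j : nat => 3 ^- j : R) n.
  by apply: cvgB; [exact: cvg_series_inv3|exact: cvg_cst].
apply: ler_cvg_to h1 h2 _; exists n => // m /= nm.
by rewrite !sub_series_geq//; apply: ler_sum => j _; have /andP[] := hv j.
Qed.

(** Riesz-Fischer: the sum of the absolute values has a finite integral, so it is finite almost
    everywhere and dominates all partial sums; dominated convergence follows. *)
Lemma L1_complete_real (x : nat -> R -> R) :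
  (forall j, leb.-integrable T (fun t => (x j t)%:E)) ->
  cvgn (series (fun j => \int[leb]_(t in T) `|x j t|)) ->
  exists2 f : R -> R, leb.-integrable T (fun t => (f t)%:E) &
  forall n, \int[leb]_(t in T) `|f t - \sum_(i < n) x i t| <=
    limn (series (fun j => \int[leb]_(t in T) `|x j t|)) -
    series (fun j => \int[leb]_(t in T) `|x j t|) n.
Proof.
move=> xi; set a := (fun j => _) => ca; have mT := @measurable_Tdom R.
pose s n t := \sum_(i < n) x i t.
have a0 j : 0 <= a j by apply: Rintegral_ge0.
have xm j : measurable_fun T (x j) by apply/measurable_EFinP; exact: measurable_int (xi j).
have si n : leb.-integrable T (fun t => (s n t)%:E).
  elim: n => [|n IH].
    by apply: eq_integrable (integrable0 leb T) => // t _; rewrite /s big_ord0.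
  have := integrableD mT IH (xi n); apply: eq_integrable => // t _.
  by rewrite /s big_ord_recr EFinD.
have sm n : measurable_fun T (s n) by apply/measurable_EFinP; exact: measurable_int (si n).
pose G t := (\sum_(j <oo) `|x j t|%:E)%E.
have G0 t : (0 <= G t)%E by apply: nneseries_ge0 => j _ _; rewrite lee_fin.
have Gm : measurable_fun T G.
  apply: (@ge0_emeasurable_sum _ _ _ T (fun j t => `|x j t|%:E) xpredT) => // j _.
  by apply/measurable_EFinP; apply: measurableT_comp.
have xnm j : measurable_fun T (fun t => `|x j t|%:E).
  by apply/measurable_EFinP; apply: measurableT_comp.
have xn0 j t : T t -> (0 <= `|x j t|%:E)%E by rewrite lee_fin.
have aE j : (\int[leb]_(t in T) `|x j t|%:E = (a j)%:E)%E.
  rewrite /a /Rintegral fineK//; apply: integrable_fin_num => //.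
  exact: integrable_norm (xi j).
have Gi : leb.-integrable T G.
  apply/integrableP; split=> //.
  under eq_integral do rewrite gee0_abs//.
  rewrite (integral_nneseries leb mT xnm xn0).
  under eq_eseriesr do rewrite aE.
  apply: (@le_lt_trans _ _ (limn (series a))%:E); last exact: ltry.
  apply: lime_le; first by apply: is_cvg_nneseries => j _ _; rewrite lee_fin.
  apply: nearW => n; rewrite sumEFin lee_fin.
  exact: nondecreasing_cvgn_le (nondecreasing_series (fun j _ _ => a0 j)) ca n.
have sG t n : (`|(s n t)%:E| <= G t)%E.
  apply: (@le_trans _ _ (\sum_(0 <= j < n) `|x j t|%:E)%E).
    by rewrite sumEFin lee_fin big_mkord; exact: ler_norm_sum.
  by apply: nneseries_lim_ge => j _ _; rewrite lee_fin.
(* The limsup exists at every point and is measurable; almost everywhere it is the limit of the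
   partial sums. *)
pose F t := limn_esup (fun n => (s n t)%:E); pose f t := fine (F t).
have Fm : measurable_fun T F.
  by apply: (@measurable_fun_limn_esup _ _ _ T (fun n t => (s n t)%:E)) => n; apply/measurable_EFinP.
have fm : measurable_fun T f by apply: measurableT_comp.
have good : {ae leb, forall t, T t -> (s n t)%:E @[n --> \oo] --> (f t)%:E}.
  apply: filterS (integrable_ae mT Gi) => t h /h Gfin.
  have ct : cvgn (series (fun j => x j t)).
    apply: normed_cvg; apply: nondecreasing_is_cvgn.
      by apply: nondecreasing_series => j _ _; exact: normr_ge0.
    exists (fine (G t)) => _ [n _ <-]; rewrite -lee_fin fineK// -sumEFin.
    by apply: nneseries_lim_ge => j _ _; rewrite lee_fin; exact: normr_ge0.
  have st : (s n t) @[n --> \oo] --> limn (series (fun j => x j t)).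
    rewrite (_ : (fun n => s n t) = series (fun j => x j t))//.
    by apply/funext => n; rewrite /s /series /= big_mkord.
  have ste : (s n t)%:E @[n --> \oo] --> (limn (series (fun j => x j t)))%:E.
    by apply: cvg_EFin => //; exact: nearW.
  have -> // : f t = limn (series (fun j => x j t)).
  rewrite /f /F is_cvg_limn_esupE; last by apply/cvg_ex; eexists; exact: ste.
  by rewrite (cvg_lim _ ste).
have [fi cv0 _] := dominated_convergence mT (fun n => iffRL (measurable_EFinP _ _) (sm n))
  (iffRL (measurable_EFinP _ _) fm) good Gi (aeW leb (fun t n _ => sG t n)).
exists f => // n; apply/ler_addgt0Pr => e e0.
have fsi m : leb.-integrable T (fun t => (f t - s m t)%:E).
  have := integrableB mT fi (si m); apply: eq_integrable => // t _.
have nfsi m : leb.-integrable T (fun t => `|f t - s m t|%:E) by exact: integrable_norm (fsi m).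
have tri (u v : R -> R) : leb.-integrable T (fun t => (u t)%:E) ->
    leb.-integrable T (fun t => (v t)%:E) ->
    \int[leb]_(t in T) `|u t + v t| <= \int[leb]_(t in T) `|u t| + \int[leb]_(t in T) `|v t|.
  move=> ui vi; have ui' := integrable_norm ui; have vi' := integrable_norm vi.
  rewrite -RintegralD//; apply: le_Rintegral => //.
  - have uv : leb.-integrable T (fun t => (u t + v t)%:E).
      by have := integrableD mT ui vi; apply: eq_integrable.
    exact: integrable_norm uv.
  - by have := integrableD mT ui' vi'; apply: eq_integrable.
  - by move=> t _; exact: ler_normD.
have ssi m k : leb.-integrable T (fun t => (s m t - s k t)%:E).
  by have := integrableB mT (si m) (si k); apply: eq_integrable.
have int0 k : \int[leb]_(t in T) `|s k t - s k t| = 0.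
  rewrite -[RHS](mul0r (fine (leb T))) -Rintegral_cst//.
  by apply: eq_Rintegral => t _; rewrite subrr normr0.
have sdiff m k : (k <= m)%N ->
    \int[leb]_(t in T) `|s m t - s k t| <= series a m - series a k.
  elim: m => [|m IH].
    rewrite leqn0 => /eqP ->; rewrite subrr le_eqVlt; apply/orP; left; apply/eqP.
    exact: int0.
  rewrite leq_eqVlt => /predU1P[->|km].
    rewrite subrr le_eqVlt; apply/orP; left; apply/eqP.
    exact: int0.
  have -> : series a m.+1 - series a k = (series a m - series a k) + a m.
    by rewrite /series /= big_nat_recr//=; ring.
  apply: le_trans (lerD (IH km) (lexx _)).
  rewrite (_ : Rintegral _ _ _ = \int[leb]_(t in T) `|(s m t - s k t) + x m t|); first exact: tri.
  apply: eq_Rintegral => t _; congr `|_|; rewrite /s big_ord_recr /=; ring.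
have /fine_cvgP[_ cvR] := cv0.
have /cvgrPdist_lt/(_ _ e0)[m0 _ hm0] := cvR.
(* An index beyond n at which the partial sum is within e of f; between n and m the norms of the
   terms telescope. *)
pose m := maxn m0 n.
have nm : (n <= m)%N by exact: leq_maxr.
have := hm0 m (leq_maxl _ _); rewrite /= sub0r normrN => /(le_lt_trans (ler_norm _)) hm.
have Em : fine (\int[leb]_(t in T) `|(s m t)%:E - (f t)%:E|)%E = \int[leb]_(t in T) `|f t - s m t|.
  by congr fine; apply: eq_integral => t _; rewrite -EFinB /= distrC.
rewrite Em in hm.
rewrite (_ : Rintegral _ _ _ = \int[leb]_(t in T) `|(f t - s m t) + (s m t - s n t)|); last first.
  by apply: eq_Rintegral => t _; rewrite addrA subrK.
apply: le_trans (tri _ _ (fsi m) (ssi m n)) _; rewrite addrC; apply: lerD; last exact: ltW.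
apply: le_trans (sdiff _ _ nm) _; rewrite lerD2r.
exact: nondecreasing_cvgn_le (nondecreasing_series (fun j _ _ => a0 j)) ca m.
Qed.

End Completeness.

(** * Completeness of complex L^1 and of the disk algebra *)

Section CompleteSpaces.
Variable R : realType.
Local Notation C := R[i].
Local Notation leb := (@lebesgue_measure R).
Local Notation T := (@Tdom R).

(** A norm equivalent to [l1norm], without the factor 1/(2 pi), for which completeness splits into
    two real problems. It is homogeneous for real scalars, which is what [uniform_boundedness]
    asks. *)
Definition l1ReIm (g : R -> C) : R :=
  \int[leb]_(t in T) `|complex.Re (g t)| + \int[leb]_(t in T) `|complex.Im (g t)|.

Lemma Re_sum (I : Type) (r : seq I) (F : I -> C) :
  complex.Re (\sum_(i <- r) F i) = \sum_(i <- r) complex.Re (F i).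
Proof. by elim: r => [|i r IH]; rewrite ?big_nil// !big_cons Re_addc IH. Qed.

Lemma Im_sum (I : Type) (r : seq I) (F : I -> C) :
  complex.Im (\sum_(i <- r) F i) = \sum_(i <- r) complex.Im (F i).
Proof. by elim: r => [|i r IH]; rewrite ?big_nil// !big_cons Im_addc IH. Qed.

Lemma L1_complete (xi : nat -> R -> C) : (forall j, L1T (xi j)) ->
  (forall j, l1ReIm (xi j) <= 3 ^- j) -> exists2 x, L1T x &
  forall j, l1ReIm (fun t => x t - \sum_(i < j) xi i t) <= 3 / 2 * 3 ^- j.
Proof.
move=> Lxi Nxi.
pose a j := \int[leb]_(t in T) `|complex.Re (xi j t)|.
pose b j := \int[leb]_(t in T) `|complex.Im (xi j t)|.
have a0 j : 0 <= a j by apply: Rintegral_ge0.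
have b0 j : 0 <= b j by apply: Rintegral_ge0.
have ab j : a j + b j <= 3 ^- j := Nxi j.
have [|ca _] := @series_le_inv3 R a.
  by move=> j; rewrite a0 (le_trans _ (ab j))// lerDl.
have [|cb _] := @series_le_inv3 R b.
  by move=> j; rewrite b0 (le_trans _ (ab j))// lerDr.
have [|_ tab] := @series_le_inv3 R (fun j => a j + b j).
  by move=> j; rewrite addr_ge0// ab.
have [f1 i1 h1] := L1_complete_real (fun j => (Lxi j).1) ca.
have [f2 i2 h2] := L1_complete_real (fun j => (Lxi j).2) cb.
exists (fun t => Complex (f1 t) (f2 t)) => // j.
apply: le_trans (tab j).
have E n : series (fun j => a j + b j) n = series a n + series b n.
  by rewrite /series /= big_split.
have -> : limn (series (fun j => a j + b j)) = limn (series a) + limn (series b).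
  by rewrite -(limD ca cb); congr (limn _); apply/funext => n; rewrite E.
rewrite E opprD addrACA; apply: lerD; [apply: le_trans (h1 j)|apply: le_trans (h2 j)];
  rewrite le_eqVlt; apply/orP; left; apply/eqP; apply: eq_Rintegral => t _.
  by rewrite Re_subc Re_sum.
by rewrite Im_subc Im_sum.
Qed.

Lemma eq_supnorm (f g : C -> C) : (forall z, cabs z <= 1 -> f z = g z) -> supnorm f = supnorm g.
Proof.
move=> fg; congr sup; apply/seteqP; split=> _ [z z1 <-]; exists z => //; by rewrite fg.
Qed.

Lemma supnormD (f g : C -> C) : disk_algebra f -> disk_algebra g ->
  supnorm (fun z => f z + g z) <= supnorm f + supnorm g.
Proof.
move=> hf hg; apply: supnorm_le => z z1.
by apply: le_trans (cabsD _ _) _; apply: lerD; exact: supnorm_ub.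
Qed.

Lemma supnormZ (a : R) (f : C -> C) : disk_algebra f ->
  supnorm (fun z => a%:C%C * f z) = `|a| * supnorm f.
Proof.
move=> hf; have H (b : R) (g : C -> C) : disk_algebra g ->
    supnorm (fun z => b%:C%C * g z) <= `|b| * supnorm g.
  move=> hg; apply: supnorm_le => z z1.
  by rewrite cabsM cabs_real ler_wpM2l//; exact: supnorm_ub.
apply/eqP; rewrite eq_le H//=; have [->|a0] := eqVneq a 0.
  by rewrite normr0 mul0r; apply: supnorm_ge0; exact: disk_algebraZ.
have := H a^-1 _ (disk_algebraZ a%:C%C hf).
rewrite (@eq_supnorm _ f); last first.
  by move=> z _; rewrite mulrA -rmorphM /= mulVf// mul1r.
by rewrite normfV ler_pdivlMl// normr_gt0.
Qed.

(** Uniform convergence gives continuity; holomorphy needs an argument. The limit is shown to be the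
    power series whose coefficients are the sums of the Taylor coefficients. Each of those is at
    most twice a sup-norm, so the coefficients of the n-th partial sum are off by at most 3 times
    3^-n. *)
Lemma disk_algebra_complete (xi : nat -> C -> C) : (forall j, disk_algebra (xi j)) ->
  (forall j, supnorm (xi j) <= 3 ^- j) -> exists2 x, disk_algebra x &
  forall j, supnorm (fun t => x t - \sum_(i < j) xi i t) <= 3 / 2 * 3 ^- j.
Proof.
move=> Dxi Nxi.
have c3 : cvgn (series (fun j : nat => 3 ^- j : R)).
  by apply/cvg_ex; eexists; exact: cvg_series_inv3.
have tail3 n : limn (series (fun j : nat => 3 ^- j : R)) - series (fun j : nat => 3 ^- j : R) n = 3 / 2 * 3 ^- n.
  by rewrite (cvg_lim _ (@cvg_series_inv3 R))// series_inv3; lra.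
have xib z j : cabs z <= 1 -> cabs (xi j z) <= 3 ^- j.
  by move=> z1; apply: le_trans (Nxi j); exact: supnorm_ub.
pose x z := csum (fun j => xi j z); pose S n z := \sum_(i < n) xi i z.
have SE n z : S n z = series (fun j => xi j z) n by rewrite /S /series /= big_mkord.
have xS n z : cabs z <= 1 -> cabs (x z - S n z) <= 3 / 2 * 3 ^- n.
  by move=> z1; rewrite SE -tail3; apply: csum_tail_le => // j; exact: xib.
have DS n : disk_algebra (S n).
  elim: n => [|n IH].
    rewrite (_ : S 0%N = fun=> 0); first exact: disk_algebra_cst.
    by apply/funext => z; rewrite /S big_ord0.
  have := disk_algebraD IH (Dxi n); congr disk_algebra; apply/funext => z.
  by rewrite /S big_ord_recr.
pose c k := csum (fun j => taylor (xi j) k).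
have tb j k : cabs (taylor (xi j) k) <= 2 * 3 ^- j.
  have [_ _ h] := disk_algebra_expansion (Dxi j); apply: le_trans (h k) _.
  by rewrite ler_wpM2l.
have c32 : cvgn (series (fun j : nat => 2 * 3 ^- j : R)) by exact: is_cvg_seriesZ.
have tS n k : taylor (S n) k = series (fun j => taylor (xi j) k) n.
  elim: n => [|n IH].
    rewrite (_ : S 0%N = psum (fun=> 0)).
      have [|_ ->] := @disk_algebra_abs_summable R (fun=> 0); last by rewrite /series /= big_geq.
      exact: (@abs_summable_finite _ _ 0%N).
    apply/funext => z; rewrite /S big_ord0 /psum (@csum_finite _ _ 0%N) ?big_ord0// => j _.
    by rewrite mul0r.
  rewrite (_ : S n.+1 = (S n \+ xi n)); last by apply/funext => z; rewrite /S big_ord_recr.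
  by rewrite taylorD// IH /series /= big_nat_recr.
have cS n k : cabs (c k - taylor (S n) k) <= 3 * 3 ^- n.
  rewrite tS; apply: le_trans (csum_tail_le n (fun j => tb j k) c32) _.
  rewrite (_ : series (fun j => 2 * 3 ^- j) = series ((2 : R) *: (fun j : nat => 3 ^- j : R)))//.
  rewrite lim_seriesZ// seriesZ -[X in _ - X]/(2 * series (fun j : nat => 3 ^- j : R) n).
  by rewrite -[_ *: _]/(2 * _) -mulrBr tail3; lra.
have cb k : cabs (c k) <= 3.
  have := cS 0%N k; rewrite tS /series /= big_geq// subr0 expr0 invr1 mulr1; exact.
have gc : subgeometric c := bounded_subgeometric cb.
have inv3_small (K e : R) : 0 < K -> 0 < e -> exists n : nat, K * 3 ^- n <= e.
  move=> K0 e0; have h : K * 3 ^- n @[n --> \oo] --> 0.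
    rewrite -(mulr0 K); apply: cvgM; first exact: cvg_cst.
    rewrite (_ : (fun n => _) = GRing.exp (3^-1)); first by apply: cvg_expr; rewrite ger0_norm; lra.
    by apply/funext => n; rewrite exprVn.
  have /cvgrPdist_le/(_ _ e0)[n _ /(_ n (leqnn n))] := h.
  by rewrite /= sub0r normrN => hn; exists n; exact: le_trans (ler_norm _) hn.
exists x; last by move=> j; apply: supnorm_le => z z1; exact: xS.
apply: (disk_algebra_psum gc); last first.
  apply: (@within_cdisk_uniform_limit _ _ S) => [n|e e0]; first by have [] := DS n.
  have [|n hn] := inv3_small (3 / 2) e _ e0; first by lra.
  by exists n => z z1; rewrite cabsBC; exact: le_trans (xS n z z1) hn.
move=> z z1; apply/eqP; rewrite -subr_eq0; apply/eqP/cabs0_eq/eqP.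
rewrite eq_le cabs_ge0 andbT; apply/ler_addgt0Pr => e e0; rewrite add0r.
have cz : cvgn (series (fun k => 3 * cabs z ^+ k)).
  by apply: cvg_geometric_scaled; rewrite cabs_ge0.
pose L := limn (series (fun k => 3 * cabs z ^+ k)).
have L0 : 0 <= L.
  apply: limr_ge => //; exists 0%N => // n _; rewrite /series /= sumr_ge0// => k _.
  by rewrite mulr_ge0// exprn_ge0// cabs_ge0.
(* 3/2 accounts for the uniform error of [S n], and L for the coefficient errors summed against the
   powers of z. *)
have K0 : 0 < 3 / 2 + L by lra.
have [n hn] := inv3_small _ _ K0 e0.
apply: le_trans hn; have [gS eS _] := disk_algebra_expansion (DS n).
rewrite -[x z](subrK (S n z)) -addrA; apply: le_trans (cabsD _ _) _.
rewrite mulrDl; apply: lerD; first by apply: xS; exact: ltW.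
rewrite eS// /psum -csumB; try exact: subgeometric_summable.
rewrite mulrC -[_ * _](lim_seriesZ _ cz); apply: csum_le; last exact: is_cvg_seriesZ.
move=> k; rewrite -mulrBl cabsM cabsX cabsBC.
apply: le_trans (ler_wpM2r (exprn_ge0 k (cabs_ge0 z)) (cS n k)) _.
by rewrite le_eqVlt; apply/orP; left; apply/eqP; rewrite /= -mulrA mulrCA.
Qed.

End CompleteSpaces.

(** * A uniform bound for the multipliers *)

Section BoundedMultipliers.
Variable R : realType.
Local Notation C := R[i].
Local Notation leb := (@lebesgue_measure R).
Local Notation T := (@Tdom R).

Lemma cint_segint (h : R -> C) : cintegrable leb T h -> cint leb h = segint 0 (2 * pi) h.
Proof.
rewrite cintE /segint /cintg TdomE => -[h1 h2].
by rewrite !Rintegral_itv_bndo_bndc.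
Qed.

(** Convergence of Fejer means misses the angle 0, that is the point 1; continuity restores it. *)
Lemma circle_bound_open (f : C -> C) (M : R) : disk_algebra f ->
  (forall theta, 0 < theta < 2 * pi -> cabs (f (expi (- theta))) <= M) ->
  forall t, cabs (f (expi t)) <= M.
Proof.
move=> hf fM t; have fc := continuous_circle_trace hf.
have H0 : cabs (f 1) <= M.
  have h0 : cabs (f (expi (- s))) @[s --> (0 : R)^'+] --> cabs (f (expi (- 0))).
    by apply: cvg_cabs; apply: cvg_at_right_filter; exact: fc.
  rewrite oppr0 expi0 in h0; apply: (cvgr_to_le h0).
  near=> s; apply: fM; apply/andP; split; near: s.
    exact: nbhs_right_gt.
  by apply: nbhs_right_lt; exact: pi2_gt0.
have e0 : expi (- t) != 0 :> C.
  by apply/eqP => h; have := cabs_expi (- t); rewrite h cabs0 => /eqP; rewrite eq_sym oner_eq0.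
have [s /andP[s0 s1]] := polar e0; rewrite cabs_expi mul1r => es.
have -> : expi t = expi (- s) :> C.
  by rewrite -[t]opprK expiN es -expiN.
move: s0; rewrite le_eqVlt => /predU1P[<-|s0]; first by rewrite oppr0 expi0.
by apply: fM; rewrite s0.
Unshelve. all: by end_near. Qed.

Lemma l1norm_ge0 (g : R -> C) : 0 <= l1norm g.
Proof.
rewrite /l1norm mulr_ge0 ?invr_ge0 ?twopi_ge0//; apply: Rintegral_ge0 => t _; exact: cabs_ge0.
Qed.

Lemma l1norm_le_ReIm (g : R -> C) : L1T g -> l1norm g <= (2 * pi)^-1 * l1ReIm g.
Proof.
move=> gi; have mT := @measurable_Tdom R; have [g1 g2] := gi.
have g1' := integrable_norm g1; have g2' := integrable_norm g2.
rewrite /l1norm ler_wpM2l ?invr_ge0 ?twopi_ge0// /l1ReIm -RintegralD//.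
apply: le_Rintegral => //.
- exact: cintegrable_cabs.
- by have := integrableD mT g1' g2'; apply: eq_integrable.
- by move=> t _; exact: cabs_le_ReIm.
Qed.

Lemma L1_functionalD (g g' h : R -> C) : L1T g -> L1T g' -> continuous h ->
  L1_functional (fun t => g t + g' t) h = L1_functional g h + L1_functional g' h.
Proof.
move=> gi gi' hc; rewrite /L1_functional -mulrDr !cintE.
rewrite -(cintgD (@measurable_Tdom R) (L1_mul_integrable gi hc) (L1_mul_integrable gi' hc)).
by congr (_ * _); apply: eq_cintg => t _; rewrite mulrDl.
Qed.

Lemma L1_functionalZ (a : C) (g h : R -> C) : L1T g -> continuous h ->
  L1_functional (fun t => a * g t) h = a * L1_functional g h.
Proof.
move=> gi hc; rewrite /L1_functional mulrCA; congr (_ * _).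
rewrite !cintE -(cintgZ (@measurable_Tdom R) _ (L1_mul_integrable gi hc)).
by apply: eq_cintg => t _; rewrite mulrA.
Qed.

Lemma l1ReImZ (a : R) (g : R -> C) : L1T g ->
  l1ReIm (fun t => a%:C%C * g t) = `|a| * l1ReIm g.
Proof.
move=> [g1 g2]; have mT := @measurable_Tdom R.
have g1' := integrable_norm g1; have g2' := integrable_norm g2.
rewrite /l1ReIm mulrDr -!RintegralZl//; congr (_ + _); apply: eq_Rintegral => t _.
  by rewrite Re_mulc /= mul0r subr0 normrM.
by rewrite Im_mulc /= mul0r addr0 normrM.
Qed.

Definition fejer_L1 (n : nat) (theta : R) : R -> C := fun t => (fejer n (theta - t))%:C%C.

Lemma L1T_continuous (h : R -> C) : continuous h -> L1T h.
Proof.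
move=> hc; have [M hM] := continuous_seg_bound hc.
apply: (cintegrable_bounded (@measurable_Tdom R) (lebesgue_Tdom_lty R) _ hM).
exact: continuous_cmeasurable.
Qed.

Lemma L1T_fejer n theta : L1T (fejer_L1 n theta).
Proof. by apply: L1T_continuous; exact: continuous_fejer. Qed.

Lemma Rintegral_Tdom_seg (f : R -> R) : leb.-integrable T (fun t => (f t)%:E) ->
  \int[leb]_(t in T) f t = \int[leb]_(t in `[0, 2 * pi]) f t.
Proof. by rewrite TdomE => fi; rewrite Rintegral_itv_bndo_bndc. Qed.

Lemma l1ReIm_fejer n theta : (0 < n)%N -> l1ReIm (fejer_L1 n theta) = 2 * pi.
Proof.
move=> n0; rewrite /l1ReIm [X in _ + X](_ : _ = 0); last first.
  rewrite -[RHS](mul0r (fine (leb T))) -Rintegral_cst; last exact: measurable_Tdom.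
  by apply: eq_Rintegral => t _; rewrite /= normr0.
rewrite addr0 -[RHS](fejer_integral theta n0) -Rintegral_Tdom_seg; last by have [] := L1T_fejer n theta.
by apply: eq_Rintegral => t _; rewrite /= ger0_norm// fejer_ge0.
Qed.

Lemma L1_functional_fejer n theta (h : R -> C) : continuous h ->
  L1_functional (fejer_L1 n theta) h = fejer_mean n h theta.
Proof.
move=> hc; rewrite /L1_functional cint_segint//.
by apply: L1_mul_integrable => //; exact: L1T_fejer.
Qed.

(** The Fejer kernels are test densities of [l1ReIm] norm 2 pi, and their pairings with the trace
    converge to its values on the circle; the maximum principle extends the bound to the disk. *)
Lemma supnorm_le_of_L1 (f : C -> C) (M : R) : disk_algebra f ->
  (forall g, L1T g -> cabs (L1_functional g (fun t => f (expi (- t)))) <= M * l1ReIm g) ->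
  supnorm f <= M * (2 * pi).
Proof.
move=> hf hM; have fc := continuous_circle_trace hf.
apply: supnorm_le => z; apply: maximum_principle => //; apply: circle_bound_open => //.
move=> theta th; have h1 := fejer_mean_cvg (continuous_on_segW (a := 0) (b := 2 * pi) fc) th.
have h2 : cabs (fejer_mean n (fun t => f (expi (- t))) theta) @[n --> \oo]
    --> cabs (f (expi (- theta))).
  by apply: cvg_cabs; exact: h1.
apply: (cvgr_to_le h2).
exists 1%N => // n n0; rewrite -[fejer_mean _ _ _](L1_functional_fejer n theta fc).
by rewrite -(l1ReIm_fejer theta n0); apply: hM; exact: L1T_fejer.
Qed.

Lemma multiplierD (a : nat -> C) (f g : C -> C) : abs_summable a ->
  disk_algebra f -> disk_algebra g -> forall z, cabs z <= 1 ->
  multiplier a (fun z => f z + g z) z = multiplier a f z + multiplier a g z.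
Proof.
move=> sa hf hg z z1; rewrite /multiplier /psum.
have s k : disk_algebra k -> abs_summable (fun j => a j * taylor k j * z ^+ j).
  move=> /(multiplier_summable sa) sk; apply: abs_summable_le sk => j.
  by rewrite cabsM cabsX -[leRHS]mulr1 ler_wpM2l ?cabs_ge0// exprn_ile1 ?cabs_ge0.
rewrite -csumD; try exact: s.
by congr csum; apply/funext => k; rewrite (taylorD k hf hg); ring.
Qed.

Lemma taylorZ (c : C) (f : C -> C) k : disk_algebra f ->
  taylor (fun z => c * f z) k = c * taylor f k.
Proof.
move=> hf; have [gf fe fb] := disk_algebra_expansion hf.
rewrite (@taylor_psum _ _ (fun k => c * taylor f k))//.
  apply: (@bounded_subgeometric _ _ (cabs c * (2 * supnorm f))) => j.
  by rewrite cabsM ler_wpM2l ?cabs_ge0.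
move=> w w1; rewrite fe// /psum -csumZ; last exact: subgeometric_summable.
by congr csum; apply/funext => j; rewrite mulrA.
Qed.

Lemma multiplierZ (a : nat -> C) (c : C) (f : C -> C) : abs_summable a ->
  disk_algebra f -> forall z, cabs z <= 1 ->
  multiplier a (fun z => c * f z) z = c * multiplier a f z.
Proof.
move=> sa hf z z1; rewrite /multiplier /psum -csumZ.
  by congr csum; apply/funext => k; rewrite taylorZ//; ring.
have sk := multiplier_summable sa hf; apply: abs_summable_le sk => j.
by rewrite cabsM cabsX -[leRHS]mulr1 ler_wpM2l ?cabs_ge0// exprn_ile1 ?cabs_ge0.
Qed.

(* Uniform boundedness is applied twice: over [g] for a fixed [f], where Fejer kernels
   recover the sup-norm of [multiplier (a n) f], and then over [f]. *)
Theorem bounded_multipliers (a : nat -> nat -> C) : (forall n, abs_summable (a n)) ->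
  (forall g, L1T g -> forall f, disk_algebra f -> exists B : R, forall n,
     cabs (pairK f (fun k => a n k * ghat g k)) <= B) ->
  exists2 M : R, 0 <= M & forall n f, disk_algebra f ->
    supnorm (multiplier (a n) f) <= M * supnorm f.
Proof.
move=> sa pw; have mT := @measurable_Tdom R.
have L0 : L1T (fun=> 0 : C) by exact: cintegrable0.
have LD (g h : R -> C) : L1T g -> L1T h -> L1T (fun t => g t + h t) by exact: cintegrableD.
have LZ (b : R) (g : R -> C) : L1T g -> L1T (fun t => b%:C%C * g t) by exact: cintegrableZ.
have pairE n f g : disk_algebra f -> L1T g -> pairK f (fun k => a n k * ghat g k) =
    L1_functional g (fun t => multiplier (a n) f (expi (- t))).
  move=> hf gi; rewrite (pairK_multiplier (sa n) (ghat g) hf).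
  by apply: pairK_ghat; [exact: gi|exact: multiplier_disk_algebra].
have step1 f : disk_algebra f -> exists B : R, forall n, supnorm (multiplier (a n) f) <= B.
  move=> hf; pose h n t := multiplier (a n) f (expi (- t)).
  have hc n : continuous (h n).
    by apply: continuous_circle_trace; exact: multiplier_disk_algebra.
  have [||||||||||M M0 hM] := @uniform_boundedness R R (@L1T R) (@l1ReIm R) (fun n g => cabs (L1_functional g (h n))).
  - exact: L0.
  - exact: LD.
  - exact: LZ.
  - by move=> g _; rewrite addr_ge0// Rintegral_ge0.
  - by move=> b g; exact: l1ReImZ.
  - by move=> n g g' gi gi'; rewrite L1_functionalD//; exact: cabsD.
  - by move=> n b g gi; rewrite L1_functionalZ// cabsM cabs_real.
  - move=> n; have [Mh hMh] := continuous_seg_bound (hc n).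
    exists (2 * (2 * pi)^-1 * `|Mh|) => g gi.
    apply: le_trans (L1_functional_le_on gi (hc n) (M := `|Mh|) _) _.
      by move=> t /hMh /le_trans; apply; exact: ler_norm.
    rewrite [leRHS](_ : _ = 2 * ((2 * pi)^-1 * l1ReIm g) * `|Mh|); last by ring.
    by rewrite ler_wpM2r// ler_wpM2l// l1norm_le_ReIm.
  - exact: L1_complete.
  - move=> g gi; have [B hB] := pw g gi f hf; exists B => n.
    by rewrite -pairE.
  exists (M * (2 * pi)) => n; apply: supnorm_le_of_L1; first exact: multiplier_disk_algebra.
  by move=> g gi; exact: hM.
apply: (@uniform_boundedness R C (@disk_algebra R) (@supnorm R) (fun n f => supnorm (multiplier (a n) f))).
- exact: disk_algebra_cst.
- exact: disk_algebraD.
- by move=> b f; exact: disk_algebraZ.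
- exact: supnorm_ge0.
- exact: supnormZ.
- move=> n f g hf hg; rewrite (eq_supnorm (multiplierD (sa n) hf hg)).
  by apply: supnormD; exact: multiplier_disk_algebra.
- move=> n b f hf; rewrite (eq_supnorm (multiplierZ b%:C%C (sa n) hf)).
  by apply: supnormZ; exact: multiplier_disk_algebra.
- by move=> n; exists (2 * limn (series (fun k => cabs (a n k)))) => f hf; exact: multiplier_le.
- exact: disk_algebra_complete.
- exact: step1.
Qed.

End BoundedMultipliers.

(** * The Hahn-Banach theorem for a seminorm *)

Section HahnBanach.
Variables (R : realType) (V : lmodType R) (D : set V) (q : V -> R).
Hypothesis D0 : D 0.
Hypothesis DD : forall x y, D x -> D y -> D (x + y).
Hypothesis DZ : forall a x, D x -> D (a *: x).
Hypothesis qD : forall x y, D x -> D y -> q (x + y) <= q x + q y.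
Hypothesis qZ : forall a x, D x -> q (a *: x) = `|a| * q x.
Implicit Types (G : set (V * R)) (x y z : V) (a b s : R).

(** A partial linear functional encoded by its graph. Single-valuedness is a consequence of
    domination: two values a, b at x put (0, a - b) in the graph, whence a - b <= q 0 = 0. *)
Record dominated_graph G : Prop := DominatedGraph {
  graphD : forall x y a b, G (x, a) -> G (y, b) -> G (x + y, a + b);
  graphZ : forall s x a, G (x, a) -> G (s *: x, s * a);
  graph_le : forall x a, G (x, a) -> D x /\ a <= q x }.

Lemma gauge0 : q 0 = 0.
Proof. by rewrite -(scale0r (0 : V)) qZ// normr0 mul0r. Qed.

Lemma gauge_ge0 x : D x -> 0 <= q x.
Proof.
move=> Dx; have := qD Dx (DZ (-1) Dx); rewrite qZ// normrN1 mul1r scaleN1r subrr gauge0; lra.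
Qed.

Lemma graph_functional G x a b : dominated_graph G -> G (x, a) -> G (x, b) -> a = b.
Proof.
move=> [gD gZ gl] ha hb.
have H c d : G (x, c) -> G (x, d) -> c <= d.
  move=> hc hd; have := gD _ _ _ _ hc (gZ (-1) _ _ hd).
  by rewrite scaleN1r subrr mulN1r => /gl[_]; rewrite gauge0 subr_le0.
by apply/eqP; rewrite eq_le !H.
Qed.

Lemma line_graph x0 : D x0 -> dominated_graph [set p | exists s, p = (s *: x0, s * q x0)].
Proof.
move=> Dx0; split.
- by move=> x y a b [s [-> ->]] [t [-> ->]]; exists (s + t); rewrite scalerDl mulrDl.
- by move=> s x a [t [-> ->]]; exists (s * t); rewrite scalerA mulrA.
- move=> x a [s [-> ->]]; split; first exact: DZ.
  by rewrite qZ// ler_wpM2r ?gauge_ge0// ler_norm.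
Qed.

(** The value c at z has to lie above every a - q(x - z) and below every q(y + z) - b. Domination at
    x + y and subadditivity make these bounds compatible, and a general multiple of z reduces to
    them by scaling. *)
Lemma extend_graph G z : dominated_graph G -> G (0, 0) -> D z ->
  exists c, dominated_graph [set p | exists x a s, G (x, a) /\ p = (x + s *: z, a + s * c)].
Proof.
move=> gG G00 Dz; have [gD gZ gl] := gG.
have key x a y b : G (x, a) -> G (y, b) -> a - q (x - z) <= q (y + z) - b.
  move=> hx hy; have [Dx _] := gl _ _ hx; have [Dy _] := gl _ _ hy.
  have [_ hxy] := gl _ _ (gD _ _ _ _ hx hy).
  have Dxz : D (x - z) by rewrite -scaleN1r; apply: DD => //; exact: DZ.
  have := qD Dxz (DD Dy Dz).
  rewrite (_ : x - z + (y + z) = x + y); last by rewrite addrACA addNr addr0.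
  lra.
pose S := [set r | exists x a, G (x, a) /\ r = a - q (x - z)].
have hS : has_sup S.
  split; first by exists (0 - q (0 - z)), 0, 0.
  by exists (q (0 + z) - 0) => _ [x [a [hx ->]]]; exact: key.
pose c := sup S; exists c.
have c1 x a : G (x, a) -> a - q (x - z) <= c.
  by move=> hx; apply: ub_le_sup; [case: hS|exists x, a].
have c2 x a : G (x, a) -> c <= q (x + z) - a.
  move=> hx; apply: ge_sup; first by case: hS.
  by move=> _ [y [b [hy ->]]]; exact: key.
split.
- move=> x y a b [x1 [a1 [s [h1 [-> ->]]]]] [x2 [a2 [t [h2 [-> ->]]]]].
  exists (x1 + x2), (a1 + a2), (s + t); split; first exact: gD.
  by rewrite scalerDl mulrDl addrACA [a1 + _ + _]addrACA.
- move=> r x a [x1 [a1 [s [h1 [-> ->]]]]]; exists (r *: x1), (r * a1), (r * s).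
  by split; [exact: gZ|rewrite scalerDr scalerA mulrDr mulrA].
- move=> x a [x1 [a1 [s [h1 [-> ->]]]]]; have [Dx1 q1] := gl _ _ h1.
  split; first by apply: DD => //; exact: DZ.
  have [s0|s0|<-] := ltrgtP 0 s; last by rewrite scale0r mul0r !addr0.
    have := c2 _ _ (gZ s^-1 _ _ h1); rewrite -(ler_pM2l s0) => /le_trans h.
    have {h} := h _ (lexx _); rewrite mulrBr mulrA mulfV ?gt_eqF// mul1r => h.
    have -> : q (x1 + s *: z) = s * q (s^-1 *: x1 + z).
      rewrite -[X in X * q _](ger0_norm (ltW s0)) -qZ; last by apply: DD => //; exact: DZ.
      by rewrite scalerDr scalerA mulfV ?gt_eqF// scale1r.
    lra.
  have t0 : 0 < - s by rewrite oppr_gt0.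
  have := c1 _ _ (gZ (- s)^-1 _ _ h1); rewrite -(ler_pM2l t0) => /(le_trans (lexx _)).
  rewrite mulrBr mulrA mulfV ?gt_eqF// mul1r => h.
  have -> : q (x1 + s *: z) = - s * q ((- s)^-1 *: x1 - z).
    rewrite -[X in X * q _](ger0_norm (ltW t0)) -qZ; last first.
      by rewrite -scaleN1r; apply: DD; exact: DZ.
    by rewrite scalerBr scalerA mulfV ?gt_eqF// scale1r scaleNr opprK.
  lra.
Qed.

Theorem hahn_banach x0 : D x0 -> exists u : V -> R,
  [/\ (forall x y, D x -> D y -> u (x + y) = u x + u y),
      (forall a x, D x -> u (a *: x) = a * u x),
      (forall x, D x -> `|u x| <= q x) & u x0 = q x0].
Proof.
move=> Dx0; pose G0 := [set p : V * R | exists s, p = (s *: x0, s * q x0)].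
(* The line through [x0] is added before testing domination, so the empty chain is admissible and
   the value prescribed at [x0] is never lost. *)
pose P := [set G | dominated_graph (G `|` G0)].
have [|A [PA maxA]] := @Zorn_bigcup _ P.
  move=> F FP Ftot; have [F0|/set0P[X0 FX0]] := eqVneq F set0.
    by rewrite /P /= F0 bigcup_set0 set0U; exact: line_graph.
  have common p1 p2 : (\bigcup_(X in F) X `|` G0) p1 -> (\bigcup_(X in F) X `|` G0) p2 ->
      exists2 X, F X & (X `|` G0) p1 /\ (X `|` G0) p2.
    move=> [[X FX X1]|g1] [[Y FY Y2]|g2].
    - by have [XY|YX] := Ftot X Y FX FY; [exists Y|exists X] => //; split; left; auto.
    - by exists X => //; split; [left|right].
    - by exists Y => //; split; [right|left].
    - by exists X0 => //; split; right.
  have inU X p : F X -> (X `|` G0) p -> (\bigcup_(X in F) X `|` G0) p.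
    by move=> FX [Xp|]; [left; exists X|right].
  split.
  - move=> x y a b h1 h2; have [X FX [k1 k2]] := common _ _ h1 h2.
    by apply: (inU X) => //; have [gD _ _] := FP X FX; exact: gD.
  - move=> s x a h; have [X FX [k _]] := common _ _ h h.
    by apply: (inU X) => //; have [_ gZ _] := FP X FX; exact: gZ.
  - move=> x a h; have [X FX [k _]] := common _ _ h h.
    by have [_ _ gl] := FP X FX; exact: gl k.
pose B := A `|` G0.
have gB : dominated_graph B := PA.
have G0B : G0 `<=` B by move=> p; right.
have maxB B' : dominated_graph B' -> B `<=` B' -> B' `<=` B.
  move=> gB' BB' p B'p.
  have PB' : P B'.
    by rewrite /P /= (_ : B' `|` G0 = B')//; apply/setUidPl; exact: subset_trans BB'.
  have AB' : A `<=` B' by move=> r Ar; apply: BB'; left.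
  have [B'A|nB'A] := pselect (B' `<=` A); first by left; exact: B'A.
  by exfalso; apply: (maxA B') => //; split.
have B00 : B (0, 0) by apply: G0B; exists 0; rewrite scale0r mul0r.
have total z : D z -> exists a, B (z, a).
  move=> Dz; have [c gB'] := extend_graph gB B00 Dz.
  exists c; apply: (maxB _ gB').
    by move=> [x a] h; exists x, a, 0; rewrite scale0r mul0r !addr0.
  by exists 0, 0, 1; rewrite scale1r mul1r !add0r.
(* Outside D the functional takes the default value 0, which the conclusion never inspects. *)
pose u z := xget 0 [set a | B (z, a)].
have uP z : D z -> B (z, u z).
  by move=> /total[a Ba]; rewrite /u; case: xgetP => [b _ //|/(_ a)].
have uE z a : D z -> B (z, a) -> u z = a.
  by move=> Dz Bz; exact: graph_functional gB (uP z Dz) Bz.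
have [gD gZ gl] := gB.
exists u; split.
- by move=> x y Dx Dy; apply: uE; [exact: DD|apply: gD; exact: uP].
- by move=> a x Dx; apply: uE; [exact: DZ|apply: gZ; exact: uP].
- move=> x Dx; rewrite ler_norml; apply/andP; split; last by have [] := gl _ _ (uP x Dx).
  have [_] := gl _ _ (gZ (-1) _ _ (uP x Dx)); rewrite qZ// normrN1 mul1r mulN1r; lra.
- by apply: uE => //; apply: G0B; exists 1; rewrite scale1r mul1r.
Qed.

End HahnBanach.

(** * Density of trigonometric polynomials in L^1 *)

Section TrigonometricDensity.
Variable R : realType.
Local Notation C := R[i].
Local Notation leb := (@lebesgue_measure R).
Local Notation T := (@Tdom R).

(** A list of coefficients and frequencies in which repetitions are allowed, so that the double sum
    of a Fejer mean fits without regrouping. *)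
Definition trig_poly (s : seq (C * int)) : R -> C :=
  fun t => \sum_(p <- s) p.1 * expi (p.2%:~R * t).

Lemma continuous_trig_poly s : continuous (trig_poly s).
Proof.
apply: continuous_sumC => p t.
by apply: cvgM; [exact: cvg_cst|exact: continuous_expiM].
Qed.

Lemma expi_int_2pi (m : int) : expi (m%:~R * (2 * pi)) = 1 :> C.
Proof.
case: m => k; first exact: expi_nat_2pi.
by rewrite NegzE rmorphN /= mulNr -mulNr; exact: expi_Nnat_2pi.
Qed.

Lemma ghat_expi (m : int) (k : nat) :
  ghat (fun t => expi (m%:~R * t)) k = (m == k%:Z)%:R :> C.
Proof.
have p0 : (2 * pi : R) != 0 by rewrite gt_eqF// pi2_gt0.
have E : (fun t => expi (m%:~R * t) * expi (- (k%:R * t))) =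
    (fun t => expi ((m - k%:Z)%:~R * t)) :> (R -> C).
  apply/funext => t; rewrite -expiD rmorphB /=; congr expi.
  by rewrite mulrBl.
rewrite /ghat E cint_segint; last by apply: L1T_continuous; exact: continuous_expiM.
have [->|mk] := eqVneq m k%:Z.
  by rewrite subrr segint_expi0 -rmorphM /= mulVf// rmorph1.
by rewrite segint_expi ?mulr0// ?expi_int_2pi// intr_eq0 subr_eq0.
Qed.

Lemma fejer_mean_trig n (phi : R -> C) : continuous_on_seg 0 (2 * pi) phi ->
  exists s, fejer_mean n phi = trig_poly s.
Proof.
move=> pc; pose F (j l : 'I_n) : C * int :=
  (n%:R^-1 * fcoef phi (j%:R - l%:R), ((j : nat)%:Z - (l : nat)%:Z)%R).
exists [seq F j l | j <- index_enum 'I_n, l <- index_enum 'I_n].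
apply/funext => t; rewrite fejer_meanE// /trig_poly big_allpairs_dep mulr_sumr.
apply: eq_bigr => j _; rewrite mulr_sumr; apply: eq_bigr => l _.
by rewrite /F /= rmorphB /=; ring.
Qed.

Lemma continuous_fejer_mean n (phi : R -> C) : continuous_on_seg 0 (2 * pi) phi ->
  continuous (fejer_mean n phi).
Proof. by move=> /(fejer_mean_trig n)[s ->]; exact: continuous_trig_poly. Qed.

(** Dominated convergence: the means are bounded by 2 M, hence the differences by 3 M, and pointwise
    convergence is known on [0, 2 pi) except at 0, a null set. *)
Lemma fejer_mean_L1_cvg (phi : R -> C) : continuous phi ->
  \int[leb]_(t in T) cabs (fejer_mean n.+1 phi t - phi t) @[n --> \oo] --> 0.
Proof.
move=> pc; have mT := @measurable_Tdom R.
have ps : continuous_on_seg 0 (2 * pi) phi by exact: continuous_on_segW.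
have [M hM] := continuous_on_seg_bounded (ltW (pi2_gt0 R)) ps.
have dc n : continuous (fun t => fejer_mean n.+1 phi t - phi t).
  have fc : continuous (fejer_mean n.+1 phi) := @continuous_fejer_mean n.+1 phi ps.
  by move=> t; apply: cvgB; [exact: fc|exact: pc].
pose f_ n t := (cabs (fejer_mean n.+1 phi t - phi t))%:E.
have mf n : measurable_fun T (f_ n).
  apply/measurable_EFinP; apply: cmeasurable_cabs.
  exact: continuous_cmeasurable (dc n).
have ae0 : {ae leb, forall t, T t -> f_ n t @[n --> \oo] --> (0 : R)%:E}.
  exists [set 0]; split => //; first exact: lebesgue_measure_set1.
  move=> t /= nt; apply: contrapT => t0; apply: nt => /andP[t1 t2].
  have th : 0 < t < 2 * pi.
    by rewrite t2 lt_neqAle t1 !andbT eq_sym; apply/eqP.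
  have h := fejer_mean_cvg ps th; rewrite -cvg_shiftS in h.
  by apply: cvg_EFin; [exact: nearW|apply/cvg_cabs0P; exact: h].
have [|||||_ _ h] := @dominated_convergence _ _ _ leb T mT f_ (fun=> 0%:E) (fun=> (3 * M)%:E).
- exact: mf.
- exact: measurable_cst.
- exact: ae0.
- exact: (integrable_cst_on mT (lebesgue_Tdom_lty R)).
- apply: aeW => t n /andP[t0 t1]; rewrite lee_fin ger0_norm ?cabs_ge0//.
  have t01 : 0 <= t <= 2 * pi by rewrite t0 ltW.
  apply: le_trans (cabsB _ _) _.
  by have := hM _ t01; have := @fejer_mean_bound _ n.+1 phi t M isT ps hM; lra.
move: h; rewrite integral0 => /fine_cvgP[_].
by apply: cvg_trans; apply: near_eq_cvg; exact: nearW.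
Qed.

Lemma l1normD (g h : R -> C) : L1T g -> L1T h ->
  l1norm (fun t => g t + h t) <= l1norm g + l1norm h.
Proof.
move=> gi hi; have mT := @measurable_Tdom R.
rewrite /l1norm -mulrDr ler_wpM2l ?invr_ge0 ?twopi_ge0//.
have g1 := cintegrable_cabs mT gi; have h1 := cintegrable_cabs mT hi.
rewrite -RintegralD//; apply: le_Rintegral => //.
- exact: (cintegrable_cabs mT (cintegrableD mT gi hi)).
- by have := integrableD mT g1 h1; apply: eq_integrable.
- by move=> t _; exact: cabsD.
Qed.

Lemma l1normZ (c : C) (g : R -> C) : L1T g -> l1norm (fun t => c * g t) = cabs c * l1norm g.
Proof.
move=> gi; have mT := @measurable_Tdom R.
rewrite /l1norm mulrCA -(RintegralZl (cabs c) mT (cintegrable_cabs mT gi)).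
by congr (_ * _); apply: eq_Rintegral => t _; rewrite cabsM.
Qed.

Lemma L1TB (g h : R -> C) : L1T g -> L1T h -> L1T (fun t => g t - h t).
Proof. by move=> gi hi; apply: cintegrableB => //; exact: measurable_Tdom. Qed.

Lemma continuous_dense (g : R -> C) (e : R) : L1T g -> 0 < e ->
  exists2 phi : R -> C, continuous phi & l1norm (fun t => g t - phi t) <= e.
Proof.
move=> gi e0; have mT := @measurable_Tdom R; have [g1 g2] := gi.
have pi0 := pi2_gt0 R; have d0 : 0 < e * (2 * pi) / 2 by rewrite divr_gt0// mulr_gt0.
have H (x : R -> R) : leb.-integrable T (fun t => (x t)%:E) -> exists y : R -> R,
    [/\ continuous y, leb.-integrable T (fun t => (y t)%:E) &
        \int[leb]_(t in T) `|x t - y t| <= e * (2 * pi) / 2].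
  move=> xi; have [y_ [yc yi yl]] := approximation_continuous_integrable mT (lebesgue_Tdom_lty R) xi.
  move/fine_cvgP: yl => [_ /cvgrPdist_le/(_ _ d0)[n _ /(_ n (leqnn n))]] /=.
  rewrite sub0r normrN => /(le_trans (ler_norm _)) h.
  by exists (y_ n); split; [exact: yc|exact: yi|exact: h].
have [y1 [c1 i1 h1]] := H _ g1; have [y2 [c2 i2 h2]] := H _ g2.
pose phi t : C := Complex (y1 t) (y2 t).
have pc : continuous phi by move=> t; apply/cvg_ReIm; split; [exact: c1|exact: c2].
exists phi => //; have phii : L1T phi by split.
apply: le_trans (l1norm_le_ReIm (L1TB gi phii)) _; rewrite ler_pdivrMl// [_ * e]mulrC.
rewrite [leRHS]splitr; apply: lerD.
  by apply: le_trans h1; rewrite le_eqVlt; apply/orP; left; apply/eqP;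
     apply: eq_Rintegral => t _; rewrite Re_subc.
by apply: le_trans h2; rewrite le_eqVlt; apply/orP; left; apply/eqP;
   apply: eq_Rintegral => t _; rewrite Im_subc.
Qed.

Lemma trig_poly_dense (g : R -> C) (e : R) : L1T g -> 0 < e ->
  exists s, l1norm (fun t => g t - trig_poly s t) <= e.
Proof.
move=> gi e0; have e2 : 0 < e / 2 by rewrite divr_gt0.
have [phi pc hphi] := continuous_dense gi e2.
have phii : L1T phi by exact: L1T_continuous.
have pi0 := pi2_gt0 R; have d0 : 0 < e / 2 * (2 * pi) by rewrite mulr_gt0.
have /cvgrPdist_le/(_ _ d0)[n _ /(_ n (leqnn n))] := fejer_mean_L1_cvg pc.
rewrite /= sub0r normrN => /(le_trans (ler_norm _)) h.
have ps : continuous_on_seg 0 (2 * pi) phi by exact: continuous_on_segW.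
have [s sE] := fejer_mean_trig n.+1 ps; exists s.
have si : L1T (trig_poly s) by apply: L1T_continuous; exact: continuous_trig_poly.
rewrite (_ : (fun t => _) = (fun t => (g t - phi t) + (phi t - trig_poly s t))); last first.
  by apply/funext => t; rewrite addrA subrK.
apply: le_trans (l1normD (L1TB gi phii) (L1TB phii si)) _.
rewrite [leRHS]splitr; apply: lerD => //.
rewrite /l1norm ler_pdivrMl// [_ * (e / 2)]mulrC; apply: le_trans h.
rewrite le_eqVlt; apply/orP; left; apply/eqP; apply: eq_Rintegral => t _.
by rewrite cabsBC sE.
Qed.

End TrigonometricDensity.

(** * The quotient norm and its functionals *)

Section QuotientNorm.
Variable R : realType.
Local Notation C := R[i].
Local Notation leb := (@lebesgue_measure R).
Local Notation T := (@Tdom R).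
Implicit Types (g h u x y : R -> C).

Lemma ghatD g h k : L1T g -> L1T h -> ghat (fun t => g t + h t) k = ghat g k + ghat h k.
Proof. by move=> gi hi; apply: (L1_functionalD gi hi); exact: continuous_expiN. Qed.

Lemma ghatZ (c : C) g k : L1T g -> ghat (fun t => c * g t) k = c * ghat g k.
Proof. by move=> gi; apply: (L1_functionalZ _ gi); exact: continuous_expiN. Qed.

Lemma L1TD g h : L1T g -> L1T h -> L1T (fun t => g t + h t).
Proof. by apply: cintegrableD; exact: measurable_Tdom. Qed.

Lemma L1TZ (c : C) g : L1T g -> L1T (fun t => c * g t).
Proof. by apply: cintegrableZ; exact: measurable_Tdom. Qed.

Lemma L1T0 : L1T (fun=> 0 : C).
Proof. exact: cintegrable0. Qed.

Lemma ghatB g h k : L1T g -> L1T h -> ghat (fun t => g t - h t) k = ghat g k - ghat h k.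
Proof.
move=> gi hi; have hn := L1TZ (-1) hi.
rewrite -mulN1r -(ghatZ (-1) k hi) -(ghatD k gi hn).
by congr (ghat _ k); apply/funext => t; rewrite mulN1r.
Qed.

Lemma H10bar0 : H10bar (fun=> 0 : C).
Proof.
split=> [|k]; first exact: L1T0.
have E := ghatZ 0 k L1T0; rewrite [RHS]mul0r in E.
rewrite -[RHS]E; congr (ghat _ k); apply/funext => t.
by rewrite mul0r.
Qed.

Lemma H10barD u v : H10bar u -> H10bar v -> H10bar (fun t => u t + v t).
Proof.
by move=> [ui u0] [vi v0]; split=> [|k]; [exact: L1TD|rewrite (ghatD k ui vi) u0 v0 addr0].
Qed.

Lemma H10barZ (c : C) u : H10bar u -> H10bar (fun t => c * u t).
Proof. by move=> [ui u0]; split=> [|k]; [exact: L1TZ|rewrite (ghatZ c k ui) u0 mulr0]. Qed.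

Lemma dist_le x u : H10bar u -> dist_H10bar x <= l1norm (fun t => x t - u t).
Proof.
move=> Hu; apply: inf_lbound; last by exists u.
by exists 0 => _ [v _ <-]; exact: l1norm_ge0.
Qed.

Lemma dist_le_l1norm x : dist_H10bar x <= l1norm x.
Proof.
have := dist_le x H10bar0; congr (_ <= l1norm _); apply/funext => t.
by rewrite subr0.
Qed.

Lemma dist_set_neq0 x : [set l1norm (x \- u) | u in @H10bar R] !=set0.
Proof. by exists (l1norm (x \- (fun=> 0))), (fun=> 0); first exact: H10bar0. Qed.

Lemma dist_ge0 x : 0 <= dist_H10bar x.
Proof. by apply: lb_le_inf; [exact: dist_set_neq0|move=> _ [u _ <-]; exact: l1norm_ge0]. Qed.

Lemma dist_witness x (e : R) : 0 < e ->
  exists2 u, H10bar u & l1norm (fun t => x t - u t) < dist_H10bar x + e.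
Proof.
move=> e0; have hi : has_inf [set l1norm (x \- u) | u in @H10bar R].
  by split; [exact: dist_set_neq0|exists 0 => _ [u _ <-]; exact: l1norm_ge0].
by have [_ [u Hu <-] h] := inf_adherent e0 hi; exists u.
Qed.

Lemma distD x y : L1T x -> L1T y ->
  dist_H10bar (fun t => x t + y t) <= dist_H10bar x + dist_H10bar y.
Proof.
move=> xi yi; apply/ler_addgt0Pr => e e0; have e2 : 0 < e / 2 by rewrite divr_gt0.
have [u Hu hu] := dist_witness x e2; have [v Hv hv] := dist_witness y e2.
apply: le_trans (dist_le _ (H10barD Hu Hv)) _.
rewrite (_ : (fun t => _) = (fun t => (x t - u t) + (y t - v t))); last first.
  by apply/funext => t; ring.
apply: le_trans (l1normD (L1TB xi Hu.1) (L1TB yi Hv.1)) _; lra.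
Qed.

Lemma dist_scale_le (c : C) x : L1T x -> dist_H10bar (fun t => c * x t) <= cabs c * dist_H10bar x.
Proof.
move=> xi; have c1 : 0 < cabs c + 1 by have := cabs_ge0 c; lra.
apply/ler_addgt0Pr => e e0.
have [u Hu hu] := dist_witness x (divr_gt0 e0 c1).
apply: le_trans (dist_le _ (H10barZ c Hu)) _.
rewrite (_ : (fun t => _) = (fun t => c * (x t - u t))); last first.
  by apply/funext => t; rewrite mulrBr.
rewrite l1normZ; last exact: L1TB xi Hu.1.
apply: le_trans (ler_wpM2l (cabs_ge0 c) (ltW hu)) _.
rewrite mulrDr lerD2l mulrCA ger_pMr// ler_pdivrMr// mul1r; lra.
Qed.

Lemma distZ (a : R) x : L1T x -> dist_H10bar (fun t => a%:C%C * x t) = `|a| * dist_H10bar x.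
Proof.
move=> xi; apply/eqP; rewrite eq_le; apply/andP; split.
  by apply: le_trans (dist_scale_le _ xi) _; rewrite cabs_real.
have [->|a0] := eqVneq a 0; first by rewrite normr0 mul0r; exact: dist_ge0.
have := dist_scale_le a^-1%:C%C (L1TZ a%:C%C xi).
rewrite (_ : (fun t => _) = x); last first.
  by apply/funext => t; rewrite mulrA -rmorphM /= mulVf// mul1r.
by rewrite cabs_real normfV ler_pdivlMl// normr_gt0.
Qed.

Lemma dist_H10bar_eq0 u : H10bar u -> dist_H10bar u = 0.
Proof.
move=> Hu; apply/eqP; rewrite eq_le dist_ge0 andbT.
apply: le_trans (dist_le _ Hu) _; rewrite (_ : (fun t => _) = (fun t => 0 * u t)).
  by rewrite l1normZ ?cabs0 ?mul0r//; exact: Hu.1.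
by apply/funext => t; rewrite subrr mul0r.
Qed.

(* Complexification of a real functional given by the Hahn-Banach theorem. *)
Lemma dist_functional x0 : L1T x0 -> exists phi : (R -> C) -> C,
  [/\ (forall x y, L1T x -> L1T y -> phi (fun t => x t + y t) = phi x + phi y),
      (forall (c : C) x, L1T x -> phi (fun t => c * x t) = c * phi x),
      (forall x, L1T x -> cabs (phi x) <= 2 * dist_H10bar x) &
      dist_H10bar x0 <= cabs (phi x0)].
Proof.
(* [Rcomplex R] is [C] with real scalars: complex functions become a real vector space, to which the
   real Hahn-Banach theorem applies. *)
move=> x0i; pose V : lmodType R := (R -> Rcomplex R).
have scE (a : R) (z : C) : (a *: (z : Rcomplex R)) = (a%:C%C * z : C) by case: z => p q; simpc.
have scfE (a : R) (x : R -> C) : (a *: (x : V)) = (fun t => a%:C%C * x t) :> (R -> C).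
  by apply/funext => t; exact: scE.
have [|||||u [uD uZ ub ux0]] := @hahn_banach R V (@L1T R) (@dist_H10bar R) _ _ _ _ _ x0 x0i.
- exact: L1T0.
- by move=> x y; exact: L1TD.
- by move=> a x xi; rewrite scfE; exact: L1TZ.
- by move=> x y; exact: distD.
- by move=> a x xi; rewrite scfE; exact: distZ.
have uZ' (a : R) x : L1T x -> u (fun t => a%:C%C * x t) = a * u x.
  by move=> xi; rewrite -uZ// scfE.
pose ix x : R -> C := fun t => 'i%C * x t.
have ixi x : L1T x -> L1T (ix x) by exact: L1TZ.
(* The complex-linear functional with real part [u] is u(x) - i u(ix). Bounding both parts
   separately produces the factor 2 in its norm. *)
pose phi x : C := Complex (u x) (- u (ix x)).
exists phi; split.
- move=> x y xi yi; apply/eqP; rewrite eq_complex /=; apply/andP; split; apply/eqP.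
    exact: uD.
  rewrite -opprD -uD; [|exact: ixi|exact: ixi]; congr (- u _).
  by apply/funext => t; rewrite /ix mulrDr.
- case=> a b x xi.
  have E : (fun t => Complex a b * x t) =
      (fun t => (fun t => a%:C%C * x t) t + (fun t => b%:C%C * ix x t) t) :> (R -> C).
    by apply/funext => t; rewrite /ix; case: (x t) => p q; simpc.
  have E' : ix (fun t => Complex a b * x t) =
      (fun t => (fun t => a%:C%C * ix x t) t + (fun t => (- b)%:C%C * x t) t) :> (R -> C).
    by apply/funext => t; rewrite /ix; case: (x t) => p q; simpc; congr Complex; ring.
  have e1 : u (fun t => Complex a b * x t) = a * u x + b * u (ix x).
    rewrite E -(uZ' a x xi) -(uZ' b (ix x) (ixi _ xi)).
    by apply: uD; [exact: L1TZ|apply: L1TZ; exact: ixi].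
  have e2 : u (ix (fun t => Complex a b * x t)) = a * u (ix x) - b * u x.
    rewrite E' -mulNr -(uZ' (- b) x xi) -(uZ' a (ix x) (ixi _ xi)).
    by apply: uD; [apply: L1TZ; exact: ixi|exact: L1TZ].
  rewrite /phi e1 e2; simpc; congr Complex; ring.
- move=> x xi; apply: le_trans (cabs_le_ReIm _) _; rewrite /= normrN.
  rewrite mulr_natl mulr2n; apply: lerD; first exact: ub.
  apply: le_trans (ub _ (ixi _ xi)) _.
  by apply: le_trans (dist_scale_le _ xi) _; rewrite cabs_im normr1 mul1r.
- by rewrite -ux0; apply: le_trans (ler_norm _) (Re_le_cabs (phi x0)).
Qed.

End QuotientNorm.

(** * The quotient norm is controlled by the disk algebra *)

Section NormingLemma.
Variable R : realType.
Local Notation C := R[i].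
Local Notation leb := (@lebesgue_measure R).
Local Notation T := (@Tdom R).

Definition char_fun (m : int) : R -> C := fun t => expi (m%:~R * t).

Lemma L1T_char m : L1T (char_fun m).
Proof. by apply: L1T_continuous; exact: continuous_expiM. Qed.

Lemma ghat_char m k : ghat (char_fun m) k = (m == k%:Z)%:R.
Proof. exact: ghat_expi. Qed.

(** Characters of negative frequency belong to [H10bar], so their pairing with the disk algebra must
    be 0. *)
Definition taylor_int (f : C -> C) (m : int) : C := if m is Posz k then taylor f k else 0.

Lemma pairK_char (f : C -> C) m : pairK f (ghat (char_fun m)) = taylor_int f m.
Proof.
rewrite /pairK; apply: cvg_lim => //.
have -> : (fun r : R => csum (fun k => taylor f k * ghat (char_fun m) k * r%:C%C ^+ k)) =
    (fun r : R => taylor_int f m * (r ^+ `|m|)%:C%C).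
  apply/funext => r; case: m => n; rewrite /taylor_int.
    rewrite (@csum_finite _ _ n.+1) => [|k nk]; last first.
      by rewrite ghat_char eqz_nat ltn_eqF// mulr0 mul0r.
    rewrite (bigD1 ord_max)//= ghat_char eqxx mulr1 big1 ?addr0 ?rmorphXn// => i.
    rewrite -val_eqE /= eq_sym => /negbTE ni.
    by rewrite ghat_char eqz_nat ni mulr0 mul0r.
  rewrite mul0r (@csum_finite _ _ 0%N) ?big_ord0// => k _.
  by rewrite ghat_char mulr0 mul0r.
rewrite -[X in _ --> X]mulr1; apply: cvgM; first exact: cvg_cst.
apply/cvg_cabsP => e e0; have /cvgrPdist_lt/(_ _ e0) := @cvg_expr_left R `|m|.
apply: filterS => r; have -> : (r ^+ `|m|)%:C%C - 1 = (r ^+ `|m| - 1)%:C%C :> C.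
  by rewrite rmorphB rmorph1.
by rewrite cabs_real distrC.
Qed.

Lemma pairK_ghatD (f : C -> C) (g h : R -> C) : disk_algebra f -> L1T g -> L1T h ->
  pairK f (ghat (fun t => g t + h t)) = pairK f (ghat g) + pairK f (ghat h).
Proof.
move=> hf gi hi; rewrite !(pairK_ghat _ hf) ?L1_functionalD//; last exact: L1TD.
exact: continuous_circle_trace.
Qed.

Lemma pairK_ghatZ (f : C -> C) (c : C) (g : R -> C) : disk_algebra f -> L1T g ->
  pairK f (ghat (fun t => c * g t)) = c * pairK f (ghat g).
Proof.
move=> hf gi; rewrite !(pairK_ghat _ hf) ?L1_functionalZ//; last exact: L1TZ.
exact: continuous_circle_trace.
Qed.

Lemma trig_poly_nil : trig_poly [::] = (fun=> 0) :> (R -> C).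
Proof. by apply/funext => t; rewrite /trig_poly big_nil. Qed.

Lemma trig_poly_cons p s :
  trig_poly (p :: s) = (fun t => (fun t => p.1 * char_fun p.2 t) t + trig_poly s t) :> (R -> C).
Proof. by apply/funext => t; rewrite /trig_poly big_cons. Qed.

Lemma L1T_trig_poly s : L1T (@trig_poly R s).
Proof. by apply: L1T_continuous; exact: continuous_trig_poly. Qed.

Lemma pairK_ghat0 (f : C -> C) : disk_algebra f -> pairK f (ghat (fun=> 0)) = 0.
Proof.
move=> hf; have E := pairK_ghatZ 0 hf (L1T0 R); rewrite [RHS]mul0r in E.
rewrite -[RHS]E; congr (pairK f (ghat _)); apply/funext => t.
by rewrite mulr0.
Qed.

Lemma pairK_trig_poly (f : C -> C) s : disk_algebra f ->
  pairK f (ghat (trig_poly s)) = \sum_(p <- s) p.1 * taylor_int f p.2.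
Proof.
move=> hf; elim: s => [|p s IH]; first by rewrite trig_poly_nil big_nil pairK_ghat0.
rewrite trig_poly_cons big_cons pairK_ghatD//; [|exact: L1TZ (L1T_char _)|exact: L1T_trig_poly].
by rewrite IH pairK_ghatZ ?pairK_char//; exact: L1T_char.
Qed.

(* A functional [phi] on L^1 vanishing on [H10bar] is determined by its values [b k]
   on the nonnegative characters.  The values of [phi] at translated Fejer kernels are
   those of the Cesaro means [F n] of [\sum b k z^k]; these polynomials are thus
   uniformly bounded, and they represent [phi] in the limit. *)
Lemma dist_le_pairK (h : R -> C) (M : R) : L1T h -> 0 <= M ->
  (forall f, disk_algebra f -> cabs (pairK f (ghat h)) <= M * supnorm f) ->
  dist_H10bar h <= 2 * M.
Proof.
move=> hi M0 hM; have [phi [phiD phiZ phib phi_h]] := dist_functional hi.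
have phil x : L1T x -> cabs (phi x) <= 2 * l1norm x.
  by move=> xi; apply: le_trans (phib x xi) _; rewrite ler_wpM2l// dist_le_l1norm.
pose b (k : nat) := phi (char_fun k%:Z).
pose bt (m : int) := if m is Posz k then b k else 0.
have phi_char m : phi (char_fun m) = bt m.
  case: m => // n; apply: cabs0_eq; apply/eqP; rewrite eq_le cabs_ge0 andbT.
  apply: le_trans (phib _ (L1T_char _)) _; rewrite dist_H10bar_eq0 ?mulr0//.
  by split=> [|k]; [exact: L1T_char|rewrite ghat_char].
have phi0 : phi (fun=> 0) = 0.
  have E := phiZ 0 _ (L1T0 R); rewrite [RHS]mul0r in E.
  rewrite -[RHS]E; congr phi; apply/funext => t.
  by rewrite mulr0.
have phi_trig s : phi (trig_poly s) = \sum_(p <- s) p.1 * bt p.2.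
  elim: s => [|p s IH]; first by rewrite trig_poly_nil big_nil phi0.
  rewrite trig_poly_cons big_cons phiD; [|exact: L1TZ (L1T_char _)|exact: L1T_trig_poly].
  by rewrite IH phiZ ?phi_char//; exact: L1T_char.
have phi_sum (I : Type) (r : seq I) (F : I -> R -> C) : (forall i, L1T (F i)) ->
    phi (fun t => \sum_(i <- r) F i t) = \sum_(i <- r) phi (F i) /\
    L1T (fun t => \sum_(i <- r) F i t).
  move=> Fi; elim: r => [|i r [IH IHi]].
    rewrite big_nil (_ : (fun t => _) = (fun=> 0)); first by split; [|exact: L1T0].
    by apply/funext => t; rewrite big_nil.
  rewrite big_cons (_ : (fun t => _) = (fun t => F i t + (fun t => \sum_(i <- r) F i t) t)).
    by rewrite phiD// IH; split=> //; exact: L1TD.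
  by apply/funext => t; rewrite big_cons.
(* [w k j] is the k-th coefficient of the partial sum of degree j. Averaging over j <= n gives the
   Cesaro weight 1 - k/(n+1) on b_k. *)
pose w (k j : nat) : C := if (k <= j)%N then b k else 0.
pose c (n k : nat) : C := n.+1%:R^-1 * \sum_(j < n.+1) w k j.
have c_big n k : (n.+1 <= k)%N -> c n k = 0.
  move=> nk; rewrite /c big1 ?mulr0// => j _; rewrite /w leqNgt.
  by rewrite (leq_trans (ltn_ord j) nk).
have sc n : abs_summable (c n) by apply: (@abs_summable_finite _ _ n.+1); exact: c_big.
pose F n := psum (c n).
have [DF tF] : (forall n, disk_algebra (F n)) /\ (forall n, taylor (F n) = c n).
  by split=> n; have [] := disk_algebra_abs_summable (sc n).
have c_cvg k : c n k @[n --> \oo] --> b k.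
  have : w k j @[j --> \oo] --> b k.
    apply/cvg_cabsP => e e0; exists k => // j /= kj.
    by rewrite /w kj subrr cabs0.
  by move=> /cesaroC; apply: cvg_trans.
(* The kernel centred at -theta is expanded in characters with coefficients e^(i(j-l) theta). [phi]
   kills the terms with j < l, and row j becomes the partial sum of degree j at e^(i theta). *)
have Fcircle n theta : F n (expi theta) = phi (fejer_L1 n.+1 (- theta)).
  have E : fejer_L1 n.+1 (- theta) = (fun t => n.+1%:R^-1 *
      (fun t => \sum_(j < n.+1) (fun t => \sum_(l < n.+1)
        (fun t => expi ((j%:R - l%:R) * theta) * char_fun (j%:Z - l%:Z) t) t) t) t).
    apply/funext => t; rewrite /fejer_L1 -opprD fejerN fejerE; congr (_ * _).
    apply: eq_bigr => j _; apply: eq_bigr => l _; rewrite /char_fun -expiD.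
    by rewrite rmorphB /=; congr expi; ring.
  have i1 (j l : 'I_n.+1) : L1T (fun t => expi ((j%:R - l%:R) * theta) * char_fun (j%:Z - l%:Z) t).
    exact: L1TZ (L1T_char _).
  have i2 (j : 'I_n.+1) := phi_sum _ (index_enum 'I_n.+1) _ (i1 j).
  have i3 := phi_sum _ (index_enum 'I_n.+1) _ (fun j => (i2 j).2).
  rewrite E phiZ; last exact: i3.2.
  rewrite i3.1 /F /psum (@csum_finite _ _ n.+1); last by move=> k /c_big ->; rewrite mul0r.
  have -> : \sum_(k < n.+1) c n k * expi theta ^+ k =
      n.+1%:R^-1 * \sum_(j < n.+1) \sum_(k < n.+1) w k j * expi theta ^+ k.
    rewrite exchange_big mulr_sumr; apply: eq_bigr => k _.
    by rewrite /c -mulrA mulr_suml.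
  congr (_ * _); apply: eq_bigr => j _; rewrite (i2 j).1.
  rewrite [RHS](@sum_lower_triangle _ n.+1 (fun k => b k * expi theta ^+ k) j); first last.
  - move=> l jl; rewrite (phiZ _ _ (L1T_char (j%:Z - l%:Z))).
    rewrite phi_char (_ : j%:Z - l%:Z = - (l - j)%N%:Z); last by rewrite -subzn ?opprB// ltnW.
    by move: jl; rewrite -subn_gt0; case: (l - j)%N => // m _; rewrite -NegzE mulr0.
  - move=> l lj; rewrite (phiZ _ _ (L1T_char (j%:Z - l%:Z))).
    by rewrite phi_char subzn// expiX -natrB// mulrC.
  rewrite (big_ord_widen n.+1 (fun k => b k * expi theta ^+ k))// [RHS]big_mkcond.
  by apply: eq_bigr => k _; rewrite /w ltnS; case: ifP => // _; rewrite mul0r.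
(* [phi] has norm at most 2 and Fejer kernels have [l1norm] at most 1, so the polynomials are
   bounded on the circle, hence on the disk. *)
have Fb n : supnorm (F n) <= 2.
  apply: supnorm_le => z; apply: maximum_principle => // theta.
  rewrite Fcircle; apply: le_trans (phil _ (L1T_fejer _ _)) _.
  rewrite -[leRHS]mulr1 ler_wpM2l//; apply: le_trans (l1norm_le_ReIm (L1T_fejer _ _)) _.
  by rewrite l1ReIm_fejer// mulVf// gt_eqF// pi2_gt0.
have Fcvg s : pairK (F n) (ghat (trig_poly s)) @[n --> \oo] --> phi (trig_poly s).
  rewrite phi_trig (_ : (fun n => _) = (fun n => \sum_(p <- s) p.1 * taylor_int (F n) p.2)).
    elim: s => [|[x m] s IH].
      by rewrite big_nil (_ : (fun n => _) = (fun=> 0)); [exact: cvg_cst|apply/funext => n; rewrite big_nil].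
    rewrite big_cons (_ : (fun n => _) = (fun n => x * taylor_int (F n) m +
        \sum_(p <- s) p.1 * taylor_int (F n) p.2)); last by apply/funext => n; rewrite big_cons.
    apply: cvgD IH; apply: cvgM; first exact: cvg_cst.
    case: m => k /=; last exact: cvg_cst.
    by rewrite (_ : (fun n => _) = (fun n => c n k)); [exact: c_cvg|apply/funext => n; rewrite tF].
  by apply/funext => n; rewrite pairK_trig_poly.
(* The remainder of h enters once through [F n], of sup-norm at most 2, at a cost of 4 (e/6), and
   once through [phi], at a cost of 2 (e/6). *)
apply/ler_addgt0Pr => e e0; have e6 : 0 < e / 6 by rewrite divr_gt0.
have [s hs] := trig_poly_dense hi e6.
have qi := L1T_trig_poly s; have hqi := L1TB hi qi.
have phi_q : cabs (phi (trig_poly s)) <= 2 * M + 4 * (e / 6).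
  have h2 : cabs (pairK (F n) (ghat (trig_poly s))) @[n --> \oo] --> cabs (phi (trig_poly s)).
    by apply: cvg_cabs; exact: Fcvg.
  apply: (cvgr_to_le h2); exists 0%N => // n _.
  have -> : pairK (F n) (ghat (trig_poly s)) =
      pairK (F n) (ghat h) - pairK (F n) (ghat (fun t => h t - trig_poly s t)).
    have E := pairK_ghatD (DF n) qi hqi.
    rewrite (_ : (fun t => _ + _) = h) in E; first by rewrite E addrK.
    by apply/funext => t; rewrite addrC subrK.
  apply: le_trans (cabsB _ _) _; apply: lerD.
    by apply: le_trans (hM _ (DF n)) _; rewrite mulrC ler_wpM2r.
  have := cabs_pairK_ghat_le hqi (DF n) (fun z z1 => le_trans (supnorm_ub (DF n) z1) (Fb n)).
  move=> /le_trans; apply; lra.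
apply: le_trans phi_h _.
have -> : phi h = phi (trig_poly s) + phi (fun t => h t - trig_poly s t).
  rewrite -(phiD _ _ qi hqi); congr phi; apply/funext => t.
  by rewrite addrC subrK.
apply: le_trans (cabsD _ _) _.
have := phil _ hqi; lra.
Qed.

End NormingLemma.

(** * Passing between the modes of convergence *)

Section Summability.
Variable R : realType.
Local Notation C := R[i].
Implicit Types (f : C -> C) (g x : R -> C).

Lemma cvg_cabs_le (u : nat -> C) (l : C) (v : nat -> R) (K : R) :
  (forall n, cabs (u n - l) <= K * v n) -> v @ \oo --> 0 -> u @ \oo --> l.
Proof.
move=> uv v0; apply/cvg_cabs0P; apply: (squeeze_cvgr _ (cvg_cst 0) (h := fun n => K * v n)).
  by apply: nearW => n; rewrite cabs_ge0 uv.
by rewrite -[X in _ --> X](mulr0 K); apply: cvgM; [exact: cvg_cst|exact: v0].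
Qed.

Lemma continuous_psum_circle (c : nat -> C) : abs_summable c ->
  continuous (fun t : R => psum c (expi t)).
Proof.
move=> /disk_algebra_abs_summable[hf _]; have fc := continuous_circle_trace hf.
rewrite (_ : (fun t => _) = (fun t => psum c (expi (- t))) \o (fun t => - t)).
  move=> t; apply: (@continuous_comp _ _ _ (fun t : R => - t)); last exact: fc.
  by apply: cvgN; exact: cvg_id.
by apply/funext => t; rewrite /= opprK.
Qed.

Lemma ghat_partial_sum (c : nat -> C) N j :
  continuous (fun t : R => \sum_(k < N) c k * expi t ^+ k) /\
  ghat (fun t => \sum_(k < N) c k * expi t ^+ k) j = if (j < N)%N then c j else 0.
Proof.
elim: N => [|N [IHc IH]].
  rewrite (_ : (fun t => _) = (fun=> 0)); last by apply/funext => t; rewrite big_ord0.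
  split; first by move=> t; exact: cvg_cst.
  by have [_ ->] := H10bar0 R.
have -> : (fun t => \sum_(k < N.+1) c k * expi t ^+ k) = (fun t =>
    (fun t => \sum_(k < N) c k * expi t ^+ k) t + (fun t => c N * char_fun N t) t).
  by apply/funext => t; rewrite big_ord_recr /= expiX.
have chi : continuous (fun t : R => c N * char_fun N t).
  by move=> t; apply: cvgM; [exact: cvg_cst|exact: continuous_expiM].
split; first by move=> t; apply: cvgD; [exact: IHc|exact: chi].
rewrite (ghatD j (L1T_continuous IHc) (L1T_continuous chi)) IH.
rewrite (ghatZ _ j (L1T_char _ _)) ghat_char eqz_nat ltnS [in RHS]leq_eqVlt eq_sym.
have [->|_] := eqVneq j N; first by rewrite ltnn mulr1 add0r.
by rewrite mulr0 addr0.
Qed.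

(** Partial sums with more than j terms already have j-th coefficient c_j, and they converge
    uniformly on the circle, where taking a coefficient is continuous. *)
Lemma ghat_psum_circle (c : nat -> C) j : abs_summable c ->
  ghat (fun t => psum c (expi t)) j = c j.
Proof.
move=> sc; have Fc := continuous_psum_circle sc.
pose e_ (t : R) : C := expi (- (j%:R * t)).
have ei : L1T e_ by apply: L1T_continuous; exact: continuous_expiN.
have ghatE' h : ghat h j = L1_functional e_ h.
  rewrite /ghat /L1_functional; congr (_ * cint _ _); apply/funext => t.
  by rewrite mulrC.
pose v N := limn (series (fun k => cabs (c k))) - series (fun k => cabs (c k)) N.
have v0 : (2 * l1norm e_) * v N @[N --> \oo] --> 0.
  rewrite -[X in _ --> X](mulr0 (2 * l1norm e_)); apply: cvgM; first exact: cvg_cst.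
  rewrite -[X in _ --> X](subrr (limn (series (fun k => cabs (c k))))).
  by apply: cvgB; [exact: cvg_cst|exact: sc].
apply/eqP; rewrite -subr_eq0; apply/eqP/cabs0_eq/eqP.
rewrite eq_le cabs_ge0 andbT.
apply: (cvgr_to_ge v0); exists j.+1 => // N /= jN.
have [Pc PE] := ghat_partial_sum c N j; rewrite jN in PE.
rewrite -PE -(ghatB j (L1T_continuous Fc) (L1T_continuous Pc)) ghatE'.
apply: (L1_functional_le ei) => [t|t].
  by apply: cvgB; [exact: Fc|exact: Pc].
rewrite (_ : \sum_(k < N) _ = series (fun k => c k * expi t ^+ k) N); last first.
  by rewrite /series /= big_mkord.
apply: csum_tail_le sc => k.
by rewrite cabsM cabsX cabs_expi expr1n mulr1.
Qed.

(** Subtracting an element of [H10bar] changes no coefficient of nonnegative index, so the L^1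
    estimate applies to every representative of the class, in particular to nearly optimal ones. *)
Lemma cabs_pairK_le_dist x f : L1T x -> disk_algebra f ->
  cabs (pairK f (ghat x)) <= 2 * supnorm f * dist_H10bar x.
Proof.
move=> xi hf; have s0 := supnorm_ge0 hf.
have s1 : 0 < 2 * supnorm f + 1 by lra.
apply/ler_addgt0Pr => e e0; have [u [ui u0] hu] := dist_witness x (divr_gt0 e0 s1).
have -> : ghat x = ghat (fun t => x t - u t).
  by apply/funext => k; rewrite (ghatB k xi ui) u0 subr0.
have xui := L1TB xi ui.
apply: le_trans (cabs_pairK_ghat_le xui hf (fun z z1 => supnorm_ub hf z1)) _.
rewrite mulrAC; apply: le_trans (ler_wpM2l _ (ltW hu)) _; first by rewrite mulr_ge0.
rewrite mulrDr lerD2l mulrCA ger_pMr// ler_pdivrMr// mul1r; lra.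
Qed.

Lemma l1_summable_ghat (a : nat -> C) g : abs_summable a -> L1T g ->
  abs_summable (fun k => a k * ghat g k).
Proof.
move=> sa gi; apply: (@abs_summable_le _ _ (fun k => (2 * l1norm g * 1) * cabs (a k))).
  move=> k; rewrite cabsM mulrC ler_wpM2r ?cabs_ge0//.
  apply: (L1_functional_le gi); first exact: continuous_expiN.
  by move=> t; rewrite cabs_expi.
exact: is_cvg_seriesZ.
Qed.

Section Means.
Variable a : nat -> nat -> C.
Hypothesis sa : forall n, abs_summable (a n).

Definition circle_mean n g (t : R) : C :=
  csum (fun k => a n k * ghat g k * expi (k%:R * t)).

Lemma circle_meanE n g : circle_mean n g = (fun t => psum (fun k => a n k * ghat g k) (expi t)).
Proof.
apply/funext => t; rewrite /circle_mean /psum; congr csum; apply/funext => k.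
by rewrite expiX.
Qed.

Lemma L1T_circle_mean n g : L1T g -> L1T (circle_mean n g).
Proof.
move=> gi; rewrite circle_meanE; apply: L1T_continuous.
by apply: continuous_psum_circle; exact: l1_summable_ghat.
Qed.

Lemma ghat_circle_mean n g : L1T g -> ghat (circle_mean n g) = (fun k => a n k * ghat g k).
Proof.
move=> gi; apply/funext => k; rewrite circle_meanE ghat_psum_circle//.
exact: l1_summable_ghat.
Qed.

Lemma pairK_circle_mean_sub n f g : L1T g -> disk_algebra f ->
  pairK f (ghat (fun t => circle_mean n g t - g t)) =
  pairK f (fun k => a n k * ghat g k) - pairK f (ghat g).
Proof.
move=> gi hf; have Si := L1T_circle_mean n gi.
have E := pairK_ghatD hf (L1TB Si gi) gi.
rewrite (_ : (fun t => _ + _) = circle_mean n g) in E.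
  by rewrite -(ghat_circle_mean n gi) E addrK.
by apply/funext => t; rewrite subrK.
Qed.

Lemma dual_cvg_of_norm f (L : (C -> C) -> C) : disk_algebra f -> AD_dual L ->
  supnorm (fun z => multiplier (a n) f z - f z) @[n --> \oo] --> 0 ->
  L (multiplier (a n) f) @[n --> \oo] --> L f.
Proof.
move=> hf [LD LZ [M LM]]; apply: (@cvg_cabs_le _ _ _ M) => n.
have hm := multiplier_disk_algebra (@sa n) hf.
have hmf := disk_algebraB hm hf.
have -> : L (multiplier (a n) f) - L f = L (fun z => multiplier (a n) f z - f z).
  have E := LD _ _ hmf hf.
  rewrite (_ : _ \+ _ = multiplier (a n) f) in E; first by rewrite E addrK.
  by apply/funext => z; rewrite /= subrK.
exact: LM.
Qed.

(** Linearity is read on the integral form of the pairing, since [lim] alone is additive only where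
    the limits exist. *)
Lemma AD_dual_cmhat (mu : cmeasure R) : AD_dual (fun f => pairK f (cmhat mu)).
Proof.
split.
- move=> f g hf hg.
  rewrite (pairK_cmhat mu hf) (pairK_cmhat mu hg) (pairK_cmhat mu (disk_algebraD hf hg)).
  have E := cmeasure_functional_lin mu 1 (continuous_circle_trace hf) (continuous_circle_trace hg).
  rewrite [in RHS]mul1r in E; rewrite -E; congr cmeasure_functional; apply/funext => t.
  by rewrite mul1r.
- move=> c f hf; rewrite (pairK_cmhat mu hf) (pairK_cmhat mu (disk_algebraZ c hf)).
  have fc := continuous_circle_trace hf.
  have c0 : continuous (fun _ : R => 0 : C) by move=> t; exact: cvg_cst.
  have E k : continuous k -> cmeasure_functional mu (fun t => c * k t + 0) =
      c * cmeasure_functional mu k + cmeasure_functional mu (fun=> 0).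
    by move=> kc; exact: (cmeasure_functional_lin mu c kc c0).
  have Z0 : cmeasure_functional mu (fun=> 0) = 0.
    have := cmeasure_functional_lin mu 1 c0 c0.
    rewrite (_ : (fun t => _) = (fun=> 0)); last by apply/funext => t; rewrite mul1r addr0.
    by rewrite mul1r => /eqP; rewrite -subr_eq0 opprD addrA subrr add0r oppr_eq0 => /eqP.
  rewrite -[RHS]addr0 -[X in _ = _ + X]Z0 -(E _ fc); congr cmeasure_functional.
  by apply/funext => t; rewrite addr0.
- have [K hK] := cabs_pairK_cmhat_le mu; exists K => f hf.
  by apply: (hK f _ hf) => z; exact: supnorm_ub.
Qed.

Section WeakStar.
Hypothesis ws : forall g, L1T g -> forall f, disk_algebra f ->
  pairK f (fun k => a n k * ghat g k) @[n --> \oo] --> pairK f (ghat g).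

(** Convergent scalar sequences are bounded, which is the pointwise hypothesis of
    [bounded_multipliers]. *)
Lemma weak_star_bounded : exists2 M : R, 0 <= M & forall n f, disk_algebra f ->
  supnorm (multiplier (a n) f) <= M * supnorm f.
Proof.
apply: bounded_multipliers => // g gi f hf.
have /cvg_cabs h := ws gi hf.
have /cvg_seq_bounded[B [_ hB]] : cvgn (fun n => cabs (pairK f (fun k => a n k * ghat g k))).
  by apply/cvg_ex; exists (cabs (pairK f (ghat g))).
exists (B + 1) => n; apply: le_trans (ler_norm _) _.
by apply: hB => //; rewrite ltrDl.
Qed.

(** The function z^k paired with the k-th character gives exactly a_nk before the limit and 1 in the
    limit. *)
Lemma weak_star_coef k : a n k @[n --> \oo] --> (1 : C).
Proof.
have sd : abs_summable (fun j => (j == k)%:R : C).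
  apply: (@abs_summable_finite _ _ k.+1) => j kj.
  by rewrite gtn_eqF.
have [hf tf] := disk_algebra_abs_summable sd.
have := ws (L1T_char R k) hf; rewrite pairK_char /= tf eqxx.
apply: cvg_trans; apply: near_eq_cvg; apply: nearW => n.
by rewrite (pairK_multiplier (@sa n) _ hf) pairK_char /= (taylor_multiplier (@sa n) _ hf) tf eqxx mulr1.
Qed.

Lemma weak_star_norm f : disk_algebra f ->
  supnorm (fun z => multiplier (a n) f z - f z) @[n --> \oo] --> 0.
Proof.
move=> hf; have [M M0 hM] := weak_star_bounded.
apply/cvgrPdist_le => e e0; have e2 : 0 < e / 2 by rewrite divr_gt0.
have M1 : 0 < M + 1 by lra.
(* The approximation error is paid at most M times through the multiplier and once directly, which
   adds up to e/2. *)
have [c0 [N hc]] := polynomial_dense hf (divr_gt0 e2 M1).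
pose c k := if (k < N)%N then c0 k else 0.
have cN k : (N <= k)%N -> c k = 0 by rewrite /c ltnNge => ->.
have sc : abs_summable c by exact: abs_summable_finite cN.
have [hp tp] := disk_algebra_abs_summable sc.
have pE z : psum c z = \sum_(k < N) c0 k * z ^+ k.
  rewrite /psum (csum_finite (N := N)) => [|k /cN ->]; last by rewrite mul0r.
  by apply: eq_bigr => k _; rewrite /c ltn_ord.
have fp z : cabs z <= 1 -> cabs (f z - psum c z) <= e / 2 / (M + 1).
  by rewrite pE; exact: hc.
pose v n := \sum_(k < N) cabs (c k) * cabs (a n k - 1).
have v0 : v n @[n --> \oo] --> 0.
  rewrite /v; elim: (N) => [|m IH].
    by rewrite (_ : (fun n => _) = (fun=> 0)); [exact: cvg_cst|apply/funext => n; rewrite big_ord0].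
  rewrite (_ : (fun n => _) = (fun n => \sum_(k < m) cabs (c k) * cabs (a n k - 1) +
      cabs (c m) * cabs (a n m - 1))); last by apply/funext => n; rewrite big_ord_recr.
  rewrite -[X in _ --> X](addr0 0) -[X in _ --> _ + X](mulr0 (cabs (c m))).
  apply: cvgD; first exact: IH.
  apply: cvgM; first exact: cvg_cst.
  by apply/cvg_cabs0P; exact: weak_star_coef.
have /cvgrPdist_le/(_ _ e2) := v0; apply: filterS => n; rewrite !(distrC 0) !subr0 => vn.
have hT := multiplier_disk_algebra (@sa n) hf.
rewrite ger0_norm; last by apply: supnorm_ge0; exact: disk_algebraB.
have hfp := disk_algebraB hf hp.
apply: supnorm_le => z z1.
have -> : multiplier (a n) f z - f z = multiplier (a n) (fun z => f z - psum c z) z +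
    (multiplier (a n) (psum c) z - psum c z) - (f z - psum c z).
  have E := multiplierD (@sa n) hfp hp z1.
  rewrite (_ : (fun z => _ + _) = f) in E; first by rewrite E; ring.
  by apply/funext => w; rewrite subrK.
apply: le_trans (cabsB _ _) _; apply: le_trans (lerD (cabsD _ _) (fp _ z1)) _.
have H1 : cabs (multiplier (a n) (fun z => f z - psum c z) z) <= M * (e / 2 / (M + 1)).
  apply: le_trans (supnorm_ub (multiplier_disk_algebra (@sa n) hfp) z1) _.
  apply: le_trans (hM _ _ hfp) _; rewrite ler_wpM2l//; exact: supnorm_le.
have H2 : cabs (multiplier (a n) (psum c) z - psum c z) <= v n.
  rewrite /multiplier tp /psum !(csum_finite (N := N)); first last.
  - by move=> k /cN ->; rewrite mulr0 mul0r.
  - by move=> k /cN ->; rewrite mul0r.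
  rewrite -sumrB; apply: le_trans (cabs_sum _ _ _) _; apply: ler_sum => k _.
  rewrite (_ : _ - _ = c k * (a n k - 1) * z ^+ k); last by ring.
  rewrite cabsM cabsX (cabsM (c k)) ler_piMr ?mulr_ge0 ?cabs_ge0//.
  by rewrite exprn_ile1 ?cabs_ge0.
have H3 : M * (e / 2 / (M + 1)) + e / 2 / (M + 1) = e / 2 by field; lra.
have := ler_norm (v n); lra.
Qed.

(** [dist_le_pairK] requires a bound uniform over the disk algebra, not only limits for each f. The
    uniform bound on multipliers reduces g to a trigonometric polynomial, where finitely many a_nk
    matter. *)
Lemma weak_star_dist g : L1T g ->
  dist_H10bar (fun t => circle_mean n g t - g t) @[n --> \oo] --> 0.
Proof.
move=> gi; have [M M0 hM] := weak_star_bounded.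
apply/cvgrPdist_le => e e0; have e2 : 0 < e / 2 by rewrite divr_gt0.
(* [dist_le_pairK] doubles its constant, so pairings may cost e/2 per unit of sup-norm: e/4 for
   replacing g, being 2 times e/(8 (M + 1)) times M + 1, and e/4 for the polynomial, being
   [v n <= e / 8] times the coefficient bound 2. *)
have M8 : 0 < 8 * (M + 1) by lra.
have [s hs] := trig_poly_dense gi (divr_gt0 e0 M8).
have qi := L1T_trig_poly s; have gqi := L1TB gi qi.
pose v n := \sum_(p <- s) cabs p.1 * (if p.2 is Posz k then cabs (a n k - 1) else 0).
have v0 : v n @[n --> \oo] --> 0.
  rewrite /v; elim: (s) => [|[x m] r IH].
    by rewrite (_ : (fun n => _) = (fun=> 0)); [exact: cvg_cst|apply/funext => n; rewrite big_nil].
  rewrite (_ : (fun n => _) = (fun n => cabs x * (if m is Posz k then cabs (a n k - 1) else 0) +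
      \sum_(p <- r) cabs p.1 * (if p.2 is Posz k then cabs (a n k - 1) else 0))); last first.
    by apply/funext => n; rewrite big_cons.
  rewrite -[X in _ --> X](addr0 0) -[X in _ --> X + _](mulr0 (cabs x)).
  apply: cvgD IH; apply: cvgM; first exact: cvg_cst.
  case: m => k; last exact: cvg_cst.
  by apply/cvg_cabs0P; exact: weak_star_coef.
have e8 : 0 < e / 8 by rewrite divr_gt0.
have /cvgrPdist_le/(_ _ e8) := v0; apply: filterS => n; rewrite !(distrC 0) !subr0 => vn.
rewrite ger0_norm ?dist_ge0//.
have vn' := le_trans (ler_norm _) vn.
have vge0 : 0 <= v n.
  by apply: sumr_ge0 => -[x [k|k]] _ /=; rewrite mulr_ge0 ?cabs_ge0.
have -> : e = 2 * (e / 4 + 2 * (e / 8)) by field.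
apply: (@dist_le_pairK _ _ (e / 4 + 2 * (e / 8))); first exact: L1TB (L1T_circle_mean n gi) gi.
  by rewrite addr_ge0 ?mulr_ge0// ltW// divr_gt0.
move=> f hf; have hT := multiplier_disk_algebra (@sa n) hf; have hTf := disk_algebraB hT hf.
have f0 := supnorm_ge0 hf.
rewrite (pairK_circle_mean_sub n gi hf) (pairK_multiplier (@sa n) _ hf).
have split_g k : disk_algebra k -> pairK k (ghat g) =
    pairK k (ghat (fun t => g t - trig_poly s t)) + pairK k (ghat (trig_poly s)).
  move=> hk; rewrite -(pairK_ghatD hk gqi qi); congr (pairK _ (ghat _)).
  by apply/funext => t; rewrite subrK.
rewrite (split_g _ hT) (split_g _ hf) opprD addrACA mulrDl.
apply: le_trans (cabsD _ _) _; apply: lerD.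
  apply: le_trans (cabsB _ _) _.
  apply: le_trans (lerD (cabs_pairK_ghat_le gqi hT (fun z z1 => supnorm_ub hT z1))
    (cabs_pairK_ghat_le gqi hf (fun z z1 => supnorm_ub hf z1))) _.
  rewrite -mulrDr; apply: (@le_trans _ _ (2 * (e / (8 * (M + 1))) * ((M + 1) * supnorm f))).
    apply: ler_pM.
    - exact: mulr_ge0 (ler0n _ 2) (l1norm_ge0 _).
    - exact: addr_ge0 (supnorm_ge0 hT) f0.
    - by rewrite ler_wpM2l.
    - by rewrite mulrDl mul1r lerD2r hM.
  by rewrite le_eqVlt; apply/orP; left; apply/eqP; field; lra.
rewrite (pairK_trig_poly _ hT) (pairK_trig_poly _ hf) -sumrB.
apply: (@le_trans _ _ (v n * (2 * supnorm f))); last first.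
  by rewrite mulrA [2 * (e / 8)]mulrC ler_wpM2r// ler_wpM2r.
(* A nonnegative frequency contributes a_nk - 1 times a Taylor coefficient; a negative one pairs to
   0 with f and with its transform. *)
apply: le_trans (cabs_sum _ _ _) _; rewrite mulr_suml; apply: ler_sum => -[x [k|k]] _ /=.
  rewrite (taylor_multiplier (@sa n) k hf).
  rewrite (_ : _ - _ = x * (a n k - 1) * taylor f k); last by ring.
  rewrite cabsM (cabsM x) ler_wpM2l ?mulr_ge0 ?cabs_ge0//.
  by have [_ _ fb] := disk_algebra_expansion hf; exact: fb.
by rewrite subrr cabs0 !mulr0 mul0r.
Qed.

End WeakStar.

Lemma weak_star_of_dist g f : L1T g -> disk_algebra f ->
  dist_H10bar (fun t => circle_mean n g t - g t) @[n --> \oo] --> 0 ->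
  pairK f (fun k => a n k * ghat g k) @[n --> \oo] --> pairK f (ghat g).
Proof.
move=> gi hf; apply: (@cvg_cabs_le _ _ _ (2 * supnorm f)) => n.
rewrite -(pairK_circle_mean_sub n gi hf); apply: cabs_pairK_le_dist => //.
exact: L1TB (L1T_circle_mean n gi) gi.
Qed.

End Means.
End Summability.

Unset Implicit Arguments.

Theorem theorem4p4 (R : realType) (a : nat -> nat -> R[i]) :
  (forall n : nat, cvgn (series (fun k => cabs (a n k)))) ->
  [<->
  (* (i) weak convergence in A(D) *)
    (forall f, disk_algebra f -> forall L, AD_dual L ->
       L (fun z => csum (fun k => a n k * taylor f k * z ^+ k)) @[n --> \oo]
         --> L f);
  (* (ii) sup-norm convergence *)
    (forall f, disk_algebra f ->
       supnorm (fun z => csum (fun k => a n k * taylor f k * z ^+ k) - f z)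
         @[n --> \oo] --> 0);
  (* (iii) weak* convergence in K, for all mu in M(T) *)
    (forall mu : cmeasure R, forall f, disk_algebra f ->
       pairK f (fun k => a n k * cmhat mu k) @[n --> \oo] --> pairK f (cmhat mu));
  (* (iv) weak* convergence in K, for all g in L^1(T) *)
    (forall g, L1T g -> forall f, disk_algebra f ->
       pairK f (fun k => a n k * ghat g k) @[n --> \oo] --> pairK f (ghat g));
  (* (v) convergence in L^1(T) / conj(H^1_0) *)
    (forall g, L1T g ->
       dist_H10bar (fun t => csum (fun k => a n k * ghat g k * expi (k%:R * t))
                             - g t) @[n --> \oo] --> 0)].
Proof.
move=> sa; tfae.
(* Weak convergence is tested only on functionals coming from L^1 densities, seen as measures; these
   already give (iv), which forces norm convergence. *)
- move=> weak f hf; apply: (weak_star_norm sa _ hf) => g gi f' hf'.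
  have [mu <-] := L1_cmeasure gi.
  have := weak f' hf' _ (AD_dual_cmhat mu); apply: cvg_trans; apply: near_eq_cvg.
  by apply: nearW => n; rewrite (pairK_multiplier (sa n) _ hf').
- move=> norm mu f hf.
  have := dual_cvg_of_norm sa hf (AD_dual_cmhat mu) (norm f hf); apply: cvg_trans.
  apply: near_eq_cvg; apply: nearW => n.
  by rewrite (pairK_multiplier (sa n) _ hf).
- move=> weak_star g gi f hf; have [mu <-] := L1_cmeasure gi.
  exact: weak_star.
- by move=> weak_star g gi; exact: weak_star_dist sa weak_star _ gi.
(* The cycle closes through two intermediate statements: distances give (iv), (iv) gives norm
   convergence, and a bounded functional preserves it. *)
- move=> dist f hf L hL; apply: (dual_cvg_of_norm sa hf hL).
  apply: (weak_star_norm sa _ hf) => g gi f' hf'.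
  exact: (weak_star_of_dist sa gi hf' (dist g gi)).
Qed.
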